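(* Let $A$ be a compactly generated locally compact abelian group and $M$ a sheer LC $A$-module. For a closed submodule $N$ of $M$, let $N^\boxminus=\Omega^\sharp(N)$ and let $N^\boxplus$ be the inverse image in $M$ of $\mathrm{W}^\flat(M/N)\subseteq M/N$. Then $N^\boxminus\subseteq N\subseteq N^\boxplus$, $N/N^\boxminus$ is purely discrete, and $N^\boxplus/N$ is compact parafinite. Moreover $N^\boxminus$ is sheer and is maximal among sheer closed submodules contained in $N$, and $N^\boxplus$ is sheer and is minimal among sheer closed submodules containing $N$. Finally, if $N_1\subseteq N_2$ are closed submodules then $N_1^\boxminus\subseteq N_2^\boxminus$ and $N_1^\boxplus\subseteq N_2^\boxplus$.
   Context: An LC $A$-module is an LCA group with a continuous action of $A$ by topological automorphisms. Compact parafinite: compact, no nonzero finite quotient module; purely discrete: discrete, no nonzero finite submodule; $\mathrm{W}^\flat(M)$ = sum of compact parafinite submodules; $\Omega^\sharp(M)$ = intersection of open submodules $U$ with $M/U$ purely discrete; sheer means $\mathrm{W}^\flat(M)=0$ and $\Omega^\sharp(M)=M$. *)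

(* Defs.v *)
From HB Require Import structures.
From mathcomp Require Import all_boot all_order all_algebra.
From mathcomp Require Import all_classical all_reals all_analysis.
Set Implicit Arguments. Unset Strict Implicit. Unset Printing Implicit Defensive.
Import Order.TTheory GRing.Theory Num.Theory.
Local Open Scope classical_set_scope.
Local Open Scope ring_scope.

Definition LCA (G : topologicalZmodType) : Prop :=
  hausdorff_space G /\ locally_compact [set: G].

Definition compactly_generated (G : topologicalZmodType) : Prop :=
  exists C : set G, compact C /\
    forall g : G, exists s : seq G,
      (forall c, c \in s -> C c \/ C (- c)) /\ g = \sum_(c <- s) c.

Definition LC_action (A M : topologicalZmodType) (act : A -> M -> M) : Prop :=
  continuous (fun p : A * M => act p.1 p.2) /\
  (forall a x y, act a (x + y) = act a x + act a y) /\
  (forall x, act 0 x = x) /\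
  (forall a b x, act (a + b) x = act a (act b x)).

Definition LC_module (A M : topologicalZmodType) (act : A -> M -> M) : Prop :=
  LCA A /\ LCA M /\ LC_action act.

Section Subquotients.
Variables (A M : topologicalZmodType) (act : A -> M -> M).

Definition sumset (X Y : set M) : set M :=
  [set z | exists x y, X x /\ Y y /\ z = x + y].

Fixpoint sum_sets (S : nat -> set M) (n : nat) : set M :=
  match n with
  | 0 => [set 0]
  | n'.+1 => sumset (sum_sets S n') (S n')
  end.

Definition submod (S : set M) : Prop :=
  S 0 /\ (forall x y, S x -> S y -> S (x - y)) /\ (forall a x, S x -> S (act a x)).

Definition closed_submod (S : set M) : Prop := closed S /\ submod S.

(* Throughout, a pair (L, K) of closed submodules with K `<=` L stands for
   the subquotient LC A-module L / K (subspace then quotient topology).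
   Submodules of L/K correspond to submodules S of M with K `<=` S `<=` L. *)
Definition between (K S L : set M) : Prop := K `<=` S /\ S `<=` L.

Definition rel_open (L S : set M) : Prop :=
  exists V : set M, open V /\ V `&` L = S.

(* L/K is discrete: {0} = K/K is open in L/K, i.e. K is open in L. *)
Definition quot_discrete (L K : set M) : Prop := rel_open L K.

(* L/K is compact (quotient topology): every cover of L/K by open sets has a
   finite subcover; open sets of L/K pull back to (U `&` L) + K, U open in M. *)
Definition quot_compact (L K : set M) : Prop :=
  forall (I : Type) (U : I -> set M), (forall i, open (U i)) ->
    L `<=` \bigcup_i sumset (U i) K ->
    exists F : set I, finite_set F /\ L `<=` \bigcup_(i in F) sumset (U i) K.

Definition quot_finite (L S : set M) : Prop :=
  exists F : set M, finite_set F /\ F `<=` L /\ L `<=` sumset F S.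

(* L/K compact parafinite: compact, and no nonzero finite quotient module
   (quotients by closed submodules S/K, K `<=` S `<=` L). *)
Definition compact_parafinite (L K : set M) : Prop :=
  quot_compact L K /\
  forall S, closed_submod S -> between K S L -> quot_finite L S -> S = L.

(* L/K purely discrete: discrete, and no nonzero finite submodule. *)
Definition purely_discrete (L K : set M) : Prop :=
  quot_discrete L K /\
  forall S, submod S -> between K S L -> quot_finite S K -> S = K.

(* Inverse image in L of W^flat(L/K): the sum of all compact parafinite
   submodules S/K of L/K (finite sums), pulled back to L. *)
Definition Wflat_pre (L K : set M) : set M :=
  [set x | exists (n : nat) (S : nat -> set M),
     (forall i, (i < n)%N ->
        closed_submod (S i) /\ between K (S i) L /\ compact_parafinite (S i) K) /\
     sumset K (sum_sets S n) x].

(* Inverse image in L of Omega^sharp(L/K): the intersection (inside L/K) of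
   all open submodules S/K of L/K with (L/K)/(S/K) = L/S purely discrete. *)
Definition Omega_pre (L K : set M) : set M :=
  [set x | L x /\ forall S, submod S -> between K S L -> rel_open L S ->
                              purely_discrete L S -> S x].

Definition sheer (L K : set M) : Prop :=
  Wflat_pre L K = K /\ Omega_pre L K = L.

End Subquotients.

(* Submodule N of M regarded as an LC A-module: the pair (N, {0}). *)
Definition Nminus (A M : topologicalZmodType) (act : A -> M -> M) (N : set M) : set M :=
  Omega_pre act N [set 0].
Definition Nplus (A M : topologicalZmodType) (act : A -> M -> M) (N : set M) : set M :=
  Wflat_pre act [set: M] N.

(* Main.v *)
(** The submodule [N^boxminus] is the least open submodule of [N] with purely
    discrete quotient, and [N^boxplus] is the greatest submodule of [M] that is
    compact parafinite modulo [N]; both classes are closed under extensions, and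
    everything follows formally except that [N^boxplus] satisfies
    [Omega = N^boxplus] and is minimal.  These two points are the following dual
    vanishing statements ([discrete_trivial] and [cocompact_trivial]):
    - if [M / U] has [Omega = M / U], [E / U] is purely discrete and [M / E] has
      [W = 0], then [E = U];
    - if [W (Q) = 0], [Omega (S) = S] and [Q / S] is compact parafinite, then
      [Q = S].
    The hypotheses on [Omega] and [W] pass to the action of any subgroup of [A],
    because the canonical submodules are stable under the commuting operators.
    Each statement is then proved for the trivial group, for one automorphism,
    and finally for [A] using a compact set of generators.  For the trivial
    group, [Omega (L) = L] says that every quotient of [L] by an open subgroup is
    torsion.  A compactly generated open subgroup has a proper additive chart to
    some [R^n], obtained from a lattice by Hyers' averaging, and torsion makes
    it onto.  The kernels of the charts make up the closed subgroup of the elements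
    whose multiples stay bounded; for a compact open subgroup [C] of it,
    Willis' tidying shows that the elements with bounded forward orbit and those
    with bounded backward orbit generate an open subgroup, while an element with
    both orbits bounded is periodic modulo the largest invariant subgroup of
    [C]. *)
Require Import Defs.
From HB Require Import structures.
From mathcomp Require Import all_boot all_order all_algebra.
From mathcomp Require Import all_classical all_reals all_analysis.
From mathcomp Require Import zify ring lra.
From mathcomp Require Import Rstruct.
Set Implicit Arguments. Unset Strict Implicit. Unset Printing Implicit Defensive.
Import Order.TTheory GRing.Theory Num.Theory.
Local Open Scope classical_set_scope.
Local Open Scope ring_scope.

(** No quotient group is formed: [bdd U X] says that [X] is relatively compact modulo [U],
    [ropen L S] that [S] is open in [L], and [fin_over S X] that [X] meets only finitely many cosets
    of [S]. One clash is used throughout: a set that is compact modulo [U] has finite image in a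
    discrete quotient, while both classes of modules are defined by the absence of finite pieces.
    The obstacle is that a subgroup of finite index, or a finite subgroup, that is stable under one
    automorphism need not be stable under [A]. The hypotheses on Omega and W restrict to subgroups
    of [A], but being purely discrete or parafinite does not. On the discrete side this is repaired
    by dividing by all periodic elements; the result, that every element is periodic under each [a],
    is turned into finite orbits of [A]. On the compact side one proves that W vanishes on [Q / S]
    for each cyclic group, and then builds a finite index subgroup that is stable under a
    neighbourhood of zero in [A] and under finitely many further elements. *)

(** * Identities in abelian groups by reflection *)

Inductive zexpr :=
  ZVar of nat | ZZero | ZAdd of zexpr & zexpr | ZOpp of zexpr
| ZMuln of zexpr & nat.

Fixpoint zeval (M : zmodType) (e : seq M) (t : zexpr) : M :=
  match t with
  | ZVar i => nth 0 e i
  | ZZero => 0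
  | ZAdd t1 t2 => zeval e t1 + zeval e t2
  | ZOpp t1 => - zeval e t1
  | ZMuln t1 n => zeval e t1 *+ n
  end.

(** The raw operations on integers are used, so that comparing coefficients is a closed
    computation. *)
Fixpoint zcoef (t : zexpr) (i : nat) : int :=
  match t with
  | ZVar j => Posz (i == j)
  | ZZero => Posz 0
  | ZAdd t1 t2 => intZmod.addz (zcoef t1 i) (zcoef t2 i)
  | ZOpp t1 => intZmod.oppz (zcoef t1 i)
  | ZMuln t1 n => iter n (intZmod.addz (zcoef t1 i)) (Posz 0)
  end.

Lemma zevalE (M : zmodType) (e : seq M) t :
  zeval e t = \sum_(i < size e) nth 0 e i *~ zcoef t i.
Proof.
elim: t => [j||t1 IH1 t2 IH2|t IH|t IH n] /=.
- have [ltj|lej] := ltnP j (size e).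
    rewrite (bigD1 (Ordinal ltj)) //= eqxx mulr1z big1 ?addr0 // => i.
    by rewrite -val_eqE /= => /negPf ->.
  rewrite nth_default // big1 // => i _.
  by rewrite ltn_eqF ?mulr0z // (leq_trans (ltn_ord i)).
- by rewrite big1.
- rewrite IH1 IH2 -big_split; apply: eq_bigr => i _ /=.
  exact: esym (mulrzDr _ _ _).
- by rewrite IH -sumrN; apply: eq_bigr => i _; exact: esym (mulrNz _ _).
- rewrite IH -sumrMnl; apply: eq_bigr => i _.
  elim: n => [|n IHn] /=; first by rewrite mulr0n mulr0z.
  by rewrite mulrS IHn; exact: esym (mulrzDr _ _ _).
Qed.

Lemma zmod_correct (M : zmodType) (e : seq M) t1 t2 :
  all (fun i => zcoef t1 i == zcoef t2 i) (iota 0 (size e)) ->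
  zeval e t1 = zeval e t2.
Proof.
move=> /allP H; rewrite !zevalE; apply: eq_bigr => i _.
by rewrite (eqP (H i _)) // mem_iota add0n ltn_ord.
Qed.

(* Atoms are compared up to unification, as the same element may be displayed
   through different paths of the algebraic hierarchy. *)
Ltac zindex e t :=
  lazymatch e with
  | cons ?a ?e1 =>
      match constr:(Set) with
      | _ => let _ := match constr:(Set) with _ => unify a t end in constr:(O)
      | _ => let i := zindex e1 t in constr:(S i)
      end
  end.
Ltac isnatcst n :=
  lazymatch n with
  | O => constr:(true)
  | S ?m => isnatcst m
  | _ => constr:(false)
  end.
Ltac zatom e t :=
  match constr:(Set) with
  | _ => let _ := zindex e t in e
  | _ => constr:(cons t e)
  end.
Ltac zatoms e t :=
  lazymatch t with
  | @GRing.zero _ => e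
  | @GRing.add _ ?a ?b => let e1 := zatoms e a in zatoms e1 b
  | @GRing.opp _ ?a => zatoms e a
  | @GRing.natmul _ ?a ?n =>
      lazymatch isnatcst n with true => zatoms e a | _ => zatom e t end
  | _ => zatom e t
  end.
Ltac zreify e t :=
  lazymatch t with
  | @GRing.zero _ => constr:(ZZero)
  | @GRing.add _ ?a ?b =>
      let x := zreify e a in let y := zreify e b in constr:(ZAdd x y)
  | @GRing.opp _ ?a => let x := zreify e a in constr:(ZOpp x)
  | @GRing.natmul _ ?a ?n =>
      lazymatch isnatcst n with
      | true => let x := zreify e a in constr:(ZMuln x n)
      | _ => let i := zindex e t in constr:(ZVar i)
      end
  | _ => let i := zindex e t in constr:(ZVar i)
  end.
Ltac zmod :=
  lazymatch goal with
  | |- @eq ?T ?a ?b =>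
      let e0 := zatoms (@nil T) a in
      let e := zatoms e0 b in
      let x := zreify e a in let y := zreify e b in
      refine (@zmod_correct _ e x y _); vm_compute; reflexivity
  end.

Notation "X `+ Y" := (sumset X Y) (at level 50, left associativity,
  format "X  `+  Y") : classical_set_scope.

(** * Subgroups *)

Definition subg (M : topologicalZmodType) (S : set M) : Prop :=
  S 0 /\ forall x y, S x -> S y -> S (x - y).

Section SubgroupTheory.
Variables (M : topologicalZmodType) (S : set M).
Hypothesis subgS : subg S.

Lemma subg0 : S 0. Proof. exact: subgS.1. Qed.
Lemma subgB x y : S x -> S y -> S (x - y). Proof. exact: subgS.2. Qed.
Lemma subgN x : S x -> S (- x).
Proof. by move=> Sx; rewrite -sub0r; apply: subgB => //; exact: subg0. Qed.
Lemma subgD x y : S x -> S y -> S (x + y).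
Proof. by move=> Sx Sy; rewrite -[y]opprK; apply: subgB => //; exact: subgN. Qed.
Lemma subgMn x n : S x -> S (x *+ n).
Proof.
move=> Sx; elim: n => [|n IHn]; first by rewrite mulr0n; exact: subg0.
by rewrite mulrS; apply: subgD.
Qed.
Lemma subgMz x k : S x -> S (x *~ k).
Proof.
by move=> Sx; case: k => n; [exact: subgMn|rewrite NegzE mulrNz; exact/subgN/subgMn].
Qed.
Lemma subg_sum (I : Type) (r : seq I) (F : I -> M) :
  (forall i, S (F i)) -> S (\sum_(i <- r) F i).
Proof.
by move=> SF; elim/big_ind: _ => // [|x y]; [exact: subg0|exact: subgD].
Qed.
End SubgroupTheory.

Lemma subgI (M : topologicalZmodType) (S T : set M) : subg S -> subg T -> subg (S `&` T).
Proof.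
move=> gS gT; split; first by split; exact: subg0.
by move=> x y [Sx Tx] [Sy Ty]; split; apply: subgB.
Qed.

Lemma subg_bigcap (M : topologicalZmodType) (F : set (set M)) :
  (forall S, F S -> subg S) -> subg [set x | forall S, F S -> S x].
Proof.
move=> gF; split=> [S /gF[]//|x y Fx Fy S FS].
by apply: subgB (gF _ FS) _ _ _ _; [exact: Fx|exact: Fy].
Qed.

(** * Finite index *)

(** Finite index, but for an arbitrary set [X]: it is also applied to orbits and to compact
    pieces. *)
Definition fin_over (M : topologicalZmodType) (S X : set M) : Prop :=
  exists s : seq M, (forall y, y \in s -> X y) /\
    forall x, X x -> exists2 y, y \in s & S (x - y).

Section FiniteIndex.
Variable M : topologicalZmodType.
Implicit Types (S T X Y : set M).

(** Points sharing a label are congruent modulo [S], so one point of each nonempty cell suffices.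
    This moves representatives from an ambient set into [X]. *)
Lemma fin_cells (T : eqType) S X (s : seq T) (R : T -> M -> Prop) :
  (forall x, X x -> exists2 y, y \in s & R y x) ->
  (forall y x x', R y x -> R y x' -> X x -> X x' -> S (x - x')) ->
  fin_over S X.
Proof.
elim: s X => [|y s IHs] X cov sep.
  by exists [::]; split=> // x /cov[].
have [] := IHs [set x | X x /\ ~ R y x].
- move=> x [Xx nR]; have [z] := cov x Xx; rewrite inE => /predU1P[->//|zs Rz].
  by exists z.
- by move=> z x x' Rx Rx' [Xx _] [Xx' _]; apply: sep Rx Rx' Xx Xx'.
move=> t [tX tcov].
have [[x0 [Xx0 Rx0]]|nex] := pselect (exists x0, X x0 /\ R y x0).
  exists (x0 :: t); split=> [z|x Xx]; first by rewrite inE => /predU1P[->//|/tX[]].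
  have [Rx|nRx] := pselect (R y x).
    by exists x0; [rewrite mem_head|apply: sep Rx Rx0 Xx Xx0].
  by have [z zt Sz] := tcov x (conj Xx nRx); exists z => //; rewrite inE zt orbT.
exists t; split=> [z /tX[]//|x Xx]; apply: tcov; split=> // Rx.
by apply: nex; exists x.
Qed.

Lemma fin_overP S X (s : seq M) : subg S ->
  (forall x, X x -> exists2 y, y \in s & S (x - y)) -> fin_over S X.
Proof.
move=> gS cov; apply: (@fin_cells _ S X s (fun y x => S (x - y))) => //.
move=> y x x' Sx Sx' _ _.
by rewrite (_ : x - x' = (x - y) - (x' - y)); [apply: subgB|zmod].
Qed.

Lemma fin_overS S S' X X' : subg S' -> S `<=` S' -> X' `<=` X ->
  fin_over S X -> fin_over S' X'.
Proof.
move=> gS' SS' XX' [s [_ cov]]; apply: (@fin_overP _ _ s) => // x /XX' /cov[y ys].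
by move=> /SS' Sy; exists y.
Qed.

Lemma fin_over_trans S T X : subg S -> T 0 -> fin_over S T -> fin_over T X ->
  fin_over S X.
Proof.
move=> gS T0 [s [_ scov]] [t [_ tcov]].
apply: (@fin_overP _ _ [seq a + b | a <- s, b <- t]) => // x /tcov[b bt Tb].
have [a as_ Sa] := scov _ Tb; exists (a + b); first exact: allpairs_f.
by rewrite (_ : x - (a + b) = x - b - a); last zmod.
Qed.

Lemma fin_overI S T X : subg S -> subg T -> fin_over S X -> fin_over T X ->
  fin_over (S `&` T) X.
Proof.
move=> gS gT [s [_ scov]] [t [_ tcov]].
apply: (@fin_cells _ _ X [seq (a, b) | a <- s, b <- t]
  (fun p x => S (x - p.1) /\ T (x - p.2))).
  move=> x Xx; have [a as_ Sa] := scov _ Xx; have [b bt Tb] := tcov _ Xx.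
  by exists (a, b) => //; exact: (allpairs_f pair).
move=> [a b] x x' /= [Sa Tb] [Sa' Tb'] _ _; split.
  by rewrite (_ : x - x' = (x - a) - (x' - a)); [apply: subgB|zmod].
by rewrite (_ : x - x' = (x - b) - (x' - b)); [apply: subgB|zmod].
Qed.

Lemma fin_over_sum S T X : subg S -> subg T -> S `<=` T ->
  fin_over S X -> fin_over T (X `+ T).
Proof.
move=> gS gT ST [s [_ scov]]; apply: (@fin_overP _ _ s) => //.
move=> _ [x [t [Xx [Tt ->]]]]; have [y ys /ST Sy] := scov _ Xx; exists y => //.
by rewrite (_ : x + t - y = x - y + t); [apply: subgD|zmod].
Qed.

Lemma pigeonhole (T : eqType) (s : seq T) (c : nat -> T) :
  (forall i, c i \in s) -> exists i j, (i < j <= size s)%N /\ c i = c j.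
Proof.
move=> cP.
pose h (i : 'I_(size s).+1) : 'I_(size s) := Ordinal
  (n:=size s) (m:=index (c i) s) (eq_ind_r is_true (cP i) (index_mem (c i) s)).
have /injectivePn[i [j nij hij]] : ~~ injectiveb h.
  by apply/negP => /injectiveP /leq_card; rewrite !card_ord ltnn.
have cij : c i = c j.
  have := congr1 val hij => /= /(congr1 (nth (c 0) s)).
  by rewrite !nth_index.
have [ltij|ltji|/val_inj eij] := ltngtP i j.
- by exists i, j; rewrite ltij -ltnS ltn_ord.
- by exists j, i; rewrite ltji -ltnS ltn_ord.
- by rewrite eij eqxx in nij.
Qed.

(** The bound [m] does not depend on the sequence; this is what yields a uniform exponent below. *)
Lemma fin_over_pigeon S X : subg S -> fin_over S X ->
  exists m, forall z : nat -> M, (forall i, X (z i)) ->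
    exists i j, (i < j <= m)%N /\ S (z j - z i).
Proof.
move=> gS [s [_ scov]]; exists (size s) => z Xz.
have /choice[c cP] : forall i, exists y, y \in s /\ S (z i - y).
  by move=> i; have [y ys Sy] := scov _ (Xz i); exists y.
have [i [j [ltij cij]]] := pigeonhole (fun i => (cP i).1).
exists i, j; split=> //; rewrite (_ : z j - z i = (z j - c j) - (z i - c i)).
  by apply: subgB => //; [exact: (cP j).2|exact: (cP i).2].
by rewrite cij; zmod.
Qed.

Lemma fin_over_exp S X : subg S -> subg X -> fin_over S X ->
  exists2 N, (0 < N)%N & forall x, X x -> S (x *+ N).
Proof.
(* The exponent found for one element is some [j - i] at most [m], hence a divisor of the factorial
   of [m]. *)
move=> gS gX /(fin_over_pigeon gS)[m mP]; exists (m`!)%N; first exact: fact_gt0.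
move=> x Xx; have [|i [j [/andP[ltij lejm]]]] := mP (fun i => x *+ i).
  by move=> i; apply: subgMn.
rewrite -mulrnBr; last exact: ltnW.
move=> Sij; have /dvdnP[q ->] : (j - i %| m`!)%N.
  by rewrite dvdn_fact // subn_gt0 ltij /= (leq_trans _ lejm) // leq_subr.
by rewrite mulnC mulrnA; apply: subgMn.
Qed.

End FiniteIndex.

(** * Compactness in topological abelian groups *)

Section Topology.
Variable M : topologicalZmodType.
Implicit Types (C K L O S U X Y Z : set M) (x y z : M).

Lemma nbhs0_shift x O : nbhs (0 : M) O -> nbhs x [set y | O (y - x)].
Proof.
move=> nO; have /= := @sub_continuous M (x, x) O.
rewrite subrr => /(_ nO) [[A B] /= [nA nB] AB].
by apply: filterS nA => y Ay; apply: (AB (y, x)); split=> //; exact: nbhs_singleton.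
Qed.

Lemma nbhs_shift0 x N : nbhs x N -> nbhs (0 : M) [set o | N (x + o)].
Proof.
move=> nN; have /= := @add_continuous M (x, 0) N.
rewrite addr0 => /(_ nN) [[A B] /= [nA nB] AB].
by apply: filterS nB => y By; apply: (AB (x, y)); split=> //; exact: nbhs_singleton.
Qed.

Lemma nbhs0_opp O : nbhs (0 : M) O -> nbhs (0 : M) [set x | O (- x)].
Proof. by move=> nO; have /= := @opp_continuous M 0 O; rewrite oppr0; exact. Qed.

Lemma nbhs0_shiftN x O : nbhs (0 : M) O -> nbhs x [set y | O (x - y)].
Proof.
move=> /nbhs0_opp /(nbhs0_shift x); apply: filterS => y /=.
by rewrite opprB.
Qed.

Lemma nbhs0_split O : nbhs (0 : M) O -> exists O', [/\ nbhs (0 : M) O',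
  forall x y, O' x -> O' y -> O (x + y) & forall x, O' x -> O' (- x)].
Proof.
move=> nO; have /= := @add_continuous M (0, 0) O.
rewrite addr0 => /(_ nO) [[A B] /= [nA nB] AB].
have nAB : nbhs (0 : M) (A `&` B) by exact: filterI.
exists ((A `&` B) `&` [set x | (A `&` B) (- x)]); split.
- by apply: filterI => //; exact: (nbhs0_opp nAB).
- by move=> x y [[Ax _] _] [[_ By] _]; exact: (AB (x, y)).
- by move=> x [ABx ABNx]; split=> //=; rewrite opprK.
Qed.

Lemma nbhs0_split3 O : nbhs (0 : M) O -> exists O', [/\ nbhs (0 : M) O', O' `<=` O,
  (forall x, O' x -> O' (- x)), (forall x y, O' x -> O' y -> O (x + y)) &
  (forall x y z, O' x -> O' y -> O' z -> O (x + y + z))].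
Proof.
move=> /nbhs0_split [ O1 [nO1 O1D O1N]]; have [ O2 [nO2 O2D O2N]] := nbhs0_split nO1.
have O20 := nbhs_singleton nO2.
have H x y z t : O2 x -> O2 y -> O2 z -> O2 t -> O (x + y + z + t).
  by move=> ? ? ? ?; rewrite -addrA; apply: O1D; apply: O2D.
exists O2; split=> //.
- by move=> x Ox; have := H _ _ _ _ Ox O20 O20 O20; rewrite !addr0.
- by move=> x y Ox Oy; have := H _ _ _ _ Ox Oy O20 O20; rewrite !addr0.
- by move=> x y z Ox Oy Oz; have := H _ _ _ _ Ox Oy Oz O20; rewrite !addr0.
Qed.

Lemma nbhs0_mulrn n O : nbhs (0 : M) O -> exists2 O', nbhs (0 : M) O' &
  forall x, O' x -> O (x *+ n).
Proof.
elim: n O => [|n IHn] O nO.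
  exists O => // x _; rewrite mulr0n; exact: nbhs_singleton.
have [ O1 [nO1 O1D _]] := nbhs0_split nO; have [ O2 nO2 O2n] := IHn _ nO1.
exists (O1 `&` O2); first exact: filterI.
by move=> x [ O1x O2x]; rewrite mulrS; apply: O1D => //; apply: O2n.
Qed.

Lemma closure_subg S : subg S -> subg (closure S).
Proof.
move=> gS; split; first by apply: subset_closure; exact: subg0.
move=> x y clx cly N /= nN; have /= := @sub_continuous M (x, y) N nN.
move=> [[A B] /= [nA nB] AB].
have [a [Sa Aa]] := clx _ nA; have [b [Sb Bb]] := cly _ nB.
by exists (a - b); split; [apply: subgB|exact: (AB (a, b))].
Qed.

Lemma closedP S : closed S <->
  forall x, (forall O, nbhs (0 : M) O -> exists2 y, S y & O (y - x)) -> S x.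
Proof.
split=> [cS x H|H x clx].
  apply: cS => N nN; have [y Sy Oy] := H _ (nbhs_shift0 nN).
  by exists y; split=> //; move: Oy => /=; rewrite addrC subrK.
apply: H => O nO; have [y [Sy Oy]] := clx _ (nbhs0_shift x nO).
by exists y.
Qed.

Lemma closed_nmem S x : closed S -> ~ S x -> exists2 O, nbhs (0 : M) O &
  forall o, O o -> ~ S (x + o).
Proof.
move=> cS nSx; exists [set o | ~ S (x + o)] => //.
apply: (@nbhs_shift0 x (~` S)); apply: open_nbhs_nbhs; split=> //.
exact: closed_openC.
Qed.

Lemma compactD C K : compact C -> compact K -> compact (C `+ K).
Proof.
move=> cC cK; have -> : C `+ K = (fun p : M * M => p.1 + p.2) @` (C `*` K).
  apply/seteqP; split=> [_ [x [y [Cx [Ky ->]]]]|_ [[x y] /= [Cx Ky] <-]].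
    by exists (x, y).
  by exists x, y.
apply: continuous_compact; last exact: compact_setX.
by apply: continuous_subspaceT; exact: add_continuous.
Qed.

Lemma compactN C : compact C -> compact [set x | C (- x)].
Proof.
move=> cC; have -> : [set x | C (- x)] = -%R @` C.
  apply/seteqP; split=> [x Cx|_ [x Cx <-]] /=; last by rewrite opprK.
  by exists (- x) => //; rewrite opprK.
apply: continuous_compact => //.
by apply: continuous_subspaceT; exact: opp_continuous.
Qed.

Lemma compact_seq (s : seq M) : compact [set x | x \in s].
Proof. by apply: finite_compact; exact: finite_seq. Qed.

(** Near-covering compactness for the filter of finite sequences of points of [C] ordered by
    inclusion: near [x], every sequence containing [x] will do. *)
Lemma compact_cover_seq C (N : M -> set M) : compact C ->
  (forall x, C x -> nbhs x (N x)) ->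
  exists2 s : seq M, (forall y, y \in s -> C y) &
    forall x, C x -> exists2 y, y \in s & N y x.
Proof.
move=> /compact_near_coveringP cC nN.
pose D := [set s : seq M | forall y, y \in s -> C y].
pose B (s : seq M) := [set t : seq M | D t /\ {subset s <= t}].
have FF : Filter (filter_from D B).
  apply: filter_from_filter; first by exists [::].
  move=> s t Ds Dt; exists (s ++ t).
    by move=> y; rewrite mem_cat => /orP[/Ds|/Dt].
  by move=> r [Dr sr]; split; split=> // y yr; apply: sr; rewrite mem_cat yr ?orbT.
have [|s Ds sP] := cC _ _ (fun (s : seq M) x => exists2 y, y \in s & N y x) FF.
  move=> x Cx; exists (N x, B [:: x]) => /=.
    split; first exact: nN.
    by exists [:: x] => //= y; rewrite inE => /eqP->.
  by move=> [z s] /= [Nz [_ sP]]; exists x => //; apply: sP; rewrite mem_head.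
by exists s => // x Cx; apply: (sP s) => //; split.
Qed.

Lemma compact_cover0 C O : compact C -> nbhs (0 : M) O ->
  exists2 s : seq M, (forall y, y \in s -> C y) &
    forall x, C x -> exists2 y, y \in s & O (x - y).
Proof.
by move=> cC nO; apply: (compact_cover_seq (N := fun y => [set x | O (x - y)])) => // x _;
  exact: nbhs0_shift.
Qed.

Definition directed_down (F : set (set M)) : Prop :=
  (exists A, F A) /\
  forall A B, F A -> F B -> exists2 D, F D & D `<=` A `&` B.

Lemma compact_directed C (F : set (set M)) : compact C -> directed_down F ->
  (forall A, F A -> closed A) -> (forall A, F A -> exists2 x, C x & A x) ->
  exists2 x, C x & forall A, F A -> A x.
Proof.
move=> cC [F0 dF] cF mF.
have FF : Filter (filter_from F (fun A => C `&` A)).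
  apply: filter_from_filter => // A B FA FB; have [D FD DAB] := dF _ _ FA FB.
  by exists D => // x [Cx /DAB[Ax Bx]].
have PF : ProperFilter (filter_from F (fun A => C `&` A)).
  by apply: filter_from_proper => // A /mF[x Cx Ax]; exists x.
have [A0 FA0] := F0.
have [|x [Cx clx]] := cC _ PF; first by exists A0 => // x [].
exists x => // A FA; apply: (cF _ FA) => N nN.
have [|y [Ay Ny]] := clx A N _ nN; first by exists A => // y [].
by exists y.
Qed.

Lemma closed_compactD C S : compact C -> closed S -> closed (C `+ S).
Proof.
move=> /compact_near_coveringP cC cS x clx; apply: contrapT => nCS.
have NP : nbhs x [set y | C `<=` [set c | ~ S (y - c)]].
  apply: (cC _ (nbhs x) (fun y c => ~ S (y - c))) => c Cc.
  have /= := @sub_continuous M (x, c) (~` S).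
  case.
    apply: open_nbhs_nbhs; split; first exact: closed_openC.
    by move=> Sxc; apply: nCS; exists c, (x - c); split=> //; split=> //; zmod.
  move=> [A B] /= [nA nB] AB; exists (B, A) => //= -[c' y] /= [Bc Ay].
  by apply: (AB (y, c')).
have [y [[c [s [Cc [Ss yE]]]] Ny]] := clx _ NP.
by apply: (Ny _ Cc); rewrite yE addrC addKr.
Qed.

Lemma closed_sum_compact C S : compact C -> closed S -> closed (S `+ C).
Proof.
move=> cC cS; have -> : S `+ C = C `+ S; last exact: closed_compactD.
by apply/seteqP; split=> _ [x [y [? [? ->]]]]; exists y, x; rewrite addrC.
Qed.

Lemma sumsetS X X' Y Y' : X `<=` X' -> Y `<=` Y' -> X `+ Y `<=` X' `+ Y'.
Proof.
by move=> XX' YY' _ [x [y [/XX' ? [/YY' ? ->]]]]; exists x, y.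
Qed.

Lemma subg_sumset S T : subg S -> subg T -> subg (S `+ T).
Proof.
move=> gS gT; split; first by exists 0, 0; rewrite addr0; split; [|split]; try exact: subg0.
move=> _ _ [x [y [Sx [Ty ->]]]] [x' [y' [Sx' [Ty' ->]]]].
exists (x - x'), (y - y'); split; first exact: subgB.
by split; [exact: subgB|zmod].
Qed.

Lemma sumsetl S T : subg T -> S `<=` S `+ T.
Proof. by move=> gT x Sx; exists x, 0; rewrite addr0; split=> //; split=> //; exact: subg0. Qed.

Lemma sumsetr S T : subg S -> T `<=` S `+ T.
Proof. by move=> gS x Tx; exists 0, x; rewrite add0r; split; [exact: subg0|]. Qed.

Lemma sumset_sub S T X : subg X -> S `<=` X -> T `<=` X -> S `+ T `<=` X.
Proof. by move=> gX SX TX _ [x [y [/SX ? [/TX ? ->]]]]; apply: subgD. Qed.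

(** * Boundedness modulo a subgroup, relative openness *)

(** Stands for relative compactness of the image of [X] in [M / U]. *)
Definition bdd U X : Prop := exists2 C, compact C & X `<=` C `+ U.

Definition ropen L S : Prop := exists2 O, nbhs (0 : M) O & O `&` L `<=` S.

Lemma bddS U X Y : X `<=` Y -> bdd U Y -> bdd U X.
Proof. by move=> XY [C cC YC]; exists C => //; exact: subset_trans YC. Qed.

Lemma bddSU U U' X : U `<=` U' -> bdd U X -> bdd U' X.
Proof.
by move=> UU' [C cC XC]; exists C => //; apply: subset_trans XC _; exact: sumsetS.
Qed.

Lemma bdd_compact U C : subg U -> compact C -> bdd U C.
Proof. by move=> gU cC; exists C => //; exact: sumsetl. Qed.

Lemma bddD U X Y : subg U -> bdd U X -> bdd U Y -> bdd U (X `+ Y).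
Proof.
move=> gU [C cC XC] [K cK YK]; exists (C `+ K); first exact: compactD.
move=> _ [x [y [/XC[c [u [Cc [Uu ->]]]] [/YK[k [v [Kk [Uv ->]]]] ->]]]].
exists (c + k), (u + v); split; first by exists c, k.
by split; [exact: subgD|zmod].
Qed.

Lemma bddN U X : subg U -> bdd U X -> bdd U [set x | X (- x)].
Proof.
move=> gU [C cC XC]; exists [set x | C (- x)]; first exact: compactN.
move=> x /= /XC[c [u [Cc [Uu xE]]]]; exists (- c), (- u); split; first by rewrite /= opprK.
by split; [exact: subgN|rewrite -[x]opprK xE; zmod].
Qed.

Lemma bdd_trans U U' X : subg U -> bdd U U' -> bdd U' X -> bdd U X.
Proof.
move=> gU [C cC UC] [K cK XK]; exists (K `+ C); first exact: compactD.
move=> _ /XK[k [u [Kk [/UC[c [v [Cc [Uv ->]]]] ->]]]].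
by exists (k + c), v; split; [exists k, c|split=> //; zmod].
Qed.

Lemma bdd_closure U X : closed U -> bdd U X -> bdd U (closure X).
Proof.
move=> cU [C cC XC]; exists C => //.
have := closed_compactD cC cU; rewrite closure_id => ->; exact: closureS.
Qed.

Lemma bdd_self U : subg U -> bdd U U.
Proof.
move=> gU; exists [set 0]; first exact: compact_set1.
by move=> u Uu; exists 0, u; rewrite add0r.
Qed.

Lemma bdd_seq U (s : seq M) : subg U -> bdd U [set x | x \in s].
Proof. by move=> gU; apply: bdd_compact => //; exact: compact_seq. Qed.

Lemma bdd_directed U X (F : set (set M)) : subg U -> bdd U X -> directed_down F ->
  (forall A, F A -> closed A) ->
  (forall A x u, F A -> A x -> U u -> A (x + u)) ->
  (forall A, F A -> exists2 x, X x & A x) ->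
  exists x, forall A, F A -> A x.
Proof.
move=> gU [C cC XC] dF cF sF mF.
have [|x _ Fx] := compact_directed cC dF cF; last by exists x.
move=> A FA; have [x /XC[c [u [Cc [Uu ->]]]] Ax] := mF _ FA.
exists c => //; rewrite (_ : c = c + u - u); last by zmod.
by apply: sF => //; exact: subgN.
Qed.

(** If no member were inside [G] over [X], the closed traces outside [G] would still have a common
    point. So an intersection lying in an open set is already caught there by one member. *)
Lemma bdd_directed_sub U X (F : set (set M)) (G : set M) : subg U -> bdd U X ->
  directed_down F -> (forall A, F A -> closed A) ->
  (forall A x u, F A -> A x -> U u -> A (x + u)) ->
  open G -> (forall x u, G x -> U u -> G (x + u)) ->
  (forall x, (forall A, F A -> A x) -> G x) ->
  exists2 A, F A & forall x, X x -> A x -> G x.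
Proof.
move=> gU bX [[A0 FA0] dF] cF sF oG sG FG.
apply: contrapT => nH.
have [] := @bdd_directed U X [set A `\` G | A in F] gU bX.
- split; first by exists (A0 `\` G); exists A0.
  move=> _ _ [A FA <-] [B FB <-]; have [D FD DAB] := dF _ _ FA FB.
  by exists (D `\` G); [exists D|move=> x [/DAB[Ax Bx] nG]].
- move=> _ [A FA <-]; apply: closedI; [exact: cF|exact: open_closedC].
- move=> _ x u [A FA <-] [Ax nG] Uu; split; first exact: sF.
  move=> Gxu; apply: nG; rewrite (_ : x = x + u - u); last by zmod.
  by apply: sG => //; exact: subgN.
- move=> _ [A FA <-]; apply: contrapT => nex; apply: nH; exists A => // x Xx Ax.
  by apply: contrapT => nG; apply: nex; exists x.
move=> x xP; have [] := xP (A0 `\` G); first by exists A0.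
by move=> _; apply; apply: FG => A FA; have [] := xP (A `\` G); first by exists A.
Qed.

Lemma ropenS L S S' : S `<=` S' -> ropen L S -> ropen L S'.
Proof. by move=> SS' [ O nO OS]; exists O => //; exact: subset_trans SS'. Qed.

Lemma ropenSl L L' S : L' `<=` L -> ropen L S -> ropen L' S.
Proof. by move=> LL' [ O nO OS]; exists O => // x [ Ox /LL' Lx]; apply: OS. Qed.

Lemma ropenI L S T : ropen L S -> ropen L T -> ropen L (S `&` T).
Proof.
move=> [ O nO OS] [P nP PT]; exists (O `&` P); first exact: filterI.
by move=> x [[ Ox Px] Lx]; split; [apply: OS|apply: PT].
Qed.

Lemma ropen_self L : ropen L L.
Proof. by exists setT; [exact: filterT|move=> x []]. Qed.

Lemma ropen_closed L S : closed L -> subg L -> subg S -> S `<=` L -> ropen L S ->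
  closed S.
Proof.
move=> cL gL gS SL [ O nO OS] x clx.
have Lx : L x by apply: cL; move: x clx; exact: closureS.
have [y [Sy Oy]] := clx _ (nbhs0_shiftN x nO).
rewrite (_ : x = x - y + y); last by zmod.
by apply: subgD => //; apply: OS; split=> //; apply: subgB => //; exact: SL.
Qed.

(** A subgroup that is closed near zero is closed: a limit [x] is translated near zero by some [y]
    of [G] close to it, and [x - y] is then a limit of points of [Z]. *)
Lemma loc_closed G Z : closed Z -> subg G -> Z `<=` G -> ropen G Z -> closed G.
Proof.
move=> cZ gG ZG [ O nO OZ] x clx.
have := nO; rewrite nbhsE => -[ O' [oO' O'0] O'O].
have nO' : nbhs (0 : M) O' by apply: open_nbhs_nbhs.
have [y [Gy Oy]] := clx _ (nbhs0_shiftN x nO').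
rewrite (_ : x = x - y + y); last by zmod.
apply: subgD => //; apply: ZG; apply: cZ => N nN.
have nN' : nbhs x [set t | (N `&` O') (t - y)].
  have nNO : nbhs (x - y) (N `&` O') by apply: filterI => //; apply: open_nbhs_nbhs.
  have := nbhs0_shift x (nbhs_shift0 nNO); apply: filterS => t /=.
  by rewrite (_ : x - y + (t - x) = t - y); last zmod.
have [t [Gt [Nt Ot]]] := clx _ nN'.
by exists (t - y); split=> //; apply: OZ; split; [exact: O'O|apply: subgB].
Qed.

(** Each of the finitely many cosets other than the closed [S] stays away from a neighbourhood of
    zero. *)
Lemma fin_ropen L S : closed S -> subg S -> fin_over S L -> ropen L S.
Proof.
move=> cS gS [s [_ scov]].
suff [ O nO OP] : exists2 O, nbhs (0 : M) O &
    forall x y, O x -> y \in s -> S (x - y) -> S y.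
  exists O => // x [ Ox Lx]; have [y ys Sy] := scov _ Lx.
  rewrite (_ : x = x - y + y); last by zmod.
  by apply: subgD => //; apply: OP Ox ys Sy.
elim: s {scov} => [|y s [ O nO OP]]; first by exists setT => //; exact: filterT.
have [Sy|nSy] := pselect (S y).
  by exists O => // x z Ox; rewrite inE => /predU1P[-> //|]; exact: OP.
have nS' : ~ S (- y) by move=> /(subgN gS); rewrite opprK.
have [P nP PP] := closed_nmem cS nS'.
exists (O `&` P); first exact: filterI.
move=> x z [ Ox Px]; rewrite inE => /predU1P[-> Sxy|]; last exact: OP.
by have := PP _ Px; rewrite addrC.
Qed.

(** Compact meets discrete: points of [X] in the same cell of a fine finite cover modulo [U] differ
    by a small element of [E] plus an element of [U], hence by an element of [G]. *)
Lemma bdd_fin U E G X : subg E -> subg G -> U `<=` G -> U `<=` E -> subg U ->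
  X `<=` E -> bdd U X -> ropen E G -> fin_over G X.
Proof.
move=> gE gG UG UE gU XE [C cC XC] [ O nO OG].
have [ O' [nO' O'D O'N]] := nbhs0_split nO.
have [s sC scov] := compact_cover0 cC nO'.
apply: (@fin_cells _ _ _ _ s (fun y x => exists2 u, U u & O' (x - u - y))).
  move=> _ /XC[c [u [Cc [Uu ->]]]]; have [y ys Oy] := scov _ Cc.
  by exists y => //; exists u => //; rewrite (_ : c + u - u - y = c - y); last zmod.
move=> y x x' [u Uu Oxu] [u' Uu' Oxu'] Xx Xx'.
rewrite (_ : x - x' = ((x - u - y) - (x' - u' - y)) + (u - u')); last by zmod.
apply: subgD => //; last by apply: subgB => //; exact: UG.
apply: OG; split; first by apply: O'D => //; exact: O'N.
rewrite (_ : _ - _ = (x - u) - (x' - u')); last by zmod.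
by do 2 apply: subgB => //; [exact: XE|exact: UE|exact: XE|exact: UE].
Qed.

Lemma fin_over_closed S X : closed S -> subg S -> subg X -> S `<=` X ->
  fin_over S X -> closed X.
Proof.
move=> cS gS gX SX [s [sX scov]].
have -> : X = [set x | x \in s] `+ S.
  apply/seteqP; split=> [x /scov[y ys Sy]|]; first by exists y, (x - y); split=> //; split=> //; zmod.
  by apply: sumset_sub.
by apply: closed_compactD => //; exact: compact_seq.
Qed.

Lemma bdd_fin_over U S X : bdd U S -> subg U -> fin_over S X -> bdd U X.
Proof.
move=> bS gU [s [_ scov]]; apply: bddS (bddD gU (bdd_seq s gU) bS) => x /scov[y ys Sy].
by exists y, (x - y); split=> //; split=> //; zmod.
Qed.

(** As [S] absorbs [U], only a compact part of [P] contributes to the sum. *)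
Lemma closed_sum_bdd U S P : subg U -> closed S -> closed P -> subg S -> subg P ->
  U `<=` S -> U `<=` P -> bdd U P -> closed (S `+ P).
Proof.
move=> gU cS cP gS gP US UP [C cC PC].
have -> : S `+ P = S `+ (C `&` P); last first.
  by apply: closed_sum_compact => //; exact: compact_closedI.
apply/seteqP; split; last by apply: sumsetS => // x [].
move=> _ [s [p [Ss [Pp ->]]]]; have [c [u [Cc [Uu pE]]]] := PC _ Pp.
exists (s + u), c; split; first by apply: subgD => //; exact: US.
split; last by rewrite pE; zmod.
split=> //; rewrite (_ : c = p - u); last by rewrite pE; zmod.
by apply: subgB => //; exact: UP.
Qed.

End Topology.

(** * Families of operators *)

Section Operators.
Variables (M : topologicalZmodType) (I : Type) (f : I -> M -> M).
Implicit Types (C G K L O P S T U X : set M).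

Definition stable S : Prop := forall i x, S x -> S (f i x).

Definition msub S : Prop := subg S /\ stable S.

(* Equicontinuity is only required of a set [J] of operators generating the
   family, as provided by a compact generating set of the acting group. *)
Definition good_ops : Prop :=
  (forall i x y, f i (x + y) = f i x + f i y) /\
  exists J : set I,
    (forall S, subg S -> (forall i x, J i -> S x -> S (f i x)) -> stable S) /\
    (forall O, nbhs (0 : M) O -> exists2 O', nbhs (0 : M) O' &
       forall i x, J i -> O' x -> O (f i x)).

(** [pd] and [pf] keep only the conditions on finite subquotients; discreteness and compactness are
    stated separately by [ropen] and [bdd]. *)
Definition pd L S : Prop := forall F, msub F -> S `<=` F -> F `<=` L ->
  fin_over S F -> F `<=` S.

Definition pf P K : Prop := forall S, closed S -> msub S -> K `<=` S -> S `<=` P ->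
  fin_over S P -> P `<=` S.

Definition om_mem L U S : Prop :=
  [/\ msub S, U `<=` S, S `<=` L, ropen L S & pd L S].

(** This is Omega (L / U) = L / U, and [wzero L K] below is W (L / K) = 0. *)
Definition om_full L U : Prop := forall S, om_mem L U S -> L `<=` S.

Definition w_mem L K P : Prop :=
  [/\ closed P /\ msub P, K `<=` P, P `<=` L, bdd K P & pf P K].

Definition wzero L K : Prop := forall P, w_mem L K P -> P `<=` K.

Lemma om_fullS L U U' : U `<=` U' -> om_full L U -> om_full L U'.
Proof.
move=> UU' omU S [mS U'S SL oS pdS]; apply: omU; split=> //.
exact: subset_trans U'S.
Qed.

Lemma wzeroS L L' K : L' `<=` L -> wzero L K -> wzero L' K.
Proof.
by move=> LL' wL P [mP KP PL bP pfP]; apply: wL; split=> //; exact: subset_trans LL'.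
Qed.

Lemma msubI S T : msub S -> msub T -> msub (S `&` T).
Proof.
move=> [gS fS] [gT fT]; split; first exact: subgI.
by move=> i x [Sx Tx]; split; [exact: fS|exact: fT].
Qed.

Hypothesis f_good : good_ops.

Lemma opD i x y : f i (x + y) = f i x + f i y.
Proof. exact: f_good.1. Qed.
Lemma op0 i : f i 0 = 0.
Proof. by apply: (addrI (f i 0)); rewrite -opD !addr0. Qed.
Lemma opN i x : f i (- x) = - f i x.
Proof. by apply: (addrI (f i x)); rewrite -opD !subrr op0. Qed.
Lemma opB i x y : f i (x - y) = f i x - f i y.
Proof. by rewrite opD opN. Qed.

Lemma msub_sum S T : msub S -> msub T -> msub (S `+ T).
Proof.
move=> [gS fS] [gT fT]; split; first exact: subg_sumset.
move=> i _ [x [y [Sx [Ty ->]]]]; exists (f i x), (f i y).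
by split; [exact: fS|split; [exact: fT|exact: opD]].
Qed.

Lemma msub_closure S : msub S -> msub (closure S).
Proof.
move=> [gS fS]; have gcS := closure_subg gS; split=> //.
have [_ [J [Jgen Jeq]]] := f_good; apply: Jgen => // i x Ji clx N nN.
have [ O' nO' O'P] := Jeq _ (nbhs_shift0 nN).
have [y [Sy Oy]] := clx _ (nbhs0_shift x nO').
exists (f i y); split; first exact: fS.
by have /= := O'P _ _ Ji Oy; rewrite opB addrC subrK.
Qed.

Hypothesis lcM : exists2 K : set M, compact K & nbhs (0 : M) K.

Lemma open_sumset O X : open O -> open (O `+ X).
Proof.
move=> oO; rewrite openE => _ [ o [x [ Oo [Xx ->]]]].
have := nbhs0_shift (o + x) (nbhs_shift0 (open_nbhs_nbhs (conj oO Oo))).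
apply: filterS => y /= Oy; exists (y - x), x; split; last by split=> //; zmod.
by move: Oy; rewrite (_ : o + (y - (o + x)) = y - x); last zmod.
Qed.

(** [W] is so small that its differences and its images under the generators stay in [K]. A sum of a
    [K]-part and a submodule that is already covered by its [W]-part is therefore a submodule. *)
Lemma op_nbhs : exists K W J, [/\ compact K, open W /\ W 0,
  (forall x, W x -> K x) /\ (forall x y, W x -> W y -> K (x - y)),
  forall i x, J i -> W x -> K (f i x) &
  forall S, subg S -> (forall i x, J i -> S x -> S (f i x)) -> stable S].
Proof.
have [K cK nK] := lcM; have [_ [J [Jgen Jeq]]] := f_good.
have [ O1 [nO1 O1D O1N]] := nbhs0_split nK; have [ O2 nO2 O2P] := Jeq _ nK.
have : nbhs (0 : M) (O1 `&` O2) by exact: filterI.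
rewrite nbhsE => -[W [ oW W0] WO].
have O10 := nbhs_singleton nO1.
exists K, W, J; split=> //; last by move=> i x Ji /WO[_ Ox]; exact: O2P.
split=> [x /WO[ Ox _]|x y /WO[ Ox _] /WO[ Oy _]]; last by apply: O1D => //; exact: O1N.
by rewrite -[x]addr0; apply: O1D.
Qed.

Lemma om_memI L U S T : subg L -> om_mem L U S -> om_mem L U T -> om_mem L U (S `&` T).
Proof.
move=> gL [mS US SL oS pdS] [mT UT TL oT pdT]; split.
- exact: msubI.
- by move=> x Ux; split; [exact: US|exact: UT].
- by move=> x [Sx _]; exact: SL.
- exact: ropenI.
move=> F mF STF FL finF.
have fin S' : msub S' -> S `&` T `<=` S' -> fin_over S' (F `+ S').
  by move=> mS' sS'; exact: (fin_over_sum (msubI mS mT).1 mS'.1 sS' finF).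
have FS S' : pd L S' -> msub S' -> S `&` T `<=` S' -> S' `<=` L -> F `<=` S'.
  move=> pdS' mS' STS' S'L; apply: subset_trans (sumsetl mS'.1) _; apply: pdS'.
  - exact: msub_sum.
  - by apply: sumsetr; exact: mF.1.
  - exact: sumset_sub.
  - exact: fin.
by move=> x Fx; split; [apply: FS Fx => // y []|apply: FS Fx => // y []].
Qed.

(** The intersection is open because it contains an open submodule [G] which is compact modulo it:
    every member has to contain such a [G]. *)
Lemma omega_open L U : closed L -> msub L -> U `<=` L ->
  om_mem L U [set x | forall S, om_mem L U S -> S x].
Proof.
move=> cL mL UL; set Om := [set x | _].
have memL : om_mem L U L.
  by split=> //; exact: ropen_self.
have OmL : Om `<=` L by move=> x; apply.
have mOm : msub Om.
  split; first by apply: subg_bigcap => S [[]].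
  by move=> i x Omx S memS; have [[_ fS] _ _ _ _] := memS; apply: fS; exact: Omx.
have finpd S F : om_mem L U S -> msub F -> F `<=` L -> fin_over S F -> F `<=` S.
  move=> [mS US SL oS pdS] mF FL finF.
  apply: subset_trans (sumsetl mS.1) _; apply: pdS.
  - exact: msub_sum.
  - by apply: sumsetr; exact: mF.1.
  - by apply: sumset_sub => //; exact: mL.1.
  - by apply: fin_over_sum finF => //; exact: mS.1.
have [K [W [J [cK [ oW W0] [WK WBK] fWK Jgen]]]] := op_nbhs.
(* The members decrease to [Om]; by compactness one of them is within [W] of [Om] over [K]. *)
have [A memA AP] : exists2 A, om_mem L U A &
    forall x, (K `&` L) x -> A x -> (W `+ Om) x.
  apply: (@bdd_directed_sub _ Om (K `&` L) (om_mem L U)) => //.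
  - exact: mOm.1.
  - by apply: bdd_compact; [exact: mOm.1|exact: compact_closedI].
  - split; first by exists L.
    by move=> A B memA memB; exists (A `&` B) => //; apply: om_memI => //; exact: mL.1.
  - by move=> A [[gA _] _ AL oA _]; apply: ropen_closed cL _ _ _ oA => //; exact: mL.1.
  - by move=> A x u memA Ax Omu; have [[gA _] _ _ _ _] := memA; apply: subgD => //; exact: Omu.
  - exact: open_sumset.
  - move=> _ u [w [ o [Ww [ Oo ->]]]] Ou; exists w, (o + u); split=> //.
    by split; [exact: (subgD mOm.1)|zmod].
  - by move=> x Omx; exists 0, x; rewrite add0r.
have [[gA fA] UA AL oA pdA] := memA.
have OmA : Om `<=` A by move=> x; apply.
pose G := (A `&` K) `+ Om.
have GP x : G x -> exists w o, [/\ W w, A w, Om o & x = w + o].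
  move=> [k [ o [[Ak Kk] [ Oo ->]]]]; have [w [ o' [Ww [ Oo' kE]]]] := AP k (conj Kk (AL _ Ak)) Ak.
  exists w, (o' + o); split=> //; last by rewrite kE; zmod.
    rewrite (_ : w = k - o'); last by rewrite kE; zmod.
    by apply: subgB => //; exact: OmA.
  exact: (subgD mOm.1).
have gG : subg G.
  split.
    exists 0, 0; rewrite addr0; split; last by split=> //; exact: mOm.1.1.
    by split; [exact: gA.1|exact: WK].
  move=> x y /GP[w [ o [Ww Aw Oo ->]]] /GP[w' [ o' [Ww' Aw' Oo' ->]]].
  exists (w - w'), (o - o'); split.
    by split; [exact: subgB|exact: WBK].
  by split; [exact: (subgB mOm.1)|zmod].
have mG : msub G.
  split=> //; apply: Jgen => // i _ Ji /GP[w [ o [Ww Aw Oo ->]]].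
  exists (f i w), (f i o); split; first by split; [exact: fA|exact: fWK].
  by split; [exact: mOm.2|exact: opD].
have GL : G `<=` L.
  by apply: sumset_sub => //; [exact: mL.1|move=> x [/AL]].
(* [G] is compact modulo [Om], so it has finite image in the discrete [L / S], where there is no
   nonzero finite submodule. *)
have GOm : G `<=` Om.
  move=> x Gx S memS; apply: (finpd S G memS) Gx => //.
  have [[gS _] _ SL oS _] := memS.
  apply: (@bdd_fin _ Om L S G) => //; [exact: mL.1|by move=> y; apply|exact: mOm.1|].
  exists (K `&` closure A); first by apply: compact_closedI => //; exact: closed_closure.
  by apply: sumsetS => // y [Ay Ky]; split=> //; exact: subset_closure.
split=> //.
- by move=> x Ux S [_ US _ _ _]; exact: US.
- have [ O nO OA] := oA; exists (O `&` W); first by apply: filterI => //; exact: open_nbhs_nbhs.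
  move=> x [[ Ox Wx] Lx]; apply: GOm; exists x, 0; rewrite addr0; split; last first.
    by split=> //; exact: mOm.1.1.
  by split; [exact: OA|exact: WK].
move=> F mF OmF FL finF x Fx S memS; apply: (finpd S F memS) Fx => //.
by apply: fin_overS finF => //; [have [[]] := memS|move=> y; apply].
Qed.

End Operators.

(** * The greatest compact parafinite submodule *)

Section Greatest.
Variables (M : topologicalZmodType) (I : Type) (f : I -> M -> M).
Hypothesis f_good : good_ops f.
Hypothesis lcM : exists2 K : set M, compact K & nbhs (0 : M) K.
Implicit Types (C G K L O P Q S T U X : set M).

Lemma pf_sub P K S : msub f P -> subg K -> pf f P K -> closed P -> closed S -> msub f S ->
  K `<=` S -> K `<=` P -> fin_over S P -> P `<=` S.
Proof.
move=> mP gK pfP cP cS mS KS KP finP.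
suff : P `<=` S `&` P by move=> PSP x /PSP[].
apply: pfP; first exact: closedI.
- exact: msubI.
- by move=> x Kx; split; [exact: KS|exact: KP].
- by move=> x [].
- apply: fin_overI => //; [exact: mS.1|exact: mP.1|].
  exists [:: 0]; split=> [y|x Px]; first by rewrite inE => /eqP->; exact: mP.1.1.
  by exists 0; rewrite ?mem_head // subr0.
Qed.

Lemma w_memD L K P Q : subg L -> msub f K -> w_mem f L K P -> w_mem f L K Q ->
  w_mem f L K (P `+ Q).
Proof.
move=> gL mK [[cP mP] KP PL bP pfP] [[cQ mQ] KQ QL bQ pfQ]; split.
- split; last exact: msub_sum.
  by apply: (@closed_sum_bdd _ K) => //; [exact: mK.1|exact: mP.1|exact: mQ.1].
- by apply: subset_trans KP (sumsetl _); exact: mQ.1.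
- exact: sumset_sub.
- by apply: bddD => //; exact: mK.1.
move=> S cS mS KS SPQ finS; apply: sumset_sub; first exact: mS.1.
- apply: (@pf_sub P K) => //; first exact: mK.1.
  by apply: fin_overS finS => //; [exact: mS.1|apply: sumsetl; exact: mQ.1].
- apply: (@pf_sub Q K) => //; first exact: mK.1.
  by apply: fin_overS finS => //; [exact: mS.1|apply: sumsetr; exact: mP.1].
Qed.

(** In the closure [Lc] of the sum of all members, a compact neighbourhood of zero together with one
    member forms an open submodule [G]. Each member has finite image in the discrete [Lc / G], hence
    lies in [G], so [Lc] is [G] and is compact modulo [K]. *)
Lemma w_greatest L K : closed L -> msub f L -> closed K -> msub f K -> K `<=` L ->
  exists2 G, w_mem f L K G & forall P, w_mem f L K P -> P `<=` G.
Proof.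
move=> cL mL cK mK KL; have [gL gK] := (mL.1, mK.1).
have memK : w_mem f L K K by split=> //; exact: bdd_self.
pose W0 := [set x | exists2 P, w_mem f L K P & P x].
have mW0 : msub f W0.
  split; last first.
    by move=> i x [P memP Px]; exists P => //; have [[_ [_ fP]] _ _ _ _] := memP; exact: fP.
  split; first by exists K => //; exact: gK.1.
  move=> x y [P memP Px] [Q memQ Qy]; exists (P `+ Q); first exact: w_memD.
  exists x, (- y); split=> //; split=> //.
  by have [[_ [gQ _]] _ _ _ _] := memQ; exact: subgN.
have W0L : W0 `<=` L by move=> x [P [_ _ PL _ _] /PL].
pose Lc := closure W0.
have mLc : msub f Lc by exact: msub_closure.
have gLc := mLc.1.
have LcL : Lc `<=` L by move: cL; rewrite closure_id => ->; exact: closureS.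
have [D [V [J [cD [ oV V0] [VD VBD] fVD Jgen]]]] := op_nbhs f_good lcM.
have nV : nbhs (0 : M) V by exact: open_nbhs_nbhs.
have cDL : compact (D `&` Lc) by apply: compact_closedI => //; exact: closed_closure.
(* Finitely many elements of [W0] approximate the compact set up to [V], and a finite sum of members
   contains them all. *)
have [P memP DP] : exists2 P, w_mem f L K P & D `&` Lc `<=` V `+ P.
  have /choice[w wP] : forall x, exists w, (D `&` Lc) x -> W0 w /\ V (x - w).
    move=> x; have [[_ clx]|nx] := pselect ((D `&` Lc) x); last by exists 0.
    by have [w [W0w Vw]] := clx _ (nbhs0_shiftN x nV); exists w.
  have [|s sD scov] := @compact_cover_seq _ _ (fun x => [set z | V (z - w x)]) cDL.
    move=> x /wP[_ Vw].
    have nz := nbhs0_shift x (nbhs_shift0 (open_nbhs_nbhs (conj oV Vw))).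
    by apply: filterS nz => z /=; rewrite (_ : x - w x + (z - x) = z - w x); last zmod.
  have [P memP PP] : exists2 P, w_mem f L K P & forall y, y \in s -> P (w y).
    elim: s sD {scov} => [|y s IHs] sD; first by exists K.
    have [z zs|P memP PP] := IHs; first by apply: sD; rewrite inE zs orbT.
    have [[Q memQ Qy] _] := wP y (sD _ (mem_head _ _)).
    have [[_ [gP _]] _ _ _ _] := memP; have [[_ [gQ _]] _ _ _ _] := memQ.
    exists (P `+ Q) => [|z]; first exact: w_memD.
    by rewrite inE => /predU1P[->|/PP]; [exact: sumsetr|exact: sumsetl].
  exists P => // z /scov[y ys Vy]; exists (z - w y), (w y).
  by split=> //; split; [exact: PP|zmod].
have [[cP mP] KP PL bP pfP] := memP; have gP := mP.1.
have PLc : P `<=` Lc by move=> x Px; apply: subset_closure; exists P.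
pose G := (D `&` Lc) `+ P.
have GP x : G x -> exists v p, [/\ V v, Lc v, P p & x = v + p].
  move=> [d [p [[Dd Ld] [Pp ->]]]]; have [v [p' [Vv [Pp' dE]]]] := DP d (conj Dd Ld).
  exists v, (p' + p); split=> //; last by rewrite dE; zmod.
    by rewrite (_ : v = d - p'); [apply: (subgB gLc) => //; exact: PLc|rewrite dE; zmod].
  exact: subgD.
have gG : subg G.
  split.
    exists 0, 0; rewrite addr0; split; last by split=> //; exact: gP.1.
    by split; [exact: VD|exact: gLc.1].
  move=> x y /GP[v [p [Vv Lv Pp ->]]] /GP[v' [p' [Vv' Lv' Pp' ->]]].
  exists (v - v'), (p - p'); split.
    by split; [exact: VBD|exact: (subgB gLc)].
  by split; [exact: subgB|zmod].
have mG : msub f G.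
  split=> //; apply: Jgen => // i _ Ji /GP[v [p [Vv Lv Pp ->]]].
  exists (f i v), (f i p); split; first by split; [exact: fVD|exact: mLc.2].
  by split; [exact: mP.2|exact: opD].
have GLc : G `<=` Lc by apply: sumset_sub => // x [].
have oG : ropen Lc G.
  exists V => // x [Vx Lx]; exists x, 0; rewrite addr0; split; last by split=> //; exact: gP.1.
  by split=> //; exact: VD.
have cG : closed G.
  by apply: ropen_closed oG => //; exact: closed_closure.
have PG Q : w_mem f L K Q -> Q `<=` G.
  move=> memQ; have [[cQ mQ] KQ QL bQ pfQ] := memQ.
  have KG : K `<=` G.
    move=> x /KP Px; exists 0, x; rewrite add0r; split=> //.
    by split; [exact: VD|exact: gLc.1].
  apply: (pf_sub mQ gK pfQ) => //.
  apply: (@bdd_fin _ K Q) => //; first exact: mQ.1.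
  by apply: ropenSl oG => x Qx; apply: subset_closure; exists Q.
have LcG : Lc `<=` G.
  by move: cG; rewrite closure_id => ->; apply: closureS => x [Q /PG]; apply.
exists G => //; split=> //.
- by move=> x Kx; apply: (PG K).
- exact: subset_trans LcL.
- by apply: bddD => //; apply: bdd_compact.
move=> S cS mS KS SG finS.
have SE : S = closure S by apply/closure_id.
apply: subset_trans GLc _; rewrite SE; apply: closureS.
move=> x [Q memQ]; have [[cQ mQ] KQ QL bQ pfQ] := memQ.
apply: (pf_sub mQ gK pfQ) => //.
by apply: fin_overS finS => //; [exact: mS.1|exact: PG].
Qed.

End Greatest.

(** * Compact modules with W = 0 are profinite *)

Section Profinite.
Variables (M : topologicalZmodType) (I : Type) (f : I -> M -> M).
Hypothesis f_good : good_ops f.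
Implicit Types (C G K L O P Q S T U X : set M).

Definition fi_mem L K S : Prop :=
  [/\ closed S /\ msub f S, K `<=` S, S `<=` L & fin_over S L].

(* If the intersection [Z] of the closed finite index submodules were larger
   than [K], a proper finite index submodule [T] of [Z] would extend to the
   finite index submodule [S `&` (T `+ W)] of [L]. *)
Lemma wzero_residually_finite L K : closed L -> msub f L -> closed K -> msub f K ->
  K `<=` L -> bdd K L -> wzero f L K -> [set x | forall S, fi_mem L K S -> S x] `<=` K.
Proof.
move=> cL mL cK mK KL bL wL; set Z := [set x | _].
have gK := mK.1; have gL := mL.1.
have memL : fi_mem L K L.
  split=> //; exists [:: 0]; split=> [y|x Lx]; first by rewrite inE => /eqP->; exact: gL.1.
  by exists 0; rewrite ?mem_head // subr0.
have ZL : Z `<=` L by move=> x; apply.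
have KZ : K `<=` Z by move=> x Kx S [_ KS _ _]; exact: KS.
have mZ : msub f Z.
  split; first by apply: subg_bigcap => S [[_ []]].
  by move=> i x Zx S memS; have [[_ [_ fS]] _ _ _] := memS; apply: fS; exact: Zx.
have gZ := mZ.1.
have cZ : closed Z.
  move=> x clx S memS; have [[cS _] _ _ _] := memS; apply: cS.
  by move: x clx; apply: closureS => y; apply.
apply: wL; split=> //; first exact: bddS bL.
move=> T cT mT KT TZ finT; have gT := mT.1.
have [ O nO OT] := fin_ropen cT gT finT.
have [ O1 [nO1 _ O1N _ O1D]] := nbhs0_split3 nO.
have [_ [J [Jgen Jeq]]] := f_good.
have [ O2 [nO2 O2O _ O2D _]] := nbhs0_split3 nO.
have [ O3 nO3 O3P] := Jeq _ nO2.
pose O4 := O1 `&` O3 `&` O2.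
have nO4 : nbhs (0 : M) (O4 `&` [set x | O4 (- x)]).
  have nO4 : nbhs (0 : M) O4 by do !apply: filterI.
  by apply: filterI => //; exact: nbhs0_opp.
have := nO4; rewrite nbhsE => -[W [ oW W0] WO].
have nW : nbhs (0 : M) W by apply: open_nbhs_nbhs.
have [S memS SZ] : exists2 S, fi_mem L K S & forall x, L x -> S x -> (W `+ Z) x.
  apply: (@bdd_directed_sub _ K L (fi_mem L K)) => //.
  - split; first by exists L.
    move=> A B [[cA mA] KA AL finA] [[cB mB] KB BL finB]; exists (A `&` B) => //; split.
    + by split; [exact: closedI|exact: msubI].
    + by move=> x Kx; split; [exact: KA|exact: KB].
    + by move=> x [Ax _]; exact: AL.
    + by apply: fin_overI => //; [exact: mA.1|exact: mB.1].
  - by move=> A [[]].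
  - by move=> A x u [[_ [gA _]] KA _ _] Ax /KA Au; exact: subgD.
  - exact: open_sumset.
  - move=> _ u [w [z [Ww [Zz ->]]]] /KZ Zu; exists w, (z + u); split=> //.
    by split; [exact: (subgD gZ)|zmod].
  - by move=> x Zx; exists 0, x; rewrite add0r.
have [[cS mS] KS SL finS] := memS; have gS := mS.1.
have ZS : Z `<=` S by move=> x; apply.
pose S' := S `&` (W `+ T).
(* Write [x] as [w + z] with [z] in [Z]. The condition puts [z - t] in [O], and a difference in [O]
   of elements of [Z] lies in [T], as [T] is open in [Z]. *)
have S'key x t : S x -> T t ->
    (forall w, W w -> O (x - t - w)) -> S' x.
  move=> Sx Tt xw; split=> //; have [w [z [Ww [Zz xE]]]] := SZ _ (SL _ Sx) Sx.
  exists w, z; split=> //; split=> //.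
  rewrite (_ : z = (x - t - w) + t); last by rewrite xE; zmod.
  apply: subgD => //; apply: OT; split; first exact: xw.
  by rewrite (_ : x - t - w = z - t); [apply: (subgB gZ) => //; exact: TZ|rewrite xE; zmod].
have gS' : subg S'.
  split; first by split; [exact: gS.1|exists 0, 0; rewrite addr0; split=> //; split=> //; exact: gT.1].
  move=> x y [Sx [w [t [Ww [Tt xE]]]]] [Sy [w' [t' [Ww' [Tt' yE]]]]].
  apply: (S'key _ (t - t')); [exact: subgB|exact: subgB|move=> w'' Ww''].
  rewrite (_ : x - y - (t - t') - w'' = w + - w' + - w''); last by rewrite xE yE; zmod.
  have [[[ O1w _] _] _] := WO _ Ww; have [_ [[ O1w' _] _]] := WO _ Ww'.
  have [_ [[ O1w'' _] _]] := WO _ Ww''.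
  exact: O1D.
have mS' : msub f S'.
  split=> //; apply: Jgen => // i x Ji [Sx [w [t [Ww [Tt xE]]]]].
  apply: (S'key _ (f i t)); [exact: mS.2|exact: mT.2|move=> w'' Ww''].
  rewrite xE opD // (_ : _ - _ = f i w + - w''); last by zmod.
  have [[[ _ O3w] _] _] := WO _ Ww; have [_ [_ O2w'']] := WO _ Ww''.
  by apply: O2D => //; exact: O3P.
have S'S : S' `<=` S by move=> x [].
have finS' : fin_over S' S.
  have [s [sZ scov]] := finT; apply: (@fin_overP _ _ _ s) => // x Sx.
  have [w [z [Ww [Zz xE]]]] := SZ _ (SL _ Sx) Sx; have [y ys Ty] := scov _ Zz.
  exists y => //; split; first by apply: subgB => //; apply: ZS; exact: sZ.
  by exists w, (z - y); split=> //; split=> //; rewrite xE; zmod.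
have memS' : fi_mem L K S'.
  split.
  - split=> //; apply: (ropen_closed cS gS) => //; exists W => // x [Wx Sx]; split=> //.
    by exists x, 0; rewrite addr0; split=> //; split=> //; exact: gT.1.
  - move=> x Kx; split; first exact: KS.
    by exists 0, x; rewrite add0r; split=> //; split=> //; exact: KT.
  - exact: subset_trans SL.
  - exact: fin_over_trans gS' (subg0 gS) finS' finS.
move=> x Zx; have [_ [w [t [Ww [Tt xE]]]]] := Zx _ memS'.
rewrite xE; apply: subgD => //; apply: OT; split.
  by apply: O2O; have [[_ O2w] _] := WO _ Ww.
by rewrite (_ : w = x - t); [apply: (subgB gZ) => //; exact: TZ|rewrite xE; zmod].
Qed.

(** The finite index submodules meet in [K]; compactness modulo [K] makes one of them small. *)
Lemma wzero_profinite L K O : closed L -> msub f L -> closed K -> msub f K ->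
  K `<=` L -> bdd K L -> wzero f L K -> nbhs (0 : M) O ->
  exists2 S, fi_mem L K S & S `<=` O `+ K.
Proof.
move=> cL mL cK mK KL bL wL; rewrite nbhsE => -[W [ oW W0] WO].
have gK := mK.1; have gL := mL.1.
have [S memS SW] : exists2 S, fi_mem L K S & forall x, L x -> S x -> (W `+ K) x.
  apply: (@bdd_directed_sub _ K L (fi_mem L K)) => //.
  - split.
      exists L; split=> //; exists [:: 0]; split=> [y|x Lx].
        by rewrite inE => /eqP->; exact: gL.1.
      by exists 0; rewrite ?mem_head // subr0.
    move=> A B [[cA mA] KA AL finA] [[cB mB] KB BL finB]; exists (A `&` B) => //; split.
    + by split; [exact: closedI|exact: msubI].
    + by move=> x Kx; split; [exact: KA|exact: KB].
    + by move=> x [Ax _]; exact: AL.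
    + by apply: fin_overI => //; [exact: mA.1|exact: mB.1].
  - by move=> A [[]].
  - by move=> A x u [[_ [gA _]] KA _ _] Ax /KA Au; exact: subgD.
  - exact: open_sumset.
  - move=> _ u [w [z [Ww [Zz ->]]]] Ku; exists w, (z + u); split=> //.
    by split; [exact: (subgD gK)|zmod].
  - move=> x Zx; exists 0, x; rewrite add0r; split=> //; split=> //.
    exact: (wzero_residually_finite cL mL cK mK KL bL wL).
exists S => //; have [_ _ SL _] := memS.
by move=> x Sx; apply: sumsetS (SW _ (SL _ Sx) Sx).
Qed.

End Profinite.

(** * Passing from a commuting family of operators to a smaller one *)

Section Transfer.
Variables (M : topologicalZmodType) (I I' : Type) (f : I -> M -> M) (g : I' -> M -> M).
Hypothesis f_good : good_ops f.
Hypothesis f_cont : forall i, continuous (f i).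
Hypothesis f_inv : forall i, exists j, forall x, f j (f i x) = x /\ f i (f j x) = x.
Hypothesis g_good : good_ops g.
Hypothesis gf : forall S : set M, subg S -> stable f S -> stable g S.
Hypothesis gfC : forall i k x, f i (g k x) = g k (f i x).
Hypothesis lcM : exists2 K : set M, compact K & nbhs (0 : M) K.
Implicit Types (C G K L O P Q S T U X : set M).

Let preim i S : set M := [set x | S (f i x)].

Let msub_preim i S : msub g S -> msub g (preim i S).
Proof.
move=> [gS sS]; split=> [|k x Sx]; last by rewrite /preim /= gfC; exact: sS.
split; first by rewrite /preim /= op0 //; exact: gS.1.
by move=> x y Sx Sy; rewrite /preim /= opB //; exact: subgB.
Qed.

Let fin_preim i S X : subg S -> fin_over S X -> fin_over (preim i S) (preim i X).
Proof.
move=> gS [s [_ scov]].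
apply: (@fin_cells _ _ _ _ s (fun y x => S (f i x - y))) => [x /scov//|y x x' Sx Sx' _ _].
rewrite /preim /= opB // (_ : f i x - f i x' = (f i x - y) - (f i x' - y)); last by zmod.
exact: subgB.
Qed.

Let nbhs_preim i O : nbhs (0 : M) O -> nbhs (0 : M) (preim i O).
Proof. by move=> nO; apply: f_cont; rewrite op0. Qed.

(** Each [f i] permutes the members for [g], so their intersection is stable under [f]. It is then a
    member for [f]: an [f]-submodule is a [g]-submodule, so [pd] for [g] implies [pd] for [f]. *)
Lemma om_full_transfer L U : closed L -> msub f L -> msub f U -> U `<=` L ->
  om_full f L U -> om_full g L U.
Proof.
move=> cL mL mU UL omf.
have mgL : msub g L by split; [exact: mL.1|exact: gf mL.1 mL.2].
have := omega_open g_good lcM cL mgL UL; set Om := [set x | _] => -[mOm UOm OmL oOm pdOm].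
have fOm : stable f Om.
  move=> i x Omx S [mS US SL oS pdS].
  apply: (Omx (preim i S)); have [j jP] := f_inv i; split.
  - exact: msub_preim.
  - by move=> y Uy; apply: US; exact: mU.2.
  - by move=> y /SL /(mL.2 j); rewrite (jP y).1.
  - have [ O nO OS] := oS; exists (preim i O); first exact: nbhs_preim.
    by move=> y [ Oy Ly]; apply: OS; split=> //; exact: mL.2.
  - move=> F mF SF FL finF y Fy.
    have pp S' : preim j (preim i S') = S'.
      by apply/seteqP; split=> z; rewrite /preim /= (jP z).2.
    have : preim j F `<=` S.
      apply: pdS.
      + exact: msub_preim.
      + by rewrite -{1}(pp S) => z; exact: SF.
      + by move=> z /FL /(mL.2 i); rewrite (jP z).2.
      + rewrite -(pp S); apply: fin_preim => //; exact: (msub_preim _ mS).1.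
    by apply; rewrite /preim /= (jP y).1.
have LOm : L `<=` Om.
  apply: omf; split=> //; first by split=> //; exact: mOm.1.
  move=> F mF OmF FL finF; apply: pdOm => //; split; first exact: mF.1.
  exact: gf mF.1 mF.2.
by move=> S memS x /LOm; apply.
Qed.

Lemma wzero_transfer L K : closed L -> msub f L -> closed K -> msub f K -> K `<=` L ->
  wzero f L K -> wzero g L K.
Proof.
move=> cL mL cK mK KL wf.
have mg S : msub f S -> msub g S by move=> mS; split; [exact: mS.1|exact: gf mS.1 mS.2].
have [G memG GP] := w_greatest g_good lcM cL (mg _ mL) cK (mg _ mK) KL.
have [[cG mG] KG GL bG pfG] := memG.
have fG : stable f G.
  move=> i x Gx; have [j jP] := f_inv i.
  suff memjG : w_mem g L K (preim j G) by apply: (GP _ memjG); rewrite /preim /= (jP x).1.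
  have pp S' : preim i (preim j S') = S'.
    by apply/seteqP; split=> z; rewrite /preim /= (jP z).1.
  have pp' S' : preim j (preim i S') = S'.
    by apply/seteqP; split=> z; rewrite /preim /= (jP z).2.
  have clo k S : closed S -> closed (preim k S).
    by move=> cS; apply: closed_comp => // y _; exact: f_cont.
  split.
  - by split; [exact: clo|exact: msub_preim].
  - by move=> y Ky; apply: KG; exact: mK.2.
  - by move=> y /GL /(mL.2 i); rewrite (jP y).2.
  - have [C cC GC] := bG; exists (f i @` C).
      by apply: continuous_compact => //; apply: continuous_subspaceT; exact: f_cont.
    move=> y /GC[c [k [Cc [Kk yE]]]]; exists (f i c), (f i k).
    split; first by exists c.
    by split; [exact: mK.2|rewrite -opD // -yE (jP y).2].
  - move=> S cS mS KS SG finS y Gy.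
    have : G `<=` preim i S.
      apply: pfG.
      + exact: clo.
      + exact: msub_preim.
      + by move=> z Kz; apply: KS; exact: mK.2.
      + by move=> z /SG; rewrite /preim /= (jP z).1.
      + rewrite -(pp G); apply: fin_preim => //; exact: mS.1.
    by move=> /(_ _ Gy); rewrite /preim /= (jP y).2.
have GK : G `<=` K.
  apply: wf; split=> //; first by split=> //; split=> //; exact: mG.1.
  move=> S cS mS KS SG finS; apply: pfG => //; exact: mg.
by move=> P /GP PG; exact: subset_trans GK.
Qed.

End Transfer.

(** * Essential purely discrete submodules *)

Section Essential.
Variables (M : topologicalZmodType) (I : Type) (f : I -> M -> M).
Hypothesis f_good : good_ops f.
Implicit Types (E F L S T U : set M).

(* An open submodule [S] meeting [E] only in [U] is enlarged by Zorn's lemma to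
   a maximal one [T]; then [E / U] is essential in [L / T]. *)
Lemma om_full_essential L U E S : om_full f L U -> msub f E -> U `<=` E ->
  E `<=` L -> pd f E U -> msub f S -> U `<=` S -> S `<=` L -> ropen L S ->
  S `&` E `<=` U -> E `<=` U.
Proof.
move=> omU mE UE EL pdE mS US SL oS SE.
pose good T := [/\ msub f T, S `<=` T, T `<=` L & T `&` E `<=` U].
(* Zorn is applied to what is added to [S], so that the empty chain is bounded by [S] itself. *)
have [A [gT Amax]] : exists A, good (S `|` A) /\ forall B, A `<` B -> ~ good (S `|` B).
  apply: (@Zorn_bigcup _ [set X | good (S `|` X)]) => Ch ChP tot /=.
  set T := S `|` _.
  have cmp x y : T x -> T y -> T (x - y).
    have sub X a b : Ch X -> (S `|` X) a -> (S `|` X) b -> T (a - b).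
      move=> ChX Xa Xb; have [[gX _] _ _ _] := ChP _ ChX.
      by have [?|?] := subgB gX Xa Xb; [left|right; exists X].
    move=> [Sx|[X ChX Xx]] [Sy|[Y ChY Yy]].
    - by left; apply: subgB => //; exact: mS.1.
    - by apply: (sub Y) => //; [left|right].
    - by apply: (sub X) => //; [right|left].
    - have [XY|YX] := tot _ _ ChX ChY.
        by apply: (sub Y) => //; right => //; exact: XY.
      by apply: (sub X) => //; right => //; exact: YX.
  split.
  - split; first by split=> //; left; exact: mS.1.1.
    move=> i x [Sx|[X ChX Xx]]; first by left; exact: mS.2.
    have [[_ fX] _ _ _] := ChP _ ChX.
    by have [?|?] := fX i x (or_intror Xx); [left|right; exists X].
  - by move=> x; left.
  - move=> x [/SL//|[X ChX Xx]]; have [_ _ XL _] := ChP _ ChX.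
    by apply: XL; right.
  - move=> x [[Sx|[X ChX Xx]] Ex]; first exact: SE.
    by have [_ _ _ XE] := ChP _ ChX; apply: XE; split=> //; right.
set T := S `|` A in gT; have [mT ST TL TE] := gT.
have LT : L `<=` T.
  apply: omU; split=> //; first exact: subset_trans ST.
    exact: ropenS oS.
  move=> F mF TF FL finF.
  (* The trace of a finite extension [F] of [T] is finite over [U], hence trivial; [F] is then good
     and maximality gives [F = T]. *)
  have FE : F `&` E `<=` U.
    apply: pdE.
    - exact: msubI.
    - by move=> x Ux; split; [apply: TF; exact/ST/US|exact: UE].
    - by move=> x [].
    have [s [_ scov]] := finF.
    apply: (@fin_cells _ _ _ _ s (fun y x => T (x - y))) => [x [Fx _]|]; first exact: scov.
    move=> y x x' Tx Tx' [Fx Ex] [Fx' Ex']; apply: TE; split.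
      by rewrite (_ : x - x' = (x - y) - (x' - y)); [apply: subgB => //; exact: mT.1|zmod].
    by apply: subgB => //; exact: mE.1.
  have gF : good F by split=> //; exact: subset_trans TF.
  have SF : S `|` F = F by apply/setUidPr/(subset_trans ST).
  apply: contrapT => nFT; apply: (Amax F); last by rewrite SF.
  split; last by move=> FA; apply: nFT => x /FA; right.
  by move=> x Ax; apply: TF; right.
by move=> x Ex; apply: TE; split=> //; apply: LT; exact: EL.
Qed.

End Essential.

(** * Torsion quotients, cyclic subgroups and lattices *)

(** The trivial acting group: every subgroup is a submodule. *)
Definition no_ops (M : topologicalZmodType) : void -> M -> M := fun _ => id.

Section NoOps.
Variable M : topologicalZmodType.
Implicit Types (L S U : set M).

Lemma no_ops_good : good_ops (@no_ops M).
Proof.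
split=> //; exists setT; split=> [S _ _ []//| O nO].
by exists O => // -[].
Qed.

Lemma msub_no_ops S : subg S -> msub (@no_ops M) S.
Proof. by move=> gS; split=> // -[]. Qed.

(** Dividing by the elements [T] of finite order modulo [S] leaves a torsion free discrete group,
    which has no nonzero finite subgroup. *)
Lemma om_full_torsion L U S : om_full (@no_ops M) L U -> subg L -> subg S ->
  U `<=` S -> S `<=` L -> ropen L S ->
  forall x, L x -> exists2 k, (0 < k)%N & S (x *+ k).
Proof.
move=> omL gL gS US SL oS.
pose T := [set x | L x /\ exists2 k, (0 < k)%N & S (x *+ k)].
have ST : S `<=` T by move=> x Sx; split; [exact: SL|exists 1%N].
have gT : subg T.
  split; first by apply: ST; exact: subg0.
  move=> x y [Lx [k k0 Sk]] [Ly [l l0 Sl]]; split; first exact: subgB.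
  exists (k * l)%N; first by rewrite muln_gt0 k0.
  rewrite mulrnBl; apply: subgB => //; first by rewrite mulrnA; exact: subgMn.
  by rewrite mulnC mulrnA; exact: subgMn.
suff LT : L `<=` T by move=> x /LT[].
apply: omL; split.
- exact: msub_no_ops.
- exact: subset_trans ST.
- by move=> x [].
- exact: ropenS oS.
move=> F [gF _] TF FL finF x Fx; split; first exact: FL.
have [N N0 NP] := fin_over_exp gT gF finF.
have [_ [k k0 Sk]] := NP _ Fx; exists (N * k)%N; first by rewrite muln_gt0 N0.
by rewrite mulrnA.
Qed.

End NoOps.

Section Cyclic.
Variable M : topologicalZmodType.
Hypothesis lcM : exists2 K : set M, compact K & nbhs (0 : M) K.
Implicit Types (C D L O Q S U V : set M) (x y z : M).

(** Two far apart multiples in the same small cell of [Q] modulo [U] differ by a large multiple that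
    is close to [U]. *)
Lemma unbdd_return U Q x : subg U -> compact Q ->
  (forall N, exists2 k : int, (N < `|k|)%N & (Q `+ U) (x *~ k)) ->
  forall O N, nbhs (0 : M) O -> exists2 n, (N < n)%N & (O `+ U) (x *+ n).
Proof.
move=> gU cQ unb O N nO; have [ O' [nO' O'D O'N]] := nbhs0_split nO.
have [s sQ scov] := compact_cover0 cQ nO'.
have /choice[h hP] : forall N, exists k : int, (N < `|k|)%N /\ (Q `+ U) (x *~ k).
  by move=> m; have [k ? ?] := unb m; exists k.
(* Absolute values grow by more than [N] at each step, so every difference of two terms exceeds
   [N]. *)
pose k := fix k i := if i is j.+1 then h (absz (k j) + N)%N else h 0%N.
have kQ i : (Q `+ U) (x *~ k i) by case: i => [|i]; exact: (hP _).2.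
have kS i : (absz (k i) + N < absz (k i.+1))%N by exact: (hP _).1.
have kmono i j : (i < j)%N -> (absz (k i) + N < absz (k j))%N.
  elim: j => // j IHj; rewrite ltnS leq_eqVlt => /predU1P[->//|/IHj ltij].
  by apply: ltn_trans (kS j); apply: leq_trans ltij _; exact: leq_addr.
have /choice[c cP] : forall i, exists y, y \in s /\ (O' `+ U) (x *~ k i - y).
  move=> i; have [q [u [Qq [Uu kE]]]] := kQ i; have [y ys Oy] := scov _ Qq.
  by exists y; split=> //; exists (q - y), u; split=> //; split=> //; rewrite kE; zmod.
have [i [j [/andP[ltij _] cij]]] := pigeonhole (fun i => (cP i).1).
have [ o [u [ Oo [Uu iE]]]] := (cP i).2; have [ o' [u' [ Oo' [Uu' jE]]]] := (cP j).2.
have dE : x *~ (k j - k i) = (o' - o) + (u' - u).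
  rewrite mulrzBr (_ : x *~ k j - x *~ k i = (x *~ k j - c j) - (x *~ k i - c i)).
    by rewrite iE jE; zmod.
  by rewrite cij; zmod.
have dN : (N < absz (k j - k i))%N.
  by have := kmono _ _ ltij; lia.
exists (absz (k j - k i)) => //.
have [d0|d0] := lerP 0 (k j - k i).
  exists (o' - o), (u' - u); split; first by apply: O'D => //; exact: O'N.
  split; first exact: subgB.
  by rewrite -dE -{2}(gez0_abs d0).
exists (o - o'), (u - u'); split; first by apply: O'D => //; exact: O'N.
split; first exact: subgB.
rewrite (_ : o - o' + _ = - (x *~ (k j - k i))); last by rewrite dE; zmod.
by rewrite -mulrNz -(ltz0_abs d0).
Qed.

(* A. Weil's dichotomy for monothetic groups, modulo [U]. *)
Lemma cyclic_dichotomy U x : subg U ->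
  bdd U [set y | exists k : int, y = x *~ k] \/
  forall Q, compact Q -> exists N, forall k : int, (Q `+ U) (x *~ k) -> (`|k| <= N)%N.
Proof.
move=> gU; apply: contrapT => /not_orP[nb /existsNP[Q /not_implyP[cQ nN]]].
have ret : forall O N, nbhs (0 : M) O -> exists2 n, (N < n)%N & (O `+ U) (x *+ n).
  apply: unbdd_return cQ _ => // N; apply: contrapT => nk; apply: nN; exists N => k kQ.
  by rewrite leqNgt; apply/negP => ltN; apply: nk; exists k.
apply: nb.
have [D cD nD] := lcM; have [ O [nO OD ON _ O3]] := nbhs0_split3 nD.
pose G := [set y | exists (k : int) u, U u /\ y = x *~ k + u].
have cDG : compact (D `&` closure G).
  by apply: compact_closedI => //; exact: closed_closure.
(* A positive multiple of [x] brings [p] back near [U]; by compactness finitely many such multiples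
   serve for all points. *)
have /choice[m mP] : forall p, exists m : nat, (D `&` closure G) p ->
    (0 < m)%N /\ exists2 u, U u & exists o o', [/\ O o, O o' & p - x *+ m = o + o' + u].
  move=> p; have [[Dp clp]|?] := pselect ((D `&` closure G) p); last by exists 0%N.
  have [y [[k [u [Uu yE]]] Oy]] := clp _ (nbhs0_shiftN p nO).
  have [n ltn [ o [u' [ Oo [Uu' nE]]]]] := ret _ `|k|%N nO.
  exists (absz (k + n%:Z)) => _; split; first by move: ltn; lia.
  exists (u - u'); first exact: subgB.
  exists (p - y), (- o); split=> //; first exact: ON.
  have -> : x *+ (absz (k + n%:Z)) = x *~ k + x *+ n.
    by rewrite pmulrn gez0_abs ?mulrzDr //; move: ltn; lia.
  by rewrite nE yE; zmod.
have [|s sD scov] := @compact_cover_seq _ _ (fun p => [set p' | (D `+ U) (p' - x *+ m p)]) cDG.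
  move=> p /mP[_ [u Uu [ o [ o' [ Oo Oo' pE]]]]].
  apply: filterS (nbhs0_shift p nO) => p' /= Op.
  exists (o + o' + (p' - p)), u; split; first exact: O3.
  by split=> //; rewrite (_ : p' - _ = (p' - p) + (p - x *+ m p)); [rewrite pE; zmod|zmod].
pose N := \max_(p <- s) m p.
exists ([set y | y \in [seq x *+ j | j <- iota 0 N]] `+ [set d | D (- d)]).
  by apply: compactD; [exact: compact_seq|exact: compactN].
move=> _ [k ->].
(* The least such [j] is below [N]: otherwise one of the finitely many return multiples could be
   subtracted from it without leaving [D + U]. *)
have exj : exists j : nat, `[< (D `+ U) (x *+ j - x *~ k) >].
  have [n ltn [ o [u' [ Oo [Uu' nE]]]]] := ret _ `|k|%N nO.
  exists (absz (k + n%:Z)); apply/asboolP; exists o, u'; split; first exact: OD.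
  have -> : x *+ (absz (k + n%:Z)) = x *~ k + x *+ n.
    by rewrite pmulrn gez0_abs ?mulrzDr //; move: ltn; lia.
  by split=> //; rewrite -nE; zmod.
case: (ex_minnP exj) => j /asboolP [d [u [Dd [Uu jE]]]] jmin.
have dG : (D `&` closure G) d.
  split=> //; apply: subset_closure; exists (j%:Z - k), (- u); split; first exact: subgN.
  by rewrite mulrzBr -pmulrn jE; zmod.
have [p ps /= [d' [u' [Dd' [Uu' dE]]]]] := scov _ dG.
have mp0 : (0 < m p)%N by have [] := mP p (sD _ ps).
have jm : (j < m p)%N.
  rewrite ltnNge; apply/negP => lemj.
  have /jmin : `[< (D `+ U) (x *+ (j - m p) - x *~ k) >].
    apply/asboolP; exists d', (u' + u); split=> //; split; first exact: subgD.
    rewrite mulrnBr // (_ : x *+ j - _ - _ = (x *+ j - x *~ k) - x *+ m p); last by zmod.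
    by rewrite jE (_ : d + u - _ = (d - x *+ m p) + u); [rewrite dE; zmod|zmod].
  by move: lemj mp0; lia.
have jN : (j < N)%N by apply: leq_trans jm _; exact: leq_bigmax_seq.
exists (x *+ j - d), (- u); split; last first.
  by split; [exact: subgN|rewrite (_ : x *~ k = x *+ j - (x *+ j - x *~ k)); [rewrite jE; zmod|zmod]].
exists (x *+ j), (- d); split; first by apply/mapP; exists j => //; rewrite mem_iota.
by split=> //=; rewrite opprK.
Qed.

End Cyclic.

Section Span.
Variable M : topologicalZmodType.
Implicit Types (C D L O Q S U V : set M) (x y z : M).

Fixpoint gspan U (s : seq M) : set M :=
  if s is t :: s' then [set x | exists k : int, gspan U s' (x - t *~ k)] else U.

Lemma gspan_subg U s : subg U -> subg (gspan U s).
Proof.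
move=> gU; elim: s => //= t s IHs; split.
  by exists 0; rewrite mulr0z subr0; exact: subg0.
move=> x y [k Sx] [l Sy]; exists (k - l).
rewrite mulrzBr (_ : _ - _ = (x - t *~ k) - (y - t *~ l)); last by zmod.
exact: subgB.
Qed.

Lemma gspan_sub U s : U `<=` gspan U s.
Proof.
elim: s => //= t s IHs x Ux; exists 0; rewrite mulr0z subr0; exact: IHs.
Qed.

Lemma gspan_mem U s x : subg U -> x \in s -> gspan U s x.
Proof.
move=> gU; elim: s => //= t s IHs; rewrite inE => /predU1P[->|/IHs Sx].
  by exists 1; rewrite mulr1z subrr; exact: (subg0 (gspan_subg _ gU)).
by exists 0; rewrite mulr0z subr0.
Qed.

Lemma gspan_min U s S : subg S -> U `<=` S -> (forall x, x \in s -> S x) ->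
  gspan U s `<=` S.
Proof.
move=> gS US; elim: s => [|t s IHs] //= sS x [k Sk].
rewrite (_ : x = (x - t *~ k) + t *~ k); last by zmod.
apply: subgD => //; last by apply: subgMz => //; apply: sS; rewrite mem_head.
by apply: IHs Sk => y ys; apply: sS; rewrite inE ys orbT.
Qed.

Lemma fin_gspan U s : subg U ->
  (forall x, x \in s -> exists2 k, (0 < k)%N & U (x *+ k)) -> fin_over U (gspan U s).
Proof.
move=> gU; elim: s => [|t s IHs] tor.
  exists [:: 0]; split=> [y|x Ux]; first by rewrite inE => /eqP ->; exact: subg0.
  by exists 0; rewrite ?mem_head // subr0.
have gS := gspan_subg s gU.
have [k k0 Uk] := tor t (mem_head _ _).
apply: (@fin_over_trans _ U (gspan U s)) => //; first exact: subg0.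
  by apply: IHs => x xs; apply: tor; rewrite inE xs orbT.
apply: (@fin_overP _ _ _ [seq t *+ i | i <- iota 0 k]) => // x /= [l Sl].
have kz : k%:Z != 0 by case: (k) k0.
exists (t *+ `|(l %% k%:Z)%Z|%N).
  apply/mapP; exists `|(l %% k%:Z)%Z|%N => //; rewrite mem_iota add0n /=.
  by have := ltz_mod l kz; have := modz_ge0 l kz; lia.
rewrite (_ : x - _ = (x - t *~ l) + (t *~ l - t *+ `|(l %% k%:Z)%Z|%N)); last by zmod.
apply: subgD => //; rewrite pmulrn gez0_abs ?modz_ge0 // -mulrzBr.
rewrite {1}(divz_eq l k%:Z) addrK mulrC mulrzA.
by apply: subgMz => //; apply: gspan_sub; rewrite -pmulrn.
Qed.

Lemma box_compact n (d : nat -> M) N : exists2 C, compact C &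
  forall c : nat -> int, (forall i, (i < n)%N -> (`|c i| <= N)%N) ->
    C (\sum_(i < n) d i *~ c i).
Proof.
elim: n => [|n [C cC CP]].
  by exists [set 0]; [exact: compact_set1|move=> c _; rewrite big_ord0].
exists (C `+ [set x | x \in [seq d n *~ (j%:Z - N%:Z) | j <- iota 0 (N + N + 1)]]).
  by apply: compactD => //; exact: compact_seq.
move=> c cN; rewrite big_ord_recr /=.
exists (\sum_(i < n) d i *~ c i), (d n *~ c n); split; last split=> //.
  by apply: CP => i ltin; apply: cN; exact: ltnW.
apply/mapP; exists (absz (c n + N%:Z)).
  by rewrite mem_iota; have := cN n (ltnSn n); lia.
by congr (_ *~ _); have := cN n (ltnSn n); lia.
Qed.

End Span.

Section Lattice.
Variable M : topologicalZmodType.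
Hypothesis lcM : exists2 K : set M, compact K & nbhs (0 : M) K.
Implicit Types (C D L O Q S U V : set M) (x y z : M).

(** Only boundedly many multiples of [t] come near a given point modulo [U], so locally the group is
    a finite union of translates of [U]. *)
Lemma proper_cyclic_closed U t : closed U -> subg U ->
  (forall Q, compact Q -> exists N, forall k : int, (Q `+ U) (t *~ k) -> (`|k| <= N)%N) ->
  closed (gspan U [:: t]).
Proof.
move=> cU gU prop x clx; have [D cD nD] := lcM.
have [N NP] := prop ([set x] `+ D) (compactD (@compact_set1 _ x) cD).
have cS : closed ([set y | y \in [seq t *~ (j%:Z - N%:Z) | j <- iota 0 (N + N + 1)]] `+ U).
  by apply: closed_compactD => //; exact: compact_seq.
suff [y [u [yE [Uu ->]]]] : ([set y | y \in [seq t *~ (j%:Z - N%:Z) | j <- iota 0 (N + N + 1)]] `+ U) x.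
  move: yE => /mapP[j _ ->]; exists (j%:Z - N%:Z).
  by rewrite addrC addKr.
apply: cS => B nB; have nD' := nbhs0_shift x nD.
have [y [[k Uk] [By Dy]]] := clx _ (filterI nB nD').
exists y; split=> //; exists (t *~ k), (y - t *~ k); split; last by split=> //; zmod.
have kN : (`|k| <= N)%N.
  apply: NP; exists y, (- (y - t *~ k)); split; first by exists x, (y - x); split=> //; split=> //; zmod.
  by split; [exact: subgN|zmod].
by apply/mapP; exists (absz (k + N%:Z)); [rewrite mem_iota|congr (_ *~ _)]; lia.
Qed.

(** By the cyclic dichotomy each generator either has bounded multiples modulo [U] and is dropped,
    or it is properly embedded, becomes a lattice vector and is added to [U] for the remaining
    ones. *)
Lemma lattice (s : seq M) U V : closed U -> subg U -> subg V -> U `<=` V ->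
  (forall t, t \in s -> V t) -> bdd (gspan U s) V ->
  exists n (d : nat -> M), [/\ forall i, (i < n)%N -> V (d i),
    exists2 C, compact C & forall v, V v -> exists c : nat -> int,
       (C `+ U) (v - \sum_(i < n) d i *~ c i) &
    forall Q, compact Q -> exists N, forall c : nat -> int,
      (Q `+ U) (\sum_(i < n) d i *~ c i) -> forall i, (i < n)%N -> (`|c i| <= N)%N].
Proof.
elim: s U => [|t s IHs] U cU gU gV UV sV bV.
  exists 0%N, (fun=> 0); split=> //; last by move=> Q _; exists 0%N.
  have [C cC VC] := bV; exists C => // v /VC; exists (fun=> 0).
  by rewrite big_ord0 subr0.
have Vt : V t by apply: sV; rewrite mem_head.
have sV' y : y \in s -> V y by move=> ys; apply: sV; rewrite inE ys orbT.
have [bt|prop] := cyclic_dichotomy lcM t gU.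
  apply: IHs => //; apply: bdd_trans bV; first exact: gspan_subg.
  have gS := gspan_subg s gU.
  apply: bddS (bddD gS (bddSU (@gspan_sub _ U s) bt) (bdd_self gS)) => x /= [k Sk].
  by exists (t *~ k), (x - t *~ k); split; [exists k|split=> //; zmod].
pose U' := gspan U [:: t].
have cU' : closed U' by exact: proper_cyclic_closed.
have gU' : subg U' by exact: gspan_subg.
have U'V : U' `<=` V by apply: gspan_min => // y; rewrite inE => /eqP ->.
have bV' : bdd (gspan U' s) V.
  apply: bddSU bV; have gS := gspan_subg s gU'; apply: gspan_min => //.
    by apply: subset_trans (@gspan_sub _ U' s); exact: gspan_sub.
  move=> x; rewrite inE => /predU1P[->|]; last exact: gspan_mem.
  by apply: gspan_sub; apply: gspan_mem => //; rewrite mem_head.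
have [n [d [dV [C cC CP] dprop]]] := IHs U' cU' gU' gV U'V sV' bV'.
pose d' i := if (i < n)%N then d i else t.
have d'E (c : nat -> int) : \sum_(i < n.+1) d' i *~ c i = \sum_(i < n) d i *~ c i + t *~ c n.
  rewrite big_ord_recr /= /d' ltnn; congr (_ + _).
  by apply: eq_bigr => i _; rewrite ltn_ord.
exists n.+1, d'; split.
- by move=> i _; rewrite /d'; case: ifP => // ltin; exact: dV.
- exists C => // v /CP[c [a [u [Ca [[k Uk] vE]]]]].
  pose c' i := if (i < n)%N then c i else k; exists c'; rewrite d'E {2}/c' ltnn.
  rewrite (eq_bigr (fun i : 'I_n => d i *~ c i)); last by move=> i _; rewrite /c' ltn_ord.
  exists a, (u - t *~ k); split=> //; split=> //.
  by rewrite (_ : v - _ = v - \sum_(i < n) d i *~ c i - t *~ k); [rewrite vE; zmod|zmod].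
(* The first [n] coordinates are bounded working modulo [U']; they then fill a compact box, which
   bounds the last one modulo [U]. *)
- move=> Q cQ; have [N1 N1P] := dprop Q cQ; have [D cD DP] := box_compact n d N1.
  have [N2 N2P] := prop (Q `+ [set x | D (- x)]) (compactD cQ (compactN cD)).
  exists (maxn N1 N2) => c; rewrite d'E => -[q [u [Qq [Uu cE]]]].
  have c1 : forall i, (i < n)%N -> (`|c i| <= N1)%N.
    apply: N1P; exists q, (u - t *~ c n); split=> //; split.
      by exists (- c n); rewrite mulrNz opprK subrK.
    by rewrite (_ : \sum_(i < n) _ = (\sum_(i < n) d i *~ c i + t *~ c n) - t *~ c n);
      [rewrite cE; zmod|zmod].
  have c2 : (`|c n| <= N2)%N.
    apply: N2P; exists (q - \sum_(i < n) d i *~ c i), u; split; last first.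
      split=> //; rewrite (_ : t *~ c n = (\sum_(i < n) d i *~ c i + t *~ c n)
        - \sum_(i < n) d i *~ c i); [by rewrite cE; zmod|by zmod].
    exists q, (- \sum_(i < n) d i *~ c i); split=> //; split=> //=.
    by rewrite opprK; exact: DP.
  move=> i; rewrite ltnS leq_eqVlt => /predU1P[->|/c1 ci].
    by rewrite (leq_trans c2) // leq_maxr.
  by rewrite (leq_trans ci) // leq_maxl.
Qed.

End Lattice.

(** * Real charts *)

Section RealLemmas.
Variable R : realType.

Lemma bounded_multiples_eq0 (x B : R) : (forall m : nat, `|x| * m%:R <= B) -> x = 0.
Proof.
move=> xB; apply/eqP; rewrite -normr_le0 leNgt; apply/negP => x0.
have B0 : 0 <= B by have := xB 0%N; rewrite mulr0.
have := archi_boundP (divr_ge0 B0 (ltW x0)).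
by rewrite ltr_pdivrMr // mulrC ltNge xB.
Qed.

Variables (M : topologicalZmodType) (V : set M).
Hypothesis gV : subg V.

(* Hyers' theorem: a map with bounded additivity defect is uniformly close to
   an additive one. *)
Lemma quasi_additive (q : M -> R) (B : R) :
  (forall x y, V x -> V y -> `|q (x + y) - q x - q y| <= B) ->
  exists F : M -> R, (forall x y, V x -> V y -> F (x + y) = F x + F y) /\
    forall x m, V x -> `|F x * m.+1%:R - q (x *+ m.+1)| <= B.
Proof.
move=> qB.
have B0 : 0 <= B.
  by apply: le_trans (qB 0 0 _ _); [exact: normr_ge0|exact: subg0|exact: subg0].
have qn x n : V x -> `|q (x *+ n.+1) - q x *+ n.+1| <= B *+ n.
  move=> Vx; elim: n => [|n IHn]; first by rewrite !mulr1n subrr normr0 mulr0n.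
  have := qB x (x *+ n.+1) Vx (subgMn gV _ Vx); rewrite -mulrS => h.
  rewrite (mulrS (q x)) (_ : q _ - _ = (q (x *+ n.+2) - q x - q (x *+ n.+1))
    + (q (x *+ n.+1) - q x *+ n.+1)); last by zmod.
  by rewrite (mulrS B); apply: (le_trans (ler_normD _ _)); exact: lerD.
(* Comparing both sides with [q] at the product of the two multiples shows that each lower estimate
   is below each upper one; the limit of the averages is taken as a supremum. *)
pose E x := [set r | exists n, r = (q (x *+ n.+1) - B) / n.+1%:R].
have Eub x m : V x -> ubound (E x) ((q (x *+ m.+1) + B) / m.+1%:R).
  move=> Vx _ [n ->].
  rewrite ler_pdivrMr ?ltr0n // mulrAC ler_pdivlMr ?ltr0n //.
  have h1 := qn _ m (subgMn gV n.+1 Vx); have h2 := qn _ n (subgMn gV m.+1 Vx).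
  rewrite !mulr_natr mulrnBl mulrnDl (mulrS B m) (mulrS B n).
  move: h1 h2; rewrite -!mulrnA (mulnC n.+1) !ler_norml => /andP[+ _] /andP[_ +].
  move: (q (x *+ (m.+1 * n.+1))) => t; move: (q _ *+ m.+1) (q _ *+ n.+1) (B *+ m) (B *+ n) => a b c d.
  by lra.
have E0 x : E x !=set0 by exists ((q (x *+ 1) - B) / 1%:R), 0%N.
have F0 x m : V x -> `|sup (E x) * m.+1%:R - q (x *+ m.+1)| <= B.
  move=> Vx; rewrite ler_norml; apply/andP; split.
    rewrite lerBrDl -ler_pdivrMr ?ltr0n //; apply: ub_le_sup.
      by exists ((q (x *+ 1) + B) / 1%:R); exact: Eub.
    by exists m.
  by rewrite lerBlDl -ler_pdivlMr ?ltr0n //; apply: ge_sup => //; exact: Eub.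
exists (fun x => sup (E x)); split=> // x y Vx Vy; apply/eqP; rewrite -subr_eq0; apply/eqP.
(* Three approximation errors and one additivity defect, each at most [B]. *)
apply: (@bounded_multiples_eq0 _ (B *+ 4)) => -[|m]; first by rewrite mulr0 mulrn_wge0.
have h1 := F0 _ m (subgD gV Vx Vy); have h2 := F0 _ m Vx; have h3 := F0 _ m Vy.
have h4 := qB _ _ (subgMn gV m.+1 Vx) (subgMn gV m.+1 Vy).
rewrite -[m.+1%:R]ger0_norm // -normrM; move: h1 h2 h3 h4; rewrite mulrnDl.
set a := sup _; set b := sup _; set c := sup _; set k := m.+1%:R.
rewrite !ler_norml => /andP[? ?] /andP[? ?] /andP[? ?] /andP[? ?]; apply/andP; split; nra.
Qed.

End RealLemmas.

Section Chart.
Variables (R : realType) (M : topologicalZmodType).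
Hypothesis lcM : exists2 K : set M, compact K & nbhs (0 : M) K.
Implicit Types (C D K L O Q S U V : set M) (x y z : M).

Definition hull U X : set M :=
  [set x | forall S, subg S -> U `<=` S -> X `<=` S -> S x].

Lemma hull_subg U X : subg (hull U X).
Proof.
split=> [S gS _ _|x y hx hy S gS US XS]; first exact: subg0.
by apply: subgB => //; [exact: hx|exact: hy].
Qed.

Lemma hull_sub U X : U `<=` hull U X.
Proof. by move=> x Ux S _ US _; exact: US. Qed.

Lemma hull_gen U X : X `<=` hull U X.
Proof. by move=> x Xx S _ _; exact. Qed.

Lemma hull_min U X S : subg S -> U `<=` S -> X `<=` S -> hull U X `<=` S.
Proof. by move=> gS US XS x; apply. Qed.

(* The fourth clause says that [F] is proper modulo [U]; by the last one its values
   include the standard lattice. *)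
Definition chart U V n (F : M -> 'rV[R]_n) : Prop :=
  [/\ forall x y, V x -> V y -> F (x + y) = F x + F y,
      forall x, U x -> F x = 0,
      forall C, compact C -> exists r, forall v i, V v -> C v -> `|F v 0 i| <= r,
      forall r, exists2 C, compact C &
        forall v, V v -> (forall i, `|F v 0 i| <= r) -> (C `+ U) v &
      forall i, exists2 d, V d & F d = delta_mx 0 i].

(** Sums and opposites of elements of [C] return to [C] after subtracting one of finitely many
    elements [s], so [C + gspan U s] is a subgroup. *)
Lemma hull_gspan L U K : compact K -> nbhs (0 : M) K -> closed L -> subg L ->
  subg U -> exists2 s : seq M, (forall t, t \in s -> hull U (K `&` L) t) &
  bdd (gspan U s) (hull U (K `&` L)).
Proof.
move=> cK nK cL gL gU; set V := hull _ _.
have gV : subg V by exact: hull_subg.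
pose C := K `&` L; have cC : compact C by exact: compact_closedI.
have C0 : C 0 by split; [exact: nbhs_singleton|exact: subg0].
have CV : C `<=` V by exact: hull_gen.
pose Y := (C `+ C) `|` [set x | C (- x)].
have cY : compact Y by apply: compactU; [exact: compactD|exact: compactN].
have YV : Y `<=` V.
  move=> x [|/= /CV /(subgN gV)]; last by rewrite opprK.
  by apply: sumset_sub.
have YL : Y `<=` L.
  move=> x [|/= [_ /(subgN gL)]]; last by rewrite opprK.
  by apply: sumset_sub => // y [].
have [s sY scov] := compact_cover0 cY nK.
have Ycov x : Y x -> exists2 y, y \in s & C (x - y).
  move=> Yx; have [y ys Ky] := scov _ Yx; exists y => //; split=> //.
  by apply: subgB => //; apply: YL => //; exact: sY.
exists s => [t /sY/YV//|]; exists C => //.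
have gS := gspan_subg s gU; have sS := gspan_mem gU (s := s).
apply: hull_min.
- split; first by exists 0, 0; rewrite addr0; split=> //; split=> //; exact: subg0.
  move=> _ _ [c [g [Cc [Sg ->]]]] [c' [g' [Cc' [Sg' ->]]]].
  have [|y ys Cy] := Ycov (- c'); first by right; rewrite /= opprK.
  have [|z zs Cz] := Ycov (c + (- c' - y)); first by left; exists c, (- c' - y).
  exists (c + (- c' - y) - z), (g - g' + (y + z)); split=> //; split; last by zmod.
  apply: subgD => //; first exact: subgB.
  by apply: subgD => //; exact: sS.
- by move=> u Uu; exists 0, u; rewrite add0r; split=> //; split=> //; exact: gspan_sub.
- by move=> c Cc; exists c, 0; rewrite addr0; split=> //; split=> //; exact: subg0.
Qed.

(** The chosen lattice coordinates [c v] need be neither additive nor continuous. Their additivity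
    defect is the coordinate vector of a lattice element that is bounded modulo [U], hence is
    bounded. *)
Lemma chart_exists L U K : compact K -> nbhs (0 : M) K -> closed L -> subg L ->
  closed U -> subg U -> U `<=` L ->
  exists n (F : M -> 'rV[R]_n), chart U (hull U (K `&` L)) F.
Proof.
move=> cK nK cL gL cU gU UL; set V := hull _ _.
have gV : subg V by exact: hull_subg.
have [s sV bV] := hull_gspan cK nK cL gL gU.
have [n [d [dV [C cC CP] dprop]]] := lattice lcM cU gU gV (@hull_sub _ _) sV bV.
have /choice[c cP] : forall v, exists c : nat -> int, V v ->
    (C `+ U) (v - \sum_(i < n) d i *~ c i).
  move=> v; have [/CP[c ?]|?] := pselect (V v); first by exists c.
  by exists (fun=> 0).
have cbd Q : compact Q -> exists N, forall v i, V v -> (Q `+ U) v -> (i < n)%N ->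
    (`|c v i| <= N)%N.
  move=> cQ; have [N NP] := dprop _ (compactD cQ (compactN cC)).
  exists N => v i Vv [q [u [Qq [Uu vE]]]] ltin; apply: NP => //.
  have [a [u' [Ca [Uu' aE]]]] := cP _ Vv; exists (q - a), (u - u').
  split; first by exists q, (- a); split=> //; split=> //=; rewrite opprK.
  split; first exact: subgB.
  by rewrite (_ : \sum_(i < n) _ = v - (v - \sum_(i < n) d i *~ c v i));
    [rewrite aE vE; zmod|zmod].
(* The defect of the coordinates at [x + y] is the sum of the remainders of [x] and [y] minus that
   of [x + y]. *)
have [N NP] := dprop _ (compactD (compactD cC cC) (compactN cC)).
have def x y i : (i < n)%N -> V x -> V y -> (`|(c (x + y)%R i - c x i - c y i)%R| <= N)%N.
  move=> ltin Vx Vy; pose c' i := c (x + y) i - c x i - c y i.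
  apply: (NP c') => //.
  have -> : \sum_(i < n) d i *~ c' i = (x - \sum_(i < n) d i *~ c x i)
      + (y - \sum_(i < n) d i *~ c y i) - (x + y - \sum_(i < n) d i *~ c (x + y) i).
    have -> : \sum_(i < n) d i *~ c' i = \sum_(i < n) d i *~ c (x + y) i
      - \sum_(i < n) d i *~ c x i - \sum_(i < n) d i *~ c y i.
      by rewrite -!sumrB; apply: eq_bigr => j _; rewrite !mulrzBr.
    by zmod.
  have [a [u [Ca [Uu ->]]]] := cP _ Vx; have [a' [u' [Ca' [Uu' ->]]]] := cP _ Vy.
  have [b [v [Cb [Uv ->]]]] := cP _ (subgD gV Vx Vy).
  exists (a + a' - b), (u + u' - v); split.
    by exists (a + a'), (- b); split; [exists a, a'|split=> //=; rewrite opprK].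
  by split; [apply: subgB => //; exact: subgD|zmod].
have /choice[F FP] : forall i : 'I_n, exists F : M -> R,
    (forall x y, V x -> V y -> F (x + y) = F x + F y) /\
    forall x m, V x -> `|F x * m.+1%:R - (c (x *+ m.+1) i)%:~R| <= N%:R.
  move=> i; apply: (@quasi_additive _ _ _ gV (fun x => (c x i)%:~R)) => x y Vx Vy.
  by rewrite -!intrB -intr_norm -abszE -pmulrn ler_nat def.
have Fc x i : V x -> `|F i x - (c x i)%:~R| <= N%:R.
  by move=> Vx; have := (FP i).2 x 0%N Vx; rewrite mulr1 mulr1n.
have natint (k : int) (B : nat) : (`|k| <= B)%N -> `|k%:~R : R| <= B%:R.
  by move=> kB; rewrite -intr_norm -abszE -pmulrn ler_nat.
exists n, (fun v => \row_i F i v); split.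
- by move=> x y Vx Vy; apply/rowP => i; rewrite !mxE (FP i).1.
- move=> x Ux; apply/rowP => i; rewrite !mxE.
  have [B BP] := cbd _ (@compact_set1 _ (0 : M)).
  apply: (@bounded_multiples_eq0 _ _ (N%:R + B%:R)) => -[|m]; first by rewrite mulr0 addr_ge0.
  have Vx : V x by exact: hull_sub.
  have h := (FP i).2 x m Vx.
  have /natint : (`|c (x *+ m.+1) i| <= B)%N.
    apply: BP => //; first exact: (subgMn gV).
    by exists 0, (x *+ m.+1); rewrite add0r; split=> //; split=> //; exact: subgMn.
  move: h; rewrite -{2}[m.+1%:R]ger0_norm // -normrM.
  rewrite !ler_norml => /andP[? ?] /andP[? ?]; apply/andP; split; lra.
- move=> D cD; have [B BP] := cbd _ cD; exists (N%:R + B%:R) => v i Vv Dv; rewrite mxE.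
  have h := Fc v i Vv; have /natint := BP v i Vv (sumsetl gU Dv) (ltn_ord i).
  by move: h; rewrite !ler_norml => /andP[? ?] /andP[? ?]; apply/andP; split; lra.
- move=> r; have [D cD DP] := box_compact n d (Num.bound (r + N%:R)).
  exists (D `+ C); first exact: compactD.
  move=> v Vv rv; have [a [u [Ca [Uu vE]]]] := cP _ Vv.
  exists (\sum_(i < n) d i *~ c v i + a), u; split; last first.
    by split=> //; rewrite -addrA -vE; zmod.
  exists (\sum_(i < n) d i *~ c v i), a; split=> //; apply: DP => i ltin.
  have h := rv (Ordinal ltin); rewrite mxE in h; have h' := Fc v (Ordinal ltin) Vv.
  have le1 : `|(c v i)%:~R : R| <= r + N%:R.
    by move: h h'; rewrite !ler_norml => /andP[? ?] /andP[? ?]; apply/andP; split; lra.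
  have := le_lt_trans le1 (archi_boundP (le_trans (normr_ge0 _) le1)).
  by rewrite -intr_norm -abszE -pmulrn ltr_nat; exact: ltnW.
- move=> j; exists (d j); first exact: dV.
  apply/rowP => i; rewrite !mxE eqxx /=; apply/eqP; rewrite -subr_eq0; apply/eqP.
  have [B BP] := dprop _ cC.
  apply: (@bounded_multiples_eq0 _ _ (N%:R + B%:R)) => -[|m]; first by rewrite mulr0 addr_ge0.
  have Vd := dV j (ltn_ord j).
  have h := (FP i).2 (d j) m Vd.
  have /natint : (`|(m.+1%:Z * (nat_of_ord i == j)%:Z - c (d j *+ m.+1) i)%R| <= B)%N.
    pose c' (k : nat) := m.+1%:Z * (k == j)%:Z - c (d j *+ m.+1) k.
    apply: (BP c') => //.
    have -> : \sum_(k < n) d k *~ c' k = d j *+ m.+1 - \sum_(k < n) d k *~ c (d j *+ m.+1) k.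
      have dE : d j *+ m.+1 = \sum_(k < n) d k *~ (m.+1%:Z * (k == j :> nat)%:Z).
        rewrite (bigD1 j) //= eqxx mulr1 -pmulrn big1 ?addr0 // => k /negPf.
        by rewrite -val_eqE => -> /=; rewrite mulr0.
      by rewrite [X in _ = X - _]dE -sumrB; apply: eq_bigr => k _; rewrite mulrzBr.
    by apply: cP; exact: (subgMn gV).
  move: h; rewrite -{2}[m.+1%:R]ger0_norm // -normrM intrB intrM -!pmulrn.
  rewrite -val_eqE !ler_norml => /andP[? ?] /andP[? ?]; apply/andP; split; lra.
Qed.

End Chart.

Section ChartTheory.
Variables (R : realType) (M : topologicalZmodType).
Hypothesis lcM : exists2 K : set M, compact K & nbhs (0 : M) K.
Variables (L U K : set M).
Hypotheses (cK : compact K) (nK : nbhs (0 : M) K) (cL : closed L) (gL : subg L).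
Hypotheses (cU : closed U) (gU : subg U) (UL : U `<=` L).
Variable V : set M.
Hypothesis VE : V = hull U (K `&` L).
Variables (n : nat) (F : M -> 'rV[R]_n).
Hypothesis chF : chart U V F.
Implicit Types (C D O Q S : set M) (x y z : M).

Let gV : subg V. Proof. by rewrite VE; exact: hull_subg. Qed.
Let UV : U `<=` V. Proof. by rewrite VE; exact: hull_sub. Qed.
Let KLV x : K x -> L x -> V x.
Proof. by move=> Kx Lx; rewrite VE; apply: hull_gen. Qed.

Lemma hull_ropen : ropen L V.
Proof. by exists K => // x [Kx Lx]; apply: KLV. Qed.

Lemma hull_le : V `<=` L.
Proof. by rewrite VE; apply: hull_min => // x []. Qed.

Lemma hull_closed : closed V.
Proof. exact: ropen_closed cL gL gV hull_le hull_ropen. Qed.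

Lemma chartD x y : V x -> V y -> F (x + y) = F x + F y.
Proof. by have [+ _ _ _ _] := chF; exact. Qed.

Lemma chartU x : U x -> F x = 0.
Proof. by have [_ + _ _ _] := chF; exact. Qed.

Lemma chartN x : V x -> F (- x) = - F x.
Proof.
move=> Vx; apply: (addrI (F x)); rewrite subrr -chartD //; last exact: subgN.
by rewrite subrr; apply: chartU; exact: subg0.
Qed.

Lemma chartB x y : V x -> V y -> F (x - y) = F x - F y.
Proof. by move=> Vx Vy; rewrite chartD ?chartN //; exact: subgN. Qed.

Lemma chartMn x m : V x -> F (x *+ m) = F x *+ m.
Proof.
move=> Vx; elim: m => [|m IHm]; first by rewrite !mulr0n; apply: chartU; exact: subg0.
by rewrite !mulrS chartD ?IHm //; exact: subgMn.
Qed.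

Lemma chartMz x k : V x -> F (x *~ k) = F x *~ k.
Proof.
move=> Vx; case: k => m; first exact: chartMn.
by rewrite NegzE !mulrNz chartN ?chartMn //; exact: subgMn.
Qed.

Lemma chart_sum (I : Type) (r : seq I) (v : I -> M) : (forall i, V (v i)) ->
  F (\sum_(i <- r) v i) = \sum_(i <- r) F (v i).
Proof.
move=> Vv; elim: r => [|i r IHr]; first by rewrite !big_nil; apply: chartU; exact: subg0.
by rewrite !big_cons chartD ?IHr //; exact: subg_sum.
Qed.

(** [F] is bounded by some [r] on [K], so it is at most [r / m] on points whose [m]-th multiple lies
    in [K]. *)
Lemma chart_continuous (e : R) : 0 < e -> exists2 O, nbhs (0 : M) O &
  forall v i, V v -> O v -> `|F v 0 i| <= e.
Proof.
move=> e0; have [_ _ + _ _] := chF => /(_ _ cK)[r rP].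
pose m := (Num.bound (r / e)).+1.
have [ O nO OK] := nbhs0_mulrn m nK; exists O => // v i Vv Ov.
have := rP _ i (subgMn gV m Vv) (OK _ Ov).
rewrite chartMn // mulmxnE normrMn => h.
have rm : r <= e *+ m.
  have [r0|r0] := lerP 0 r; last by rewrite ltW // (lt_le_trans r0) // mulrn_wge0 // ltW.
  have := archi_boundP (divr_ge0 r0 (ltW e0)); rewrite ltr_pdivrMr // => /ltW h'.
  rewrite -mulr_natl (le_trans h') //; apply: ler_wpM2r; first exact: ltW.
  by rewrite ler_nat.
by move: (le_trans h rm); rewrite lerMn2r.
Qed.

(** For closed [L] and [U], this is the union of the compact subgroups of [L / U]. *)
Definition bel : set M :=
  [set x | L x /\ bdd U [set y | exists k : int, y = x *~ k]].

Lemma bel_subg : subg bel.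
Proof.
split.
  split; first exact: subg0.
  apply: bddS (bdd_self gU) => _ [k ->]; rewrite mul0rz; exact: subg0.
move=> x y [Lx bx] [Ly by_]; split; first exact: subgB.
apply: bddS (bddD gU bx (bddN gU by_)) => _ [k ->].
exists (x *~ k), (- (y *~ k)); split; first by exists k.
by split; [exists k; rewrite opprK|rewrite mulrzBl].
Qed.

Lemma chart_ker v : V v -> F v = 0 <-> bel v.
Proof.
move=> Vv; split=> [Fv|[_ [C cC CP]]].
  split; first exact: hull_le.
  have [_ _ _ + _] := chF => /(_ 0)[C cC CP]; exists C => // _ [k ->].
  by apply: CP => [|i]; [exact: subgMz|rewrite chartMz // Fv mul0rz mxE normr0].
have [_ _ + _ _] := chF => /(_ _ cC)[r rP].
apply/rowP => i; rewrite mxE; apply: (@bounded_multiples_eq0 _ _ r) => m.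
have [|c [u [Cc [Uu cE]]]] := CP (v *+ m); first by exists m%:Z.
have Vc : V c.
  rewrite (_ : c = v *+ m - u); last by rewrite cE; zmod.
  by apply: subgB => //; [exact: subgMn|exact: UV].
have := rP _ i Vc Cc; suff -> : F c = F v *+ m by rewrite mulmxnE normrMn mulr_natr.
by rewrite -chartMn // cE chartD ?(chartU Uu) ?addr0 //; exact: UV.
Qed.

Lemma bel_bdd : bdd U (V `&` bel).
Proof.
have [_ _ _ + _] := chF => /(_ 0)[C cC CP]; exists C => // v [Vv bv].
by apply: CP => // i; rewrite ((chart_ker Vv).2 bv) mxE normr0.
Qed.

Section Onto.
Variable S : set M.
Hypotheses (cS : closed S) (gS : subg S) (US : U `<=` S) (SL : S `<=` L).
Hypothesis omS : om_full (@no_ops M) S U.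
Hypothesis VS : V `<=` (K `&` L) `+ S.

Let small (e : R) : set 'rV[R]_n :=
  [set h | exists v, [/\ V v, S v, F v = h & forall i, `|h 0 i| <= e]].

(** The kernel of [F *m w] is then open in [V & S]. Torsion of [S] modulo open subgroups makes
    [F *m w] vanish on [V & S]. As [S] is cocompact, it is bounded on all multiples of the lattice
    vectors, hence zero on them. *)
Let small_spans e (w : 'cV[R]_n) : 0 < e -> (forall h, small e h -> h *m w = 0) -> w = 0.
Proof.
move=> e0 hw.
pose T := [set v | [/\ V v, S v & F v *m w = 0]].
have gT : subg T.
  split; first by split; [exact: subg0|exact: subg0|rewrite (chartU (subg0 gU)) mul0mx].
  move=> x y [Vx Sx wx] [Vy Sy wy]; split; [exact: subgB|exact: subgB|].
  by rewrite chartB // mulmxBl wx wy subrr.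
have oT : ropen S T.
  have [ O nO OP] := chart_continuous e0; exists (O `&` K); first exact: filterI.
  move=> x [[ Ox Kx] Sx]; have Vx : V x by apply: KLV => //; exact: SL.
  by split=> //; apply: hw; exists x; split=> // i; exact: OP.
have tor x : V x -> S x -> F x *m w = 0.
  move=> Vx Sx; have [||k k0 [_ _]] := om_full_torsion omS gS gT _ _ oT Sx.
  - by move=> u Uu; split; [exact: UV|exact: US|rewrite (chartU Uu) mul0mx].
  - by move=> u [].
  rewrite chartMn // => /matrixP h; apply/matrixP => i j; move: (h i j).
  rewrite -scaler_nat -scalemxAl !mxE => /eqP; rewrite mulf_eq0 pnatr_eq0.
  by rewrite eqn0Ngt k0 => /eqP.
have [_ _ + _ Fd] := chF => /(_ _ cK)[r rP].
apply/colP => j; rewrite mxE; have [d Vd dE] := Fd j.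
apply: (@bounded_multiples_eq0 _ _ (\sum_i r * `|w i 0|)) => m.
have [c [s [[Kc Lc] [Ss mE]]]] := VS (subgMn gV m Vd).
have Vc : V c by apply: KLV.
have Vs : V s.
  rewrite (_ : s = d *+ m - c); last by rewrite mE; zmod.
  by apply: subgB => //; exact: subgMn.
have : F (d *+ m) *m w = F c *m w by rewrite mE chartD // mulmxDl (tor s) // addr0.
rewrite chartMn // dE => /matrixP /(_ 0 0).
rewrite -scaler_nat -scalemxAl -rowE !mxE => h.
rewrite -[X in _ * X](ger0_norm (ler0n R m)) -normrM mulrC h.
apply: (le_trans (ler_norm_sum _ _ _)); apply: ler_sum => i _.
by rewrite normrM ler_wpM2r // rP.
Qed.

Let small_basis e : 0 < e -> exists2 A : 'M[R]_n, A \in unitmx & forall i, small e (row i A).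
Proof.
move=> e0; pose P k := exists2 A : 'M[R]_(k, n), row_free A & forall i, small e (row i A).
have P0 : exists k, `[< P k >].
  by exists 0%N; apply/asboolP; exists 0; [rewrite /row_free mxrank0|case].
have Pn k : `[< P k >] -> (k <= n)%N.
  by move=> /asboolP[A /eqP rA _]; have := rank_leq_col A; rewrite rA.
case: (ex_maxnP P0 Pn) => k /asboolP[A freeA Asm] kmax.
have [ltkn|] := ltnP k n; last first.
  move=> lenk; have kn : k = n by apply/eqP; rewrite eqn_leq lenk Pn //; apply/asboolP; exists A.
  move: A freeA Asm; rewrite kn => A freeA Asm.
  by exists A => //; rewrite -row_free_unit.
have [w wP] : exists w : 'cV_n, w != 0 /\ A *m w = 0.
  have : cokermx A != 0.
    rewrite -mxrank_eq0 mxrank_coker; move: freeA; rewrite /row_free => /eqP ->.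
    by rewrite subn_eq0 -ltnNge.
  move: (cokermx A) (mulmx_coker A) => Z AZ /eqP nz.
  apply: contrapT => nw; apply: nz; apply/matrixP => i j.
  rewrite mxE; apply: contrapT => nij; apply: nw; exists (col j Z); split.
    by apply/eqP => /colP /(_ i); rewrite !mxE; exact: nij.
  by rewrite colE mulmxA AZ mul0mx.
have [w0 Aw] := wP; suff : w = 0 by move=> wE; rewrite wE eqxx in w0.
apply: (small_spans e0) => h hsm.
have hA : (h <= A)%MS.
  apply: contrapT => /negP nhA; have /kmax : `[< P (k + 1)%N >]; last by rewrite addn1 ltnn.
  apply/asboolP; exists (col_mx A h).
    have : (\rank A < \rank (col_mx A h))%N.
      rewrite -addsmxE; apply: rank_ltmx.
      by rewrite ltmxE addsmxSl /= addsmx_sub submx_refl.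
    rewrite (eqP freeA : \rank A = k) => ltk.
    by rewrite /row_free eqn_leq rank_leq_row [leqLHS]addn1.
  by move=> i; case: (split_ordP i) => j ->; rewrite ?rowKu ?rowKd ?row_id.
by case/submxP: hA => D ->; rewrite -mulmxA Aw mulmx0.
Qed.

Let dense (y : 'rV[R]_n) e : 0 < e ->
  exists v, [/\ V v, S v & forall i, `|F v 0 i - y 0 i| <= e].
Proof.
(* Rounding [n] coefficients down costs at most [n] times the size of the basis vectors. *)
move=> e0; have e'0 : 0 < e / n.+1%:R by rewrite divr_gt0 // ltr0n.
have [A Au Asm] := small_basis e'0; have [v vP] := choice Asm.
have [t ->] : exists t : 'rV_n, y = \sum_i t 0 i *: row i A.
  by exists (y *m invmx A); rewrite -mulmx_sum_row mulmxKV.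
pose k i := Num.floor (t 0 i).
have Vv i : V (v i *~ k i) by apply: subgMz => //; have [] := vP i.
exists (\sum_i v i *~ k i); split.
- exact: subg_sum.
- by apply: subg_sum => // i; apply: subgMz => //; have [] := vP i.
move=> j; rewrite chart_sum //.
rewrite !summxE -sumrB; apply: (le_trans (ler_norm_sum _ _ _)).
apply: (@le_trans _ _ (\sum_(i < n) e / n.+1%:R)).
  apply: ler_sum => i _; have [Vi _ FE sm] := vP i; rewrite chartMz // FE.
  rewrite !mxE -scaler_int !mxE -mulrBl normrM -[leRHS]mul1r ler_pM //.
    have := floor_le (t 0 i); have := floorD1_gt (t 0 i); rewrite -/(k i) intrD mulr1z.
    by rewrite ler_norml => ? ?; apply/andP; split; lra.
  by have := sm j; rewrite mxE.
rewrite sumr_const card_ord; apply: (@le_trans _ _ ((e / n.+1%:R) *+ n.+1)).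
  by rewrite (mulrSr (e / _)) lerDl ltW.
by rewrite -mulr_natr divfK // pnatr_eq0.
Qed.

(** The values on [S] are dense; since [F] is proper modulo [U], the sets of better and better
    approximate solutions have a common point. *)
Lemma chart_onto (y : 'rV[R]_n) : exists v, [/\ V v, S v & F v = y].
Proof.
pose Z (m : nat) : set M := [set v | [/\ V v, S v & forall i, `|F v 0 i - y 0 i| <= m.+1%:R^-1]].
have [B yB] : exists B, forall i, `|y 0 i| <= B.
  by exists (\sum_i `|y 0 i|) => i; rewrite (bigD1 i) //= lerDl sumr_ge0.
have [_ _ _ + _] := chF => /(_ (B + 1))[C cC CP].
have [|||||v vP] := @bdd_directed _ U (C `+ U) [set Z m | m in setT] gU.
- exact: bddS (bddD gU (bdd_compact gU cC) (bdd_self gU)).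
- split; first by exists (Z 0%N), 0%N.
  move=> _ _ [a _ <-] [b _ <-]; exists (Z (maxn a b)); first by exists (maxn a b).
  have mono p q : (p <= q)%N -> Z q `<=` Z p.
    move=> lepq v [Vv Sv h]; split=> // i; apply: le_trans (h i) _.
    by rewrite lef_pV2 ?posrE ?ltr0n // ler_nat.
  by move=> v Zv; split; apply: mono Zv; [exact: leq_maxl|exact: leq_maxr].
- move=> _ [m _ <-] x clx.
  have Vx : V x by apply: hull_closed; move: x clx; apply: closureS => z [].
  have Sx : S x by apply: cS; move: x {Vx} clx; apply: closureS => z [].
  split=> // i; apply/ler_addgt0Pl => e e0.
  have [ O nO OP] := chart_continuous e0.
  have [z [[Vz Sz hz] Oz]] := clx _ (nbhs0_shiftN x nO).
  have := OP _ i (subgB gV Vx Vz) Oz; rewrite chartB // !mxE; have := hz i.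
  move: (m.+1%:R^-1) (F x 0 i) (F z 0 i) (y 0 i) => a b c d.
  by rewrite !ler_norml => /andP[? ?] /andP[? ?]; apply/andP; split; lra.
- move=> _ x u [m _ <-] [Vx Sx h] Uu; split; [|exact: subgD (US Uu)|].
    by apply: subgD => //; exact: UV.
  by rewrite chartD ?(chartU Uu) ?addr0 //; exact: UV.
- move=> _ [m _ <-]; have [|v [Vv Sv h]] := @dense y m.+1%:R^-1; first by rewrite invr_gt0 ltr0n.
  exists v => //; apply: CP => // i; have := h i; have := yB i.
  have : m.+1%:R^-1 <= 1 :> R by rewrite invf_le1 ?ltr0n // ler1n.
  move: (m.+1%:R^-1) (F v 0 i) (y 0 i) => a b c.
  by rewrite !ler_norml => ? /andP[? ?] /andP[? ?]; apply/andP; split; lra.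
exists v; have [Vv Sv _] : Z 0%N v by apply: vP; exists 0%N.
split=> //; apply/rowP => i; apply/eqP; rewrite -subr_eq0; apply/eqP.
apply: (@bounded_multiples_eq0 _ _ 1) => -[|m]; first by rewrite mulr0.
have [_ _ /(_ i)] : Z m v by apply: vP; exists m.
by rewrite -ler_pdivlMr ?ltr0n // div1r.
Qed.

End Onto.
End ChartTheory.

(** * Extending open subgroups of the bounded part *)

Lemma additive_continuous (M N : topologicalZmodType) (h : M -> N) :
  (forall x y, h (x + y) = h x + h y) ->
  (forall O, nbhs (0 : N) O -> exists2 O', nbhs (0 : M) O' & forall x, O' x -> O (h x)) ->
  continuous h.
Proof.
move=> hD h0 x B nB; have [ O' nO' OP] := h0 _ (nbhs_shift0 nB).
apply: filterS (nbhs0_shift x nO') => y /= /OP /=; rewrite -hD.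
by rewrite (_ : x + (y - x) = y); last zmod.
Qed.

Lemma compactMn (M : topologicalZmodType) (C : set M) m : compact C ->
  compact [set x *+ m | x in C].
Proof.
move=> cC; apply: continuous_compact => //; apply: continuous_subspaceT.
by apply: additive_continuous => [x y|O nO]; [exact: mulrnDl|exact: nbhs0_mulrn].
Qed.

Lemma common_multiple (M : topologicalZmodType) (S : set M) (s : seq M) : subg S ->
  (forall y, y \in s -> exists2 k, (0 < k)%N & S (y *+ k)) ->
  exists2 k, (0 < k)%N & forall y, y \in s -> S (y *+ k).
Proof.
move=> gS; elim: s => [|t s IHs] tor; first by exists 1%N.
have [k k0 kP] := IHs (fun y ys => tor y (mem_behead (s := t :: s) ys)).
have [l l0 Sl] := tor t (mem_head _ _).
exists (l * k)%N; first by rewrite muln_gt0 l0.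
move=> y; rewrite inE => /predU1P[->|/kP Sy]; first by rewrite mulrnA; exact: subgMn.
by rewrite mulnC mulrnA; exact: subgMn.
Qed.

Section Extension.
Variables (R : realType) (M : topologicalZmodType).
Hypothesis lcM : exists2 K : set M, compact K & nbhs (0 : M) K.
Variables (L U : set M).
Hypotheses (cL : closed L) (gL : subg L) (cU : closed U) (gU : subg U) (UL : U `<=` L).

Lemma bel_sub : U `<=` bel L U.
Proof.
move=> u Uu; split; first exact: UL.
by apply: bddS (bdd_self gU) => _ [k ->]; exact: subgMz.
Qed.

(** Near zero [bel] is the kernel of a chart, which is bounded modulo [U]; the closure of that
    kernel is bounded too and so consists of bounded elements. *)
Lemma bel_closed : closed (bel L U).
Proof.
have [K cK nK] := lcM; have [V VE] : exists V, V = hull U (K `&` L) by exists (hull U (K `&` L)).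
have [n [F chF]] := chart_exists R lcM cK nK cL gL cU gU UL; rewrite -VE in chF.
have gV : subg V by rewrite VE; exact: hull_subg.
have cV : closed V := hull_closed nK cL gL UL VE.
have gB := bel_subg gL gU.
suff cI : closed (V `&` bel L U).
  apply: (loc_closed cI gB) => [x []//|]; apply: ropenI; last exact: ropen_self.
  by exists K => // x [Kx [Lx _]]; rewrite VE; apply: hull_gen.
move=> x clx.
have gI : subg (closure (V `&` bel L U)) by exact/closure_subg/subgI.
have Vx : V x by apply: cV; move: x clx; apply: closureS => y [].
split=> //; split; first exact: (hull_le gL UL VE).
have := bdd_closure cU (bel_bdd gL gU UL VE chF).
by apply: bddS => _ [k ->]; exact: (subgMz gI).
Qed.

(* [W] is [mV + Oo], where [V] is compactly generated modulo [U] and [m] kills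
   the finite group [(V `&` bel) / (V `&` Oo)]. *)
Lemma bel_extend (Oo : set M) : om_full (@no_ops M) L U -> subg Oo -> U `<=` Oo ->
  Oo `<=` bel L U -> ropen (bel L U) Oo ->
  exists W, [/\ subg W /\ W `<=` L, Oo `<=` W, ropen L W, W `&` bel L U `<=` Oo &
    forall W2, subg W2 -> Oo `<=` W2 -> W2 `<=` L -> ropen L W2 -> W `<=` W2].
Proof.
move=> omL gO UO OB oO.
have [K cK nK] := lcM; have [V VE] : exists V, V = hull U (K `&` L) by exists (hull U (K `&` L)).
have [n [F chF]] := chart_exists R lcM cK nK cL gL cU gU UL; rewrite -VE in chF.
have gV : subg V by rewrite VE; exact: hull_subg.
have UV : U `<=` V by rewrite VE; exact: hull_sub.
have VL : V `<=` L := hull_le gL UL VE.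
have cV : closed V := hull_closed nK cL gL UL VE.
have gB := bel_subg gL gU; have cB := bel_closed.
have ker v : V v -> F v = 0 <-> bel L U v := chart_ker gL gU UL VE chF (v := v).
have bB : bdd U (V `&` bel L U) := bel_bdd gL gU UL VE chF.
have FB x y : V x -> V y -> F (x - y) = F x - F y.
  by move=> Vx Vy; exact: (chartB gU VE chF).
have FMn x k : V x -> F (x *+ k) = F x *+ k.
  by move=> Vx; exact: (chartMn gU VE chF).
have gVB := subgI gV gB.
have finO : fin_over Oo (V `&` bel L U).
  by apply: (@bdd_fin _ U (bel L U)) => //; exact: bel_sub.
have [m m0 mP] := fin_over_exp gO gVB finO.
(* Since the chart is onto, [V] is divisible up to its kernel. *)
have div k v : (0 < k)%N -> V v -> exists2 w, V w & (V `&` bel L U) (v - w *+ k).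
  move=> k0 Vv.
  have [|w [Vw _ Fw]] := chart_onto cK nK cL gL gU UL VE chF cL gL UL
    (@subset_refl _ L) omL _ (k%:R^-1 *: F v).
    move=> x Vx; exists 0, x; rewrite add0r; split; last by split=> //; exact: VL.
    by split; [exact: nbhs_singleton|exact: subg0].
  have Vd : V (v - w *+ k) by apply: subgB => //; exact: subgMn.
  exists w => //; split=> //; apply/ker => //.
  rewrite FB //; last exact: subgMn.
  rewrite FMn // Fw -scaler_nat scalerA divff ?scale1r ?subrr //.
  by rewrite pnatr_eq0 -lt0n.
pose W := [set x | exists v o, [/\ V v, Oo o & x = v *+ m + o]].
have gW : subg W.
  split; first by exists 0, 0; rewrite mul0rn addr0; split=> //; exact: subg0.
  move=> _ _ [v [ o [Vv Oo_ ->]]] [v' [ o' [Vv' Oo' ->]]].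
  exists (v - v'), (o - o'); split; [exact: subgB|exact: subgB|].
  by rewrite mulrnBl; zmod.
have OW : Oo `<=` W.
  by move=> o Oo_; exists 0, o; split=> //; [exact: subg0|rewrite mul0rn add0r].
exists W; split=> //.
- split=> // _ [v [ o [Vv Oo_ ->]]]; apply: subgD => //; last by have [] := OB _ Oo_.
  by apply: subgMn => //; exact: VL.
(* [G] has finite index in [V] by divisibility, and is closed because the chart is proper; hence it
   is open. *)
- pose G := [set x | exists v o, [/\ V v, V o, Oo o & x = v *+ m + o]].
  have gG : subg G.
    split; first by exists 0, 0; rewrite mul0rn addr0; split=> //; exact: subg0.
    move=> _ _ [v [ o [Vv Vo Oo_ ->]]] [v' [ o' [Vv' Vo' Oo' ->]]].
    exists (v - v'), (o - o'); split; [exact: subgB|exact: subgB|exact: subgB|].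
    by rewrite mulrnBl; zmod.
  have GV : G `<=` V.
    by move=> _ [v [ o [Vv Vo _ ->]]]; apply: subgD => //; exact: subgMn.
  have cO : closed Oo by exact: (ropen_closed cB gB).
  have cG : closed G.
    move=> x clx; have Vx : V x by apply: cV; move: x clx; exact: closureS.
    have [_ _ Fb Fp _] := chF.
    have [r rP] := Fb _ (compactD (@compact_set1 _ x) cK).
    have [C cC CP] := Fp r.
    have cS : closed ([set c *+ m | c in C `&` V] `+ (V `&` Oo)).
      apply: closed_compactD; last exact: closedI.
      by apply: compactMn; exact: compact_closedI.
    suff [_ [ o [[c [_ Vc] <-] [[Vo Oo_] ->]]]] : ([set c *+ m | c in C `&` V] `+ (V `&` Oo)) x.
      by exists c, o.
    apply: cS => B nB.
    have [y [[v [ o [Vv Vo Oo_ yE]]] [By Ky]]] := clx _ (filterI nB (nbhs0_shift x nK)).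
    exists y; split=> //.
    have Fy i : `|F y 0 i| <= r.
      apply: rP; first by apply: GV; exists v, o.
      by exists x, (y - x); split=> //; split=> //; zmod.
    have [c [u [Cc [Uu vE]]]] : (C `+ U) v.
      apply: CP => // i; apply: le_trans (Fy i).
      have -> : F y = F v *+ m.
        rewrite yE (chartD chF) //; last exact: subgMn.
        by rewrite ((ker o Vo).2 (OB _ Oo_)) addr0 FMn.
      by rewrite mulmxnE normrMn -{1}[`|F v 0 i|]mulr1n ler_wpMn2l.
    have Vc : V c.
      rewrite (_ : c = v - u); last by rewrite vE; zmod.
      by apply: subgB => //; exact: UV.
    exists (c *+ m), (u *+ m + o); split; first by exists c.
    split; last by rewrite yE vE mulrnDl; zmod.
    split; apply: subgD => //; apply: subgMn => //; [exact: UV|exact: UO].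
  have finG : fin_over G V.
    have [s [sB scov]] := finO; apply: (@fin_overP _ _ _ s) => // v Vv.
    have [w Vw Bw] := div m v m0 Vv; have [y ys Oy] := scov _ Bw; exists y => //.
    exists w, (v - w *+ m - y); split=> //; last by zmod.
    by apply: subgB => //; [exact: Bw.1|exact: (sB _ ys).1].
  have [ O1 nO1 O1G] := fin_ropen cG gG finG.
  exists (O1 `&` K); first exact: filterI.
  move=> x [[ O1x Kx] Lx]; have [|v [ o [Vv _ Oo_ ->]]] := O1G x; last by exists v, o.
  by split=> //; rewrite VE; apply: hull_gen.
- move=> _ [[v [ o [Vv Oo_ ->]]] Bx]; apply: subgD => //; apply: mP; split=> //.
  have Bv : bel L U (v *+ m).
    rewrite (_ : v *+ m = v *+ m + o - o); last by zmod.
    by apply: subgB => //; exact: OB.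
  apply/ker => //; have := (ker _ (subgMn gV m Vv)).2 Bv; rewrite FMn // => /eqP.
  by rewrite -scaler_nat scaler_eq0 pnatr_eq0 eqn0Ngt m0 /= => /eqP.
- move=> W2 gW2 OW2 W2L oW2.
  have UW2 : U `<=` W2 by exact: subset_trans OW2.
  (* The compact set generating [V] over [U] meets finitely many cosets of [W2], all of finite
     order, so one exponent serves. *)
  have [k k0 kP] : exists2 k, (0 < k)%N & forall x, V x -> W2 (x *+ k).
    have [s [sK scov]] : fin_over W2 (K `&` L).
      apply: (@bdd_fin _ U L) => //.
      by apply: bdd_compact => //; exact: compact_closedI.
    have [k k0 kP] : exists2 k, (0 < k)%N & forall y, y \in s -> W2 (y *+ k).
      apply: common_multiple => // y /sK[_ Ly].
      exact: (om_full_torsion omL gL gW2 UW2 W2L oW2).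
    exists k => // x; rewrite VE; apply: (@hull_min _ U (K `&` L) [set x | W2 (x *+ k)]).
    - split=> [|y z Wy Wz] /=; first by rewrite mul0rn; exact: subg0.
      by rewrite mulrnBl; exact: subgB.
    - by move=> u /UW2 Wu /=; exact: subgMn.
    move=> y /scov[z zs Wyz] /=; rewrite (_ : y = y - z + z); last by zmod.
    by rewrite mulrnDl; apply: subgD => //; [exact: subgMn|exact: kP].
  move=> _ [v [ o [Vv Oo_ ->]]]; apply: subgD => //; last exact: OW2.
  (* Now [v] is [w *+ k] plus a bounded element of [V]: [W2] contains the former, and [m] sends the
     latter into [Oo]. *)
  have [w Vw Bw] := div k v k0 Vv.
  rewrite (_ : v = (v - w *+ k) + w *+ k); last by zmod.
  rewrite mulrnDl; apply: subgD => //; last by apply: subgMn => //; exact: kP.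
  by apply: OW2; exact: mP.
Qed.

End Extension.

Section Subquotient.
Variables (M : topologicalZmodType) (I : Type) (f : I -> M -> M).
Hypothesis f_good : good_ops f.
Implicit Types (E K L P S : set M).

Lemma w_mem_sum L K E P : subg L -> msub f K -> closed E -> msub f E -> K `<=` E ->
  E `<=` L -> w_mem f L K P -> w_mem f L E (P `+ E).
Proof.
move=> gL mK cE mE KE EL [[cP mP] KP PL bP pfP].
have [gK gE gP] := And3 mK.1 mE.1 mP.1; split.
- split; last exact: msub_sum.
  have -> : P `+ E = E `+ P.
    by apply/seteqP; split=> _ [x [y [? [? ->]]]]; exists y, x; rewrite addrC.
  by apply: (@closed_sum_bdd _ K).
- exact: sumsetr.
- exact: sumset_sub.
- by apply: bddD => //; [exact: bddSU bP|exact: bdd_self].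
move=> S cS mS ES SPE finS; apply: sumset_sub => //; first exact: mS.1.
apply: (pf_sub mP gK pfP) => //; first exact: subset_trans ES.
by apply: fin_overS finS; [exact: mS.1| |exact: sumsetl].
Qed.

Lemma wzeroI L E S : subg L -> closed E -> msub f E -> E `<=` L ->
  msub f S -> S `<=` L -> wzero f L E -> wzero f S (E `&` S).
Proof.
move=> gL cE mE EL mS SL wE P memP x Px.
have [_ _ PS _ _] := memP; split; last exact: PS.
have memP' : w_mem f L (E `&` S) P.
  by have [? ? ? ? ?] := memP; split=> //; exact: subset_trans SL.
have mES : msub f (E `&` S) by exact: msubI.
have ES : E `&` S `<=` E by move=> y [].
by apply: (wE _ (w_mem_sum gL mES cE mE ES EL memP')); apply: sumsetl => //; exact: mE.1.
Qed.

End Subquotient.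

(** * Tidy subgroups for one automorphism *)

Section Tidy.
Variables (M : topologicalZmodType) (g : int -> M -> M).
Hypothesis gD : forall i x y, g i (x + y) = g i x + g i y.
Hypothesis g0 : forall x, g 0 x = x.
Hypothesis gA : forall i j x, g (i + j) x = g i (g j x).
Hypothesis gC : forall i, continuous (g i).
Implicit Types (B C U X : set M).

Definition fwd C : set M := [set x | forall i : nat, C (g i%:Z x)].
Definition bwd C : set M := [set x | forall i : nat, C (g (- i%:Z) x)].

Lemma act0 i : g i 0 = 0.
Proof. by apply: (addrI (g i 0)); rewrite -gD !addr0. Qed.
Lemma actN i x : g i (- x) = - g i x.
Proof. by apply: (addrI (g i x)); rewrite -gD !subrr act0. Qed.
Lemma actB i x y : g i (x - y) = g i x - g i y.
Proof. by rewrite gD actN. Qed.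

Lemma subg_preact C i : subg C -> subg [set x | C (g i x)].
Proof.
move=> gCs; split=> [|x y Cx Cy] /=; first by rewrite act0; exact: subg0.
by rewrite actB; exact: subgB.
Qed.

Lemma closed_preact C i : closed C -> closed [set x | C (g i x)].
Proof. by move=> cC; apply: closed_comp => // x _; exact: gC. Qed.

Lemma ropen_preact B C i : stable g B -> ropen B C -> ropen B [set x | C (g i x)].
Proof.
move=> sB [ O nO OC]; exists [set x | O (g i x)]; first by apply: gC; rewrite act0.
by move=> x [ Ox Bx]; apply: OC; split=> //; exact: sB.
Qed.

Lemma subg_fwd C : subg C -> subg (fwd C).
Proof.
move=> gCs; split=> [i|x y Cx Cy i]; first by rewrite act0; exact: subg0.
by rewrite actB; apply: subgB.
Qed.

Lemma subg_bwd C : subg C -> subg (bwd C).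
Proof.
move=> gCs; split=> [i|x y Cx Cy i]; first by rewrite act0; exact: subg0.
by rewrite actB; apply: subgB.
Qed.

Lemma closed_fwd C : closed C -> closed (fwd C).
Proof.
move=> cC x clx i.
suff : closure [set x | C (g i%:Z x)] x by move=> /(closed_preact cC).
by move: x clx; apply: closureS => y /(_ i).
Qed.

Lemma closed_bwd C : closed C -> closed (bwd C).
Proof.
move=> cC x clx i.
suff : closure [set x | C (g (- i%:Z) x)] x by move=> /(closed_preact cC).
by move: x clx; apply: closureS => y /(_ i).
Qed.

Lemma fwd_sub C : fwd C `<=` C.
Proof. by move=> x /(_ 0%N); rewrite g0. Qed.
Lemma bwd_sub C : bwd C `<=` C.
Proof. by move=> x /(_ 0%N); rewrite oppr0 g0. Qed.

Lemma bwd_act C m x : bwd C x -> bwd C (g (- m%:Z) x).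
Proof. by move=> Cx i; rewrite -gA -opprD -PoszD. Qed.
Section TidyAbove.
Variables (B C U : set M).
Hypotheses (gB : subg B) (sB : stable g B).
Hypotheses (gU : subg U) (sU : stable g U).
Hypotheses (cC : closed C) (gCs : subg C) (UC : U `<=` C) (CB : C `<=` B).
Hypotheses (bC : bdd U C) (oC : ropen B C).

(* Willis' "tidy above" procedure. *)
Lemma tidy_above : ropen B (bwd C `+ fwd C).
Proof.
pose Kn n := [set x | forall i, (i <= n)%N -> C (g (- i%:Z) x)].
have gK n : subg (Kn n).
  split=> [i _|x y Cx Cy i lei]; first by rewrite act0; exact: subg0.
  by rewrite actB; apply: subgB => //; [exact: Cx|exact: Cy].
have cK n : closed (Kn n).
  move=> x clx i lei.
  suff : closure [set x | C (g (- i%:Z) x)] x by move=> /(closed_preact cC).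
  by move: x clx; apply: closureS => y /(_ i lei).
have UK n : U `<=` Kn n by move=> u Uu i _; apply: UC; exact: sU.
have KC n : Kn n `<=` C by move=> x /(_ 0%N isT); rewrite oppr0 g0.
have oK n : ropen B (Kn n).
  elim: n => [|n IHn].
    by apply: ropenS oC => x Cx i; rewrite leqn0 => /eqP ->; rewrite oppr0 g0.
  apply: ropenS (ropenI IHn (ropen_preact (- n.+1%:Z) sB oC)) => x [Kx Cx] i.
  by rewrite leq_eqVlt => /predU1P[->//|]; exact: Kx.
have bK n : bwd C `<=` Kn n by move=> x Cx i _; exact: Cx.
have gb := subg_bwd gCs.
(* The [Kn] decrease to [bwd C], so some [Kn n] differs from it only by elements so small that they
   and their images under [g 1] lie in [C]. *)
have [n nP] : exists n, forall x, Kn n x ->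
    exists c y, [/\ bwd C c, C y, C (g 1 y) & x = c + y].
  have [ O nO OG] := ropenI oC (ropen_preact 1 sB oC).
  have := nO; rewrite nbhsE => -[W [ oW W0] WO].
  have [_ [n _ <-] nP] : exists2 A, [set Kn n | n in setT] A &
      forall x, C x -> A x -> (W `+ bwd C) x.
    apply: (@bdd_directed_sub _ U C) => //.
    - split; first by exists (Kn 0%N), 0%N.
      move=> _ _ [a _ <-] [b _ <-]; exists (Kn (maxn a b)); first by exists (maxn a b).
      by move=> x Kx; split=> i lei; apply: Kx; rewrite leq_max lei ?orbT.
    - by move=> _ [m _ <-].
    - by move=> _ x u [m _ <-] Kx Uu; apply: (subgD (gK m)) => //; exact: UK.
    - exact: open_sumset.
    - move=> _ u [w [c [Ww [Cc ->]]]] Uu; exists w, (c + u); split=> //.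
      by split; [apply: (subgD gb) => // i; apply: UC; exact: sU|zmod].
    - move=> x Kx; exists 0, x; rewrite add0r; split=> //; split=> // i.
      by apply: (Kx (Kn i)) => //; exists i.
  exists n => x Kx; have [w [c [Ww [bc xE]]]] := nP _ (KC _ _ Kx) Kx.
  have [|Cw Cgw] := OG w.
    split; first exact: WO.
    rewrite (_ : w = x - c); last by rewrite xE; zmod.
    by apply: subgB => //; apply: CB; [exact: KC Kx|exact: bwd_sub].
  by exists c, w; split=> //; rewrite xE addrC.
pose J := Kn n.
have step x : J x -> exists c y, [/\ bwd C c, J y, J (g 1 y) & x = c + y].
  move=> Jx; have [c [y [bc Cy Cgy xE]]] := nP _ Jx.
  have Jy : J y.
    rewrite (_ : y = x - c); last by rewrite xE; zmod.
    by apply: (subgB (gK n)) => //; exact: bK.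
  exists c, y; split=> // -[|i] lei; first by rewrite oppr0 g0.
  rewrite -gA (_ : - i.+1%:Z + 1 = - i%:Z); last by lia.
  by apply: Jy; exact: ltnW.
(* The decomposition is applied to the last iterate and pulled back by [m] steps, which preserves
   [bwd C]. *)
have iter m x : J x -> exists c y, [/\ bwd C c,
    forall i, (i <= m)%N -> J (g i%:Z y) & x = c + y].
  elim: m => [|m IHm] Jx.
    exists 0, x; split; [exact: subg0|move=> i|by rewrite add0r].
    by rewrite leqn0 => /eqP ->; rewrite g0.
  have [c [y [bc Jy xE]]] := IHm Jx; have [c' [z [bc' Jz Jgz yE]]] := step _ (Jy m (leqnn m)).
  have zE : g (- m%:Z) z = y - g (- m%:Z) c'.
    have := congr1 (g (- m%:Z)) yE; rewrite -gA addNr g0 gD => ->; zmod.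
  exists (c + g (- m%:Z) c'), (g (- m%:Z) z); split.
  - by apply: (subgD gb) => //; exact: bwd_act.
  - move=> i; rewrite leq_eqVlt => /predU1P[->|].
      by rewrite -gA (_ : m.+1%:Z + - m%:Z = 1) //; lia.
    rewrite ltnS => leim; rewrite zE actB; apply: (subgB (gK n)); first exact: Jy.
    apply: bK; rewrite -gA (_ : i%:Z + - m%:Z = - (m - i)%N%:Z); last by lia.
    exact: bwd_act.
  - by rewrite xE zE; zmod.
apply: ropenS (oK n) => x Jx.
(* A limit of the backward parts, as the number of controlled forward steps grows, leaves a
   remainder controlled forever. *)
have [||||c cP] := @bdd_directed _ U C
    [set [set c | bwd C c /\ forall i, (i <= m)%N -> J (g i%:Z (x - c))] | m in setT] gU bC.
- split; first by exists [set c | bwd C c /\ forall i, (i <= 0)%N -> J (g i%:Z (x - c))], 0%N.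
  move=> _ _ [a _ <-] [b _ <-].
  exists [set c | bwd C c /\ forall i, (i <= maxn a b)%N -> J (g i%:Z (x - c))].
    by exists (maxn a b).
  by move=> c [bc Jc]; split; split=> // i lei; apply: Jc; rewrite leq_max lei ?orbT.
- move=> _ [m _ <-] c clc; split.
    by apply: closed_bwd => //; move: c clc; apply: closureS => y [].
  move=> i lei.
  have cJ : closed [set c | J (g i%:Z (x - c))].
    apply: (@closed_comp _ _ (fun c => x - c) [set y | J (g i%:Z y)]).
      move=> y _; apply: (@continuous_comp _ _ _ (fun y => (x, y)) (fun p : M * M => p.1 - p.2)).
        by apply: cvg_pair => /=; [exact: cvg_cst|exact: cvg_id].
      exact: sub_continuous.
    exact: (closed_preact (cK n)).
  by apply: cJ; move: c clc; apply: closureS => y [_ /(_ i lei)].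
- move=> _ c u [m _ <-] [bc Jc] Uu; split.
    by apply: (subgD gb) => // i; apply: UC; exact: sU.
  move=> i lei; rewrite (_ : x - (c + u) = (x - c) - u); last by zmod.
  by rewrite actB; apply: (subgB (gK n)); [exact: Jc|apply: UK; exact: sU].
- move=> _ [m _ <-]; have [c [y [bc Jy xE]]] := iter m _ Jx.
  exists c; first exact: bwd_sub.
  by split=> // i lei; rewrite xE (_ : c + y - c = y); [exact: Jy|zmod].
have cm m := cP _ (ex_intro2 _ _ m I erefl).
exists c, (x - c); split; first exact: (cm 0%N).1.
by split=> [i|]; [apply: (KC n); exact: ((cm i).2 i)|zmod].
Qed.

End TidyAbove.
End Tidy.

(** * Discrete subgroups: the torsion-free case *)

Section TorsionFree.
Variables (R : realType) (M : topologicalZmodType).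
Hypothesis lcM : exists2 K : set M, compact K & nbhs (0 : M) K.
Implicit Types (C E L O S U V : set M).

(* The preimage [l] of the line through [F e] is compact modulo [E `&` l],
   hence profinite modulo it, although it surjects onto the real line. *)
Lemma discrete_torsionfree_trivial U E : closed U -> subg U -> closed E -> subg E ->
  U `<=` E -> ropen E U ->
  (forall x k, E x -> (0 < k)%N -> U (x *+ k) -> U x) ->
  om_full (@no_ops M) setT U -> wzero (@no_ops M) setT E -> E `<=` U.
Proof.
move=> cU gU cE gE UE oU tf omU wE.
have cT : closed [set: M] by exact: closedT.
have gT : subg [set: M] by [].
have UT : U `<=` setT by [].
have [K cK nK] := lcM; have [V VE] : exists V, V = hull U (K `&` setT).
  by exists (hull U (K `&` setT)).
have [n [F chF]] := chart_exists R lcM cK nK cT gT cU gU UT; rewrite -VE in chF.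
have gV : subg V by rewrite VE; exact: hull_subg.
have UV : U `<=` V by rewrite VE; exact: hull_sub.
have cV : closed V := hull_closed nK cT gT UT VE.
have oV : ropen setT V := hull_ropen nK VE.
have ker v : V v -> F v = 0 <-> bel setT U v := chart_ker gT gU UT VE chF (v := v).
have FB x y : V x -> V y -> F (x - y) = F x - F y.
  by move=> Vx Vy; exact: (chartB gU VE chF).
have FMn x k : V x -> F (x *+ k) = F x *+ k.
  by move=> Vx; exact: (chartMn gU VE chF).
have FMz x k : V x -> F (x *~ k) = F x *~ k.
  by move=> Vx; exact: (chartMz gU VE chF).
have onto y : exists2 v, V v & F v = y.
  have [|v [Vv _ Fv]] := chart_onto cK nK cT gT gU UT VE chF cT gT UT
    (@subset_refl _ setT) omU _ y; last by exists v.
  move=> x Vx; exists 0, x; rewrite add0r; split=> //.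
  by split=> //; exact: nbhs_singleton.
move=> e0 Ee0; apply: contrapT => nUe0.
have [k k0 Vk] := om_full_torsion omU gT gV UV (@subsetT _ V) oV (I : setT e0).
have [e eE] : exists e, e = e0 *+ k by exists (e0 *+ k).
have Ve : V e by rewrite eE.
have Ee : E e by rewrite eE; exact: subgMn.
have nUe : ~ U e by rewrite eE => /(tf _ _ Ee0 k0).
(* Otherwise the multiples of [e] are bounded modulo [U], hence finite in the discrete [E / U],
   which is torsion free. *)
have Fe0 : F e != 0.
  apply/eqP => /(ker _ Ve)[_ be].
  have fine : fin_over U [set y | exists k : int, y = e *~ k].
    by apply: (@bdd_fin _ U E) => // _ [j ->]; exact: subgMz.
  have [m mP] := fin_over_pigeon gU fine.
  have [i|i [j [/andP[ltij _]]]] := mP (fun i => e *+ i); first by exists i%:Z.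
  rewrite -mulrnBr ?(ltnW ltij) // => Uij; apply: nUe.
  by apply: (tf e (j - i)%N) => //; rewrite subn_gt0.
have [i0 fi0] : exists i0, F e 0 i0 != 0.
  apply: contrapT => nex; move/eqP: Fe0; apply; apply/rowP => i; rewrite mxE.
  by apply/eqP; apply: contrapT => /negP ni; apply: nex; exists i.
set f0 := F e 0 i0 in fi0; pose a i := F e 0 i / f0.
have [l lE] : exists l, l = [set v | V v /\ forall i, F v 0 i = a i * F v 0 i0] by eexists.
have lV : l `<=` V by rewrite lE => v [].
have la v i : l v -> F v 0 i = a i * F v 0 i0 by rewrite lE => -[_]; apply.
have gl : subg l.
  rewrite lE; split.
    by split=> [|i]; [exact: subg0|rewrite (chartU chF (subg0 gU)) !mxE mulr0].
  move=> x y [Vx ax] [Vy ay]; split=> [|i]; first exact: subgB.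
  by rewrite FB // !mxE ax ay mulrBr.
have Ul : U `<=` l.
  by rewrite lE => u Uu; split=> [|i]; [exact: UV|rewrite (chartU chF Uu) !mxE mulr0].
have le : l e.
  by rewrite lE; split=> // i; rewrite /a -mulrA mulVf // mulr1.
have lscale v t : V v -> F v = t *: F e -> l v.
  move=> Vv Fv; rewrite lE; split=> // i; rewrite Fv !mxE /a.
  by rewrite -/f0 mulrCA divfK.
have cl : closed l.
  move=> x clx; have Vx : V x by apply: cV; move: x clx; exact: closureS.
  rewrite lE; split=> // i; apply/eqP; rewrite -subr_eq0; apply/eqP.
  apply: (@bounded_multiples_eq0 _ _ (1 + `|a i|)) => -[|m]; first by rewrite mulr0 addr_ge0.
  have m0 : 0 < m.+1%:R^-1 :> R by rewrite invr_gt0 ltr0n.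
  have [ O nO OP] := chart_continuous cK nK gU VE chF m0.
  have [z [lz Oz]] := clx _ (nbhs0_shiftN x nO); have Vz := lV _ lz.
  have h1 := OP _ i (subgB gV Vx Vz) Oz; have h2 := OP _ i0 (subgB gV Vx Vz) Oz.
  rewrite -ler_pdivlMr ?ltr0n //.
  have -> : F x 0 i - a i * F x 0 i0 = F (x - z) 0 i - a i * F (x - z) 0 i0.
    by rewrite FB // !mxE (la z i) //; ring.
  rewrite mulrDl mul1r (le_trans (ler_normB _ _)) // lerD // normrM.
  exact: ler_wpM2l.
pose E1 := E `&` l.
have gE1 : subg E1 by exact: subgI.
have cE1 : closed E1 by exact: closedI.
pose U1 := gspan U [:: e].
have gU1 : subg U1 by exact: gspan_subg.
have U1E1 : U1 `<=` E1.
  apply: gspan_min => // [u Uu|y]; first by split; [exact: UE|exact: Ul].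
  by rewrite inE => /eqP ->.
have bl : bdd U1 l.
  have [_ _ _ Fp _] := chF; have [C cC CP] := Fp (\sum_i `|F e 0 i|).
  exists C => // v lv; have Vv := lV _ lv; pose t := F v 0 i0 / f0.
  have Fv : F v = t *: F e.
    by apply/rowP => i; rewrite !mxE (la v i) // /a /t; field.
  have [||c [u [Cc [Uu vE]]]] := CP (v - e *~ Num.floor t).
  - by apply: subgB => //; exact: subgMz.
  - move=> i; rewrite FB //; last exact: subgMz.
    rewrite FMz // Fv -scaler_int -scalerBl mxE normrM.
    apply: (@le_trans _ _ `|F e 0 i|); last by rewrite (bigD1 i) //= lerDl sumr_ge0.
    rewrite -[leRHS]mul1r ler_wpM2r // ler_norml.
    have := floor_le t; have := floorD1_gt t; rewrite intrD mulr1z => h1 h2.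
    by apply/andP; split; lra.
  exists c, (u + e *~ Num.floor t); split=> //; split.
    by exists (Num.floor t); rewrite /= addrK.
  by rewrite addrA -vE; zmod.
have wl : wzero (@no_ops M) l E1.
  by apply: (wzeroI (@no_ops_good M)) wE => //; exact: msub_no_ops.
have oU1 : ropen E U1 by apply: ropenS oU; exact: gspan_sub.
(* [E1 / U1] is both compact and discrete. Consequently the coordinate [lam] takes values in the
   multiples of [1 / k1] on [E1]. *)
have [k1 k10 k1P] : exists2 k, (0 < k)%N & forall x, E1 x -> U1 (x *+ k).
  apply: fin_over_exp => //; apply: (@bdd_fin _ U1 E) => //.
  - by move=> x /U1E1[].
  - by move=> x [].
  - by apply: bddS bl => x [].
pose lam v := F v 0 i0 / f0.
have lamE1 x : E1 x -> exists j : int, lam x * k1%:R = j%:~R.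
  move=> E1x; have [j Uj] := k1P _ E1x; exists j.
  have Vx : V x by apply: lV; exact: E1x.2.
  have := chartU chF Uj; rewrite FB; [|exact: subgMn|exact: subgMz].
  rewrite FMn // FMz // => /rowP /(_ i0).
  rewrite -scaler_nat -scaler_int !mxE -/f0 => /eqP; rewrite subr_eq0 => /eqP h.
  by rewrite /lam mulrAC [_ * k1%:R]mulrC h mulfK.
have d0 : 0 < `|f0| / (4 * k1%:R) by rewrite divr_gt0 ?normr_gt0 // mulr_gt0 // ltr0n.
have [ O nO OP] := chart_continuous cK nK gU VE chF d0.
have [S [[cS mS] E1S Sl finS] SO] := wzero_profinite (@no_ops_good M) cl
  (msub_no_ops gl) cE1 (msub_no_ops gE1) (@subIsetr _ _ _) (bddSU U1E1 bl) wl nO.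
have [N N0 NP] := fin_over_exp mS.1 gl finS.
(* This value puts [v *+ N], an element of [S], halfway between two consecutive multiples of
   [1 / k1], whereas [S] stays within half that distance of [E1]. *)
have [v Vv Fv] := onto ((2 * k1%:R * N%:R)^-1 *: F e).
have lv := lscale _ _ Vv Fv.
have [ o [x [ Oo [E1x sE]]]] := SO _ (NP _ lv).
have lo : l o.
  rewrite (_ : o = v *+ N - x); last by rewrite sE; zmod.
  by apply: subgB => //; [exact: subgMn|exact: E1x.2].
have [j jE] := lamE1 _ E1x.
have hs : lam (v *+ N) * k1%:R = 1 / 2.
  rewrite /lam FMn // Fv -scaler_nat scalerA mxE -/f0.
  by field; rewrite fi0 !pnatr_eq0 -!lt0n k10 N0.
have ho : `|lam o * k1%:R| <= 1 / 4.
  have := OP _ i0 (lV _ lo) Oo.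
  rewrite /lam mulrAC normrM normfV normrM (ger0_norm (ler0n R k1)).
  rewrite ler_pdivrMr ?normr_gt0 // ler_pdivlMr ?mulr_gt0 ?ltr0n //.
  by move: `|F o 0 i0| `|f0| => b c; lra.
have : lam (v *+ N) * k1%:R = lam o * k1%:R + j%:~R.
  rewrite -jE -mulrDl /lam -mulrDl sE (chartD chF) ?mxE //; first exact: lV.
  by apply: lV; exact: E1x.2.
rewrite hs => hj; move: ho; rewrite ler_norml => /andP[ho1 ho2].
have j0 : (0 : R) < j%:~R by lra.
have j1 : j%:~R < (1 : R) by lra.
by move: j0 j1; rewrite ltr0z -[1]/(1%:~R) ltr_int; lia.
Qed.

End TorsionFree.

(** * A single automorphism *)

Section IntAction.
Variables (M : topologicalZmodType) (g : int -> M -> M).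
Hypothesis gD : forall i x y, g i (x + y) = g i x + g i y.
Hypothesis g0 : forall x, g 0 x = x.
Hypothesis gA : forall i j x, g (i + j) x = g i (g j x).
Hypothesis gC : forall i, continuous (g i).
Implicit Types (B C D E O P S U X : set M).

Let aB := actB gD.
Let a0 := act0 gD.

Lemma int_stable S : (forall x, S x -> S (g 1 x)) -> (forall x, S x -> S (g (- 1) x)) ->
  stable g S.
Proof.
move=> S1 S1'; have Sn (n : nat) x : S x -> S (g n%:Z x) /\ S (g (- n%:Z) x).
  elim: n => [|n IHn] Sx; first by rewrite oppr0 g0.
  rewrite -addn1 PoszD opprD addrC [X in _ /\ S (g X x)]addrC !gA.
  by split; [apply: S1|apply: S1']; have [] := IHn Sx.
by move=> [n|n] x Sx; [exact: (Sn n x Sx).1|rewrite NegzE; exact: (Sn n.+1 x Sx).2].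
Qed.

Lemma nbhs_preact i O : nbhs (0 : M) O -> nbhs (0 : M) [set x | O (g i x)].
Proof. by move=> nO; apply: gC; rewrite a0. Qed.

Lemma int_ops_good : good_ops g.
Proof.
split=> //; exists [set 1; -1]; split=> [S gS SJ|O nO].
  by apply: int_stable => x; apply: SJ; [left|right].
exists ([set x | O (g 1 x)] `&` [set x | O (g (-1) x)]).
  by apply: filterI; exact: nbhs_preact.
by move=> i x [->|->] [].
Qed.

Lemma act_inj_in S i x : stable g S -> S (g i x) -> S x.
Proof. by move=> sS /(sS (- i)); rewrite -gA addNr g0. Qed.

Lemma actC i j x : g i (g j x) = g j (g i x).
Proof. by rewrite -!gA addrC. Qed.

Lemma bdd_act U X i : stable g U -> bdd U X -> bdd U [set g i x | x in X].
Proof.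
move=> sU [C cC XC]; exists (g i @` C).
  by apply: continuous_compact => //; apply: continuous_subspaceT; exact: gC.
move=> _ [_ /XC[c [u [Cc [Uu ->]]]] <-]; exists (g i c), (g i u).
by split; [exists c|split; [exact: sU|exact: gD]].
Qed.

Lemma gMz i x k : g i (x *~ k) = g i x *~ k.
Proof.
have gMn n : g i (x *+ n) = g i x *+ n.
  by elim: n => [|n IHn]; rewrite ?mulr0n ?a0 // !mulrS gD IHn.
by case: k => n; [exact: gMn|rewrite NegzE !mulrNz (actN gD); congr (- _); exact: gMn].
Qed.

Lemma gMn i x n : g i (x *+ n) = g i x *+ n.
Proof. exact: (gMz i x n%:Z). Qed.

Lemma per_mulz D N x : subg D -> stable g D -> D (g N x - x) ->
  forall q : int, D (g (N * q) x - x).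
Proof.
move=> gDs sD Dx.
have Dn (n : nat) : D (g (N * n%:Z) x - x).
  elim: n => [|n IHn]; first by rewrite mulr0 g0 subrr; exact: subg0.
  have -> : g (N * n.+1%:Z) x - x = g (N * n%:Z) (g N x - x) + (g (N * n%:Z) x - x).
    by rewrite aB -gA -addn1 PoszD mulrDr mulr1; zmod.
  by apply: subgD => //; exact: sD.
move=> [n|n]; first exact: Dn.
rewrite NegzE; apply: (@act_inj_in D (N * n.+1%:Z)) => //.
rewrite aB -gA mulrN subrr g0 -opprB; exact: subgN.
Qed.

(** For a stable subgroup [D], the elements generating a finite submodule modulo [D]. *)
Definition per D : set M :=
  [set x | exists N k : nat, [/\ (0 < N)%N, (0 < k)%N, D (g N%:Z x - x) & D (x *+ k)]].

Lemma per_sub D : subg D -> stable g D -> D `<=` per D.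
Proof.
move=> gDs sD x Dx; exists 1%N, 1%N; split=> //.
by apply: subgB => //; exact: sD.
Qed.

Lemma per_subg D : subg D -> stable g D -> subg (per D).
Proof.
move=> gDs sD; split; first by apply: per_sub => //; exact: subg0.
move=> x y [N [k [N0 k0 DN Dk]]] [N' [k' [N'0 k'0 DN' Dk']]].
exists (N * N')%N, (k * k')%N; rewrite !muln_gt0 N0 k0; split=> //.
- rewrite aB (_ : _ - _ = (g (N * N')%N%:Z x - x) - (g (N * N')%N%:Z y - y)); last by zmod.
  by apply: subgB => //; rewrite PoszM; [|rewrite mulrC]; exact: per_mulz.
- rewrite mulrnBl; apply: subgB => //; first by rewrite mulrnA; exact: subgMn.
  by rewrite mulnC mulrnA; exact: subgMn.
Qed.

Lemma per_stable D : subg D -> stable g D -> stable g (per D).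
Proof.
move=> gDs sD i x [N [k [N0 k0 DN Dk]]]; exists N, k; split=> //.
  by rewrite actC -aB; exact: sD.
by rewrite -gMn; exact: sD.
Qed.

(* With [h = g N], [(h - 1)^2 x] and [k x] in [D] give
   [h^k x - x = k (h - 1) x = 0] modulo [D]. *)
Lemma per_trans D x (N k : nat) : subg D -> stable g D -> (0 < N)%N -> (0 < k)%N ->
  per D (g N%:Z x - x) -> per D (x *+ k) -> per D x.
Proof.
move=> gDs sD N0 k0 [N1 [_ [N10 _ DN1 _]]] [_ [k2 [_ k20 _ Dk2]]].
pose P := (N * N1)%N; pose K := (k * k2)%N.
have DK : D (x *+ K) by rewrite /K mulrnA.
pose y := g P%:Z x - x.
have Dy : D (g P%:Z y - y).
  have D1 (n : nat) : D (g N1%:Z (g (N * n)%N%:Z x - x) - (g (N * n)%N%:Z x - x)).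
    elim: n => [|n IHn]; first by rewrite muln0 g0 subrr a0 subrr; exact: subg0.
    have -> : g (N * n.+1)%N%:Z x - x =
        g (N * n)%N%:Z (g N%:Z x - x) + (g (N * n)%N%:Z x - x).
      by rewrite aB -gA -PoszD mulnSr; zmod.
    set z := g (N * n)%N%:Z x - x in IHn *; set w := g N%:Z x - x in DN1 *.
    rewrite gD (_ : _ - _ = g (N * n)%N%:Z (g N1%:Z w - w) + (g N1%:Z z - z)).
      by apply: subgD => //; exact: sD.
    by rewrite (aB _ (g N1%:Z w)) (actC (N * n)%N%:Z N1%:Z w); zmod.
  by rewrite /P mulnC PoszM; apply: per_mulz => //; exact: (D1 N1).
have Dj (j : nat) : D (g (P * j)%N%:Z x - x - y *+ j).
  elim: j => [|j IHj]; first by rewrite muln0 g0 mulr0n subr0 subrr; exact: subg0.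
  have -> : g (P * j.+1)%N%:Z x - x - y *+ j.+1 =
      (g (P * j)%N%:Z y - y) + (g (P * j)%N%:Z x - x - y *+ j).
    by rewrite /y aB -gA -PoszD mulnSr mulrS; zmod.
  by apply: subgD => //; rewrite PoszM; exact: per_mulz.
exists (P * K)%N, K; rewrite !muln_gt0 N0 N10 k0 k20; split=> //.
rewrite (_ : _ - x = (g (P * K)%N%:Z x - x - y *+ K) + y *+ K); last by zmod.
apply: subgD => //; rewrite /y mulrnBl -gMn; apply: subgB => //; exact: sD.
Qed.

Lemma pd_per E U : msub g E -> msub g U -> pd g E U -> U `<=` E ->
  forall x, E x -> per U x -> U x.
Proof.
move=> [gE sE] [gU sU] pdE UE x Ex [N [k [N0 k0 UN Uk]]].
pose s := [seq g (i%:Z) x | i <- iota 0 N].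
have gS := gspan_subg s gU.
have memS (i : nat) : (i < N)%N -> gspan U s (g i%:Z x).
  by move=> lt; apply: gspan_mem => //; apply/mapP; exists i => //; rewrite mem_iota.
have Sx : gspan U s x by rewrite -[x]g0; exact: memS.
suff : gspan U s `<=` U by apply.
apply: pdE.
- split=> //; apply: int_stable => y.
  + have pS := subg_preact gD 1 gS.
    apply: (@gspan_min _ U s [set y | gspan U s (g 1 y)]) => // [u Uu|_ /mapP[i + ->]].
      by apply: gspan_sub; exact: sU.
    rewrite mem_iota add0n /= => lti; rewrite -gA -PoszD add1n.
    move: lti; rewrite leq_eqVlt => /predU1P[->|]; last exact: memS.
    rewrite (_ : g N%:Z x = (g N%:Z x - x) + x); last by zmod.
    by apply: subgD => //; exact: gspan_sub.
  + have pS := subg_preact gD (- 1) gS.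
    apply: (@gspan_min _ U s [set y | gspan U s (g (- 1) y)]) => // [u Uu|_ /mapP[i + ->]].
      by apply: gspan_sub; exact: sU.
    rewrite mem_iota add0n /= -gA; case: i => [|i] lti; last first.
      by rewrite (_ : -1 + i.+1%:Z = i%:Z); [apply: memS; exact: ltnW|lia].
    rewrite addr0 (_ : g (-1) x = g (-1 + N%:Z) x - g (-1) (g N%:Z x - x)).
      apply: subgB => //; last by apply: gspan_sub; exact: sU.
      by rewrite (_ : -1 + N%:Z = N.-1%:Z); [apply: memS; rewrite prednK|lia].
    by rewrite aB -gA; zmod.
- exact: gspan_sub.
- by apply: gspan_min => // _ /mapP[i _ ->]; exact: sE.
apply: fin_gspan => // _ /mapP[i _ ->]; exists k => //; rewrite -gMn; exact: sU.
Qed.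

Definition tors E U : Prop := forall x, E x -> exists2 k, (0 < k)%N & U (x *+ k).

(** A bounded half-orbit is finite modulo [U], so two late iterates agree and [x] is periodic. *)
Lemma pd_bounded E U (n : nat) x : msub g E -> msub g U -> pd g E U -> U `<=` E ->
  tors E U -> ropen E U -> E x ->
  bdd U [set y | exists i : nat, y = g (n + i)%N%:Z x] -> U x.
Proof.
move=> mE mU pdE UE tE oU Ex bx; have [gE sE] := mE; have [gU sU] := mU.
have fx : fin_over U [set y | exists i : nat, y = g (n + i)%N%:Z x].
  by apply: (@bdd_fin _ U E) => // _ [i ->]; exact: sE.
have [m mP] := fin_over_pigeon gU fx.
have [i|i [j [/andP[ltij _] Uij]]] := mP (fun i => g (n + i)%N%:Z x); first by exists i.
apply: (pd_per mE mU pdE UE Ex); have [k k0 Uk] := tE _ Ex.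
exists (j - i)%N, k; rewrite subn_gt0; split=> //.
apply: (@act_inj_in U (n + i)%N%:Z) => //.
by rewrite aB -gA -PoszD (_ : (n + i + (j - i))%N = (n + j)%N) //; lia.
Qed.

(** Profiniteness of [P / E] gives [N] with [g N u - u = o + e], where [o] lies in a submodule [T]
    bounded modulo [U] and [e] in [E]. Then [e] has a bounded half-orbit, hence lies in [U], and [u]
    is periodic modulo [T]. *)
Lemma orbit_bdd E U P (n : nat) u : (exists2 K : set M, compact K & nbhs (0 : M) K) ->
  closed E -> msub g E -> msub g U -> pd g E U -> U `<=` E -> tors E U -> ropen E U ->
  wzero g setT E -> closed P -> msub g P -> E `<=` P -> bdd E P -> P u ->
  bdd U [set y | exists i : nat, y = g (n + i)%N%:Z u] ->
  bdd U [set y | exists i : int, y = g i u].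
Proof.
move=> [K cK nK] cE mE mU pdE UE tE oU wE cP mP EP bP Pu bu.
have [[gE sE] [gU sU] [gP sP]] := And3 mE mU mP.
have [ O1 nO1 O1U] := oU; have [ O2 [nO2 _ O2N O2D O2D3]] := nbhs0_split3 nO1.
pose O := O2 `&` [set x | O2 (g 1 x)] `&` [set x | O2 (g (-1) x)] `&` K.
have nO : nbhs (0 : M) O by do 3 (apply: filterI => //; last try exact: nbhs_preact).
have OO2 x : O x -> O2 x by move=> [[[]]].
have O0 : O 0 by exact: nbhs_singleton.
have [S [[cS mS] ES SP finS] SO] := wzero_profinite int_ops_good cP mP cE mE EP bP
  (wzeroS (@subsetT _ P) wE) nO.
have [gS sS] := mS.
(* The part of [S] near [U]. For small [O] it is a submodule: an element of [E] close to [U] lies in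
   [U], which is open in [E]. *)
pose T := S `&` (O `+ U).
have mT : msub g T.
  have gT : subg T.
    split; first by split; [exact: subg0|exists 0, 0; rewrite addr0; split=> //; split=> //; exact: subg0].
    move=> x y [Sx [ o [v [ Oo [Uv xE]]]]] [Sy [ o' [v' [ Oo' [Uv' yE]]]]].
    have Sxy : S (x - y) by exact: subgB.
    split=> //; have [ o'' [e [ Oo'' [Ee xyE]]]] := SO _ Sxy.
    exists o'', e; split=> //; split=> //.
    have eE : e = (o + - o' + - o'') + (v - v').
      by rewrite (_ : e = x - y - o''); [rewrite xE yE; zmod|rewrite xyE; zmod].
    rewrite eE; apply: subgD => //; last exact: subgB.
    apply: O1U; split; first by apply: O2D3; [exact: OO2|apply: O2N; exact: OO2|apply: O2N; exact: OO2].
    rewrite (_ : _ + _ = e - (v - v')); last by rewrite eE; zmod.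
    by apply: subgB => //; apply: UE; exact: subgB.
  split=> //.
  have st i : (forall x, O x -> O2 (g i x)) -> forall x, T x -> T (g i x).
    move=> Oi x [Sx [ o [v [ Oo [Uv xE]]]]].
    have Sgx : S (g i x) by exact: sS.
    split=> //; have [ o'' [e [ Oo'' [Ee gxE]]]] := SO _ Sgx.
    exists o'', e; split=> //; split=> //.
    have eE : e = (g i o + - o'') + g i v.
      by rewrite (_ : e = g i x - o''); [rewrite xE gD; zmod|rewrite gxE; zmod].
    rewrite eE; apply: subgD => //; last exact: sU.
    apply: O1U; split; first by apply: O2D; [exact: Oi|apply: O2N; exact: OO2].
    rewrite (_ : _ + _ = e - g i v); last by rewrite eE; zmod.
    by apply: subgB => //; apply: UE; exact: sU.
  by apply: int_stable; apply: st => x [[[]]].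
have [gT sT] := mT.
have bT : bdd U T.
  by exists K => // x [_ [ o [v [[_ Ko] [Uv ->]]]]]; exists o, v.
have [m mPg] := fin_over_pigeon gS finS.
have [i|i [j [/andP[ltij _] Sij]]] := mPg (fun i => g i%:Z u); first exact: sP.
have [N0 NE] : (0 < j - i)%N /\ j = (i + (j - i))%N by rewrite subn_gt0 subnKC // ltnW.
have SN : S (g (j - i)%N%:Z u - u).
  by apply: (@act_inj_in S i%:Z) => //; rewrite aB -gA -PoszD -NE.
set N := (j - i)%N in N0 SN.
have [ o [e [ Oo [Ee NuE]]]] := SO _ SN.
have To : T o.
  split; last by exists o, 0; rewrite addr0; split=> //; split=> //; exact: subg0.
  rewrite (_ : o = g N%:Z u - u - e); last by rewrite NuE; zmod.
  by apply: subgB => //; exact: ES.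
have Ue : U e.
  apply: (@pd_bounded E U n) => //.
  have bu' := bdd_act N%:Z sU bu.
  apply: bddS (bddD gU (bddD gU bu' (bddN gU bu)) (bddN gU bT)) => _ [k ->].
  exists (g N%:Z (g (n + k)%N%:Z u) - g (n + k)%N%:Z u), (- g (n + k)%N%:Z o).
  split; [|split; [by rewrite /= opprK; exact: sT|]].
    exists (g N%:Z (g (n + k)%N%:Z u)), (- g (n + k)%N%:Z u); split.
      by exists (g (n + k)%N%:Z u) => //; exists k.
    by split=> //=; rewrite opprK; exists k.
  rewrite (_ : e = g N%:Z u - u - o); last by rewrite NuE; zmod.
  by rewrite !aB -!gA [(n + k)%N%:Z + _]addrC.
have TN : T (g N%:Z u - u).
  rewrite NuE; apply: subgD => //; split; first exact: ES.
  by exists 0, e; rewrite add0r.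
have Nz : N%:Z != 0 by case: (N) N0.
pose s := [seq g (r%:Z) u | r <- iota 0 N].
apply: bddS (bddD gU (bdd_seq s gU) bT) => _ [k ->].
pose r := absz (k %% N%:Z)%Z.
have rE : r%:Z = (k %% N%:Z)%Z by rewrite /r gez0_abs // modz_ge0.
exists (g r%:Z u), (g k u - g r%:Z u); split; last split; last by zmod.
  apply/mapP; exists r => //; rewrite mem_iota add0n /=.
  by have := ltz_mod k Nz; rewrite -rE; lia.
rewrite {1}(divz_eq k N%:Z) -rE [_ * _ + r%:Z]addrC gA -aB mulrC; apply: (sT); exact: (per_mulz gT sT TN).
Qed.

End IntAction.

Lemma ropen_trans (M : topologicalZmodType) (L V S : set M) :
  ropen L V -> ropen V S -> ropen L S.
Proof.
move=> [ O nO OV] [P nP PS]; exists (O `&` P); first exact: filterI.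
by move=> x [[ Ox Px] Lx]; apply: PS; split=> //; apply: OV.
Qed.

Lemma bdd_gspan (M : topologicalZmodType) (U : set M) (s : seq M) : subg U ->
  (forall t, t \in s -> bdd U [set y | exists k : int, y = t *~ k]) -> bdd U (gspan U s).
Proof.
move=> gU; elim: s => [|t s IHs] bs; first exact: bdd_self.
have bs' := IHs (fun y ys => bs y (mem_behead (s := t :: s) ys)).
apply: bddS (bddD gU (bs t (mem_head _ _)) bs') => x /= [k Sk].
by exists (t *~ k), (x - t *~ k); split; [exists k|split=> //; zmod].
Qed.

Lemma tors_bel (M : topologicalZmodType) (E U : set M) : subg U -> tors E U ->
  E `<=` bel setT U.
Proof.
move=> gU tE x Ex; split=> //.
have fx : fin_over U (gspan U [:: x]).
  by apply: fin_gspan => // y; rewrite inE => /eqP ->; exact: tE.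
apply: bddS (bdd_fin_over (bdd_self gU) gU fx) => _ [k ->] /=.
by exists k; rewrite subrr; exact: subg0.
Qed.

(** * Time reversal and eventually bounded orbits *)

Definition rev_act (M : Type) (g : int -> M -> M) : int -> M -> M := fun i => g (- i).

Section Reverse.
Variables (M : topologicalZmodType) (g : int -> M -> M).

Lemma stable_rev : stable (rev_act g) = stable g.
Proof.
apply/funext => S; apply/propext; split=> sS i x Sx; last exact: sS.
by have := sS (- i) x Sx; rewrite /rev_act opprK.
Qed.

Lemma msub_rev : msub (rev_act g) = msub g.
Proof. by rewrite /msub stable_rev. Qed.

Lemma pd_rev : pd (rev_act g) = pd g.
Proof. by rewrite /pd msub_rev. Qed.

Lemma wzero_rev : wzero (rev_act g) = wzero g.
Proof. by rewrite /wzero /w_mem /pf msub_rev. Qed.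

Hypothesis gA : forall i j x, g (i + j) x = g i (g j x).
Lemma rev_actA i j x : rev_act g (i + j) x = rev_act g i (rev_act g j x).
Proof. by rewrite /rev_act opprD gA. Qed.
Hypothesis g0 : forall x, g 0 x = x.
Lemma rev_act0 x : rev_act g 0 x = x.
Proof. by rewrite /rev_act oppr0. Qed.
End Reverse.

Section Eventual.
Variables (M : topologicalZmodType) (g : int -> M -> M).
Hypothesis gD : forall i x y, g i (x + y) = g i x + g i y.
Hypothesis g0 : forall x, g 0 x = x.
Hypothesis gA : forall i j x, g (i + j) x = g i (g j x).
Hypothesis gC : forall i, continuous (g i).
Implicit Types (B C U : set M).

Definition late B C (n : nat) : set M := [set x | B x /\ forall i : nat, C (g (n + i)%N%:Z x)].

Definition efwd B C : set M := [set x | B x /\ exists n : nat, fwd g C (g n%:Z x)].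

Lemma efwdP B C x : efwd B C x <-> exists n, late B C n x.
Proof.
split=> [[Bx [n nP]]|[n [Bx nP]]].
  by exists n; split=> // i; have := nP i; rewrite -gA -PoszD addnC.
by split=> //; exists n => i; rewrite -gA -PoszD addnC; exact: nP.
Qed.

Lemma efwd_msub B C : msub g B -> subg C -> msub g (efwd B C).
Proof.
move=> [gB sB] gCs; split; last first.
  move=> j x /efwdP[n [Bx nP]]; apply/efwdP; exists (n + absz j)%N.
  split=> [|i]; first exact: sB.
  rewrite -gA.
  have -> : (n + `|j| + i)%N%:Z + j = (n + absz ((absz j + i)%N%:Z + j)%R)%N%:Z by lia.
  exact: nP.
split; first by split; [exact: subg0|exists 0%N => i; rewrite !(act0 gD); exact: subg0].
move=> x y /efwdP[n [Bx nP]] /efwdP[m [By mP]]; apply/efwdP; exists (n + m)%N.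
split=> [|i]; first exact: subgB.
rewrite (actB gD); apply: subgB => //.
  by rewrite -addnA; exact: nP.
by rewrite (addnC n) -addnA; exact: mP.
Qed.

Lemma orbit_hull_msub E u : msub g E -> msub g (hull E [set y | exists i : int, y = g i u]).
Proof.
move=> [gE sE]; set P := hull _ _; split; first exact: hull_subg.
move=> j; apply: (@hull_min _ E _ [set x | P (g j x)]).
- by apply: (subg_preact gD j); exact: hull_subg.
- by move=> y Ey; apply: hull_sub; exact: sE.
- by move=> _ [i ->] /=; apply: hull_gen; exists (j + i); rewrite gA.
Qed.

(** Only the finitely many iterates between [- n] and [n] may leave [Y], and each of them has
    bounded multiples. *)
Lemma orbit_hull_bdd Y E u (n : nat) : subg Y -> E `<=` Y ->
  (forall i : nat, Y (g (n + i)%N%:Z u)) -> (forall i : nat, Y (g (- (n + i)%N%:Z) u)) ->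
  (forall i : int, bdd Y [set y | exists k : int, y = g i u *~ k]) ->
  bdd Y (hull E [set y | exists i : int, y = g i u]).
Proof.
move=> gY EY fu bu multu.
pose s := [seq g (i%:Z - n%:Z) u | i <- iota 0 (n + n)].
apply: (@bddS _ _ _ (gspan Y s)); last first.
  by apply: bdd_gspan => // _ /mapP[i _ ->]; exact: multu.
apply: hull_min; first exact: gspan_subg.
  by apply: subset_trans EY _; exact: gspan_sub.
move=> _ [i ->]; have [lei|gti] := lerP n%:Z i.
  apply: gspan_sub.
  by rewrite (_ : i = (n + absz (i - n%:Z)%R)%N%:Z); [exact: fu|lia].
have [lti|gei] := ltrP i (- n%:Z).
  apply: gspan_sub.
  by rewrite (_ : i = - (n + absz (- i - n%:Z)%R)%N%:Z); [exact: bu|lia].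
apply: gspan_mem => //; apply/mapP; exists (absz (i + n%:Z)%R).
  by rewrite mem_iota; lia.
by congr (g _ _); lia.
Qed.

Lemma fwd_efwd B C : C `<=` B -> fwd g C `<=` efwd B C.
Proof. by move=> CB x Cx; split; [apply: CB; exact: (fwd_sub g0)|exists 0%N; rewrite g0]. Qed.

End Eventual.

Section TorsionDiscrete.
Variables (R : realType) (M : topologicalZmodType) (g : int -> M -> M).
Hypothesis lcM : exists2 K : set M, compact K & nbhs (0 : M) K.
Hypothesis gD : forall i x y, g i (x + y) = g i x + g i y.
Hypothesis g0 : forall x, g 0 x = x.
Hypothesis gA : forall i j x, g (i + j) x = g i (g j x).
Hypothesis gC : forall i, continuous (g i).
Implicit Types (C E L O S U V : set M).

Lemma bel_stable L U : stable g L -> stable g U -> stable g (bel L U).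
Proof.
move=> sL sU i x [Lx bx]; split; first exact: sL.
apply: bddS (bdd_act gD gC i sU bx) => _ [k ->].
by exists (x *~ k); [exists k|rewrite (gMz gD)].
Qed.

Lemma wzero_discrete E U : closed U -> subg U -> closed E -> subg E -> U `<=` E -> ropen E U ->
  wzero (@no_ops M) setT E -> wzero (@no_ops M) setT U.
Proof.
move=> cU gU cE gE UE oU wE P memP; have [[cP mP] UP _ bP pfP] := memP.
have PE : P `<=` E.
  apply: subset_trans (sumsetl gE) (wE _ (w_mem_sum (@no_ops_good M) _ _ cE _ UE _ memP)) => //;
  exact: msub_no_ops.
apply: pfP => //; first exact: msub_no_ops.
exact: (@bdd_fin _ U E).
Qed.

(* The elements of [B] bounded forward or backward modulo [U] generate an open
   submodule of [B] meeting [E] only in [U]; it extends to an open submodule of [M]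
   with the same property, so that [om_full_essential] applies. *)
Lemma discrete_torsion_trivial U E : closed U -> msub g U -> closed E -> msub g E ->
  U `<=` E -> ropen E U -> tors E U -> pd g E U ->
  om_full (@no_ops M) setT U -> om_full g setT U ->
  wzero (@no_ops M) setT E -> wzero g setT E -> E `<=` U.
Proof.
move=> cU mU cE mE UE oU tE pdE om1 omg w1 wg.
have [[gU sU] [gE sE]] := (mU, mE).
have cT : closed [set: M] by exact: closedT.
have gT : subg [set: M] by [].
have UT : U `<=` setT by [].
have EB := tors_bel gU tE.
have [B BE] : exists B, B = bel setT U by eexists.
have gB : subg B by rewrite BE; exact: bel_subg.
have cB : closed B by rewrite BE; exact: (bel_closed R lcM).
have sB : stable g B by rewrite BE; apply: bel_stable.
have UB : U `<=` B by rewrite BE; exact: bel_sub.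
rewrite -BE in EB.
have bB x : B x -> bdd U [set y | exists k : int, y = x *~ k] by rewrite BE => -[].
(* The kernel of a chart is profinite modulo [U]; a small open subgroup of it avoids [E] outside
   [U], since [U] is open in [E]. *)
have [C [[cC gCs] [UC CB] bC oC CE]] : exists C, [/\ closed C /\ subg C,
    U `<=` C /\ C `<=` B, bdd U C, ropen B C & C `&` E `<=` U].
  have [K cK nK] := lcM; have [V VE] : exists V, V = hull U (K `&` setT) by eexists.
  have [n [F chF]] := chart_exists R lcM cK nK cT gT cU gU UT; rewrite -VE in chF.
  have gV : subg V by rewrite VE; exact: hull_subg.
  have UV : U `<=` V by rewrite VE; exact: hull_sub.
  have cV : closed V := hull_closed nK cT gT UT VE.
  have oV : ropen setT V := hull_ropen nK VE.
  have bVB : bdd U (V `&` B) by rewrite BE; exact: (bel_bdd gT gU UT VE chF).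
  have gVB := subgI gV gB; have cVB := closedI cV cB.
  have UVB : U `<=` V `&` B by move=> u Uu; split; [exact: UV|exact: UB].
  have w1U := wzero_discrete cU gU cE gE UE oU w1.
  have [ O1 nO1 O1U] := oU.
  have [C [[cC [gCs _]] UC CVB finC] CO] := wzero_profinite (@no_ops_good M) cVB
    (msub_no_ops gVB) cU (msub_no_ops gU) UVB bVB (wzeroS (@subsetT _ _) w1U) nO1.
  exists C; split=> //.
  - by split=> // x /CVB[].
  - exact: bddS bVB.
  - apply: ropen_trans (fin_ropen cC gCs finC); apply: ropenI; last exact: ropen_self.
    exact: ropenSl oV.
  - move=> x [/CO[ o [u [ Oo [Uu xE]]]] Ex]; rewrite xE; apply: subgD => //.
    apply: O1U; split=> //; rewrite (_ : o = x - u); last by rewrite xE; zmod.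
    by apply: subgB => //; exact: UE.
have rgD i x y : rev_act g i (x + y) = rev_act g i x + rev_act g i y by exact: gD.
have rgA := rev_actA gA; have rg0 := rev_act0 g0.
have rgC i : continuous (rev_act g i) by exact: gC.
have oJ : ropen B (bwd g C `+ fwd g C) by exact: (tidy_above gD g0 gA gC gB sB (U := U)).
pose Sm := efwd g B C; pose Sp := efwd (rev_act g) B C.
have mSm : msub g Sm by exact: efwd_msub.
have mSp : msub g Sp.
  by rewrite -msub_rev; apply: efwd_msub => //; rewrite msub_rev.
pose S := Sp `+ Sm.
have mS : msub g S by apply: msub_sum => //; exact: int_ops_good.
have oS : ropen B S.
  apply: ropenS oJ; apply: sumsetS; last exact: fwd_efwd.
  exact: (@fwd_efwd _ (rev_act g) rg0 B C CB).
have SB : S `<=` B by apply: sumset_sub => // x [].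
have US : U `<=` S.
  move=> u Uu; exists 0, u; rewrite add0r; split; first exact: (subg0 mSp.1).
  by split=> //; apply: fwd_efwd => // i; apply: UC; exact: sU.
have SE : S `&` E `<=` U.
  move=> e [[v [u [Spv [Smu eE]]]] Ee].
  have [n1 [Bv n1P]] := (efwdP rgA B C v).1 Spv.
  have [n2 [Bu n2P]] := (efwdP gA B C u).1 Smu.
  pose n := (n1 + n2)%N.
  have fu i : C (g (n + i)%N%:Z u) by rewrite /n (addnC n1) -addnA; exact: n2P.
  have fv i : C (g (- (n + i)%N%:Z) v) by rewrite /n -addnA; exact: n1P.
  have gCE : subg (C `+ E) by exact: subg_sumset.
  (* Modulo [E] the backward orbit of [u] is minus that of [v], so the whole orbit of [u] is bounded
     modulo [E]; [orbit_bdd] improves this to boundedness modulo [U]. *)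
  pose P0 := hull E [set y | exists i : int, y = g i u].
  have bP0 : bdd E P0.
    apply: (@bdd_trans _ E (C `+ E)) => //.
      by apply: bddD => //; [exact: bddSU bC|exact: bdd_self].
    apply: (orbit_hull_bdd (n := n)) => //; first exact: sumsetr.
    - by move=> i; apply: sumsetl => //; exact: fu.
    - move=> i; exists (- g (- (n + i)%N%:Z) v), (g (- (n + i)%N%:Z) e).
      split; first by apply: subgN => //; exact: fv.
      by split; [exact: sE|rewrite eE gD; zmod].
    - move=> i; have UCE : U `<=` C `+ E by apply: subset_trans UC _; exact: sumsetl.
      by apply: bddSU UCE _; apply: bB; exact: sB.
  have mP0 : msub g P0 by exact: orbit_hull_msub.
  have mP : msub g (closure P0) by apply: msub_closure => //; exact: int_ops_good.
  have EP : E `<=` closure P0 by move=> x Ex; apply: subset_closure; exact: hull_sub.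
  have bP : bdd E (closure P0) by exact: bdd_closure.
  have Pu : closure P0 u.
    by apply: subset_closure; apply: hull_gen; exists 0; rewrite g0.
  have Pv : closure P0 v.
    rewrite (_ : v = e - u); last by rewrite eE; zmod.
    by apply: (subgB mP.1) => //; exact: EP.
  have bu : bdd U [set y | exists i : int, y = g i u].
    apply: (orbit_bdd gD g0 gA gC (n := n) lcM cE mE mU pdE UE tE oU wg
      (@closed_closure _ P0) mP EP bP Pu).
    by apply: bddS bC => _ [i ->]; exact: fu.
  have bv : bdd U [set y | exists i : int, y = rev_act g i v].
    apply: (orbit_bdd rgD rg0 rgA rgC (n := n) lcM cE _ _ _ UE tE oU _
      (@closed_closure _ P0) _ EP bP Pv); rewrite ?msub_rev ?pd_rev ?wzero_rev //.
    by apply: bddS bC => _ [i ->]; exact: fv.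
  apply: (pd_bounded gD g0 gA (n := 0%N) mE mU pdE UE tE oU Ee).
  apply: bddS (bddD gU bv bu) => _ [i ->]; exists (g i%:Z v), (g i%:Z u).
  split; first by exists (- i%:Z); rewrite /rev_act opprK.
  by split; [exists i%:Z|rewrite eE gD].
have := bel_extend R lcM cT gT cU gU UT om1 mS.1 US; rewrite -BE.
move=> /(_ SB oS)[W [[gW _] SW oW WB Wmin]].
(* [W] is least among the open subgroups containing [S], and its preimages under [g] are such
   subgroups. *)
have sW : stable g W.
  move=> j; apply: (Wmin [set x | W (g j x)]) => //.
  - exact: (subg_preact gD j gW).
  - by move=> x Sx; apply: SW; exact: mS.2.
  - exact: (ropen_preact gD gC).
apply: (om_full_essential omg mE UE _ pdE (S := W)) => //.
- exact: subset_trans SW.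
- by move=> x [Wx Ex]; apply: SE; split=> //; apply: WB; split=> //; exact: EB.
Qed.

End TorsionDiscrete.

(** * Cocompact submodules *)

Section Cocompact.
Variables (R : realType) (M : topologicalZmodType).
Hypothesis lcM : exists2 K : set M, compact K & nbhs (0 : M) K.
Hypothesis c0 : closed [set 0 : M].
Implicit Types (C K L O P Q S : set M).

Lemma subg_zero : subg [set 0 : M].
Proof. by split=> // x y -> ->; rewrite subrr. Qed.

Lemma zero_sub S : subg S -> [set 0] `<=` S.
Proof. by move=> gS _ ->; exact: subg0. Qed.

Lemma msub_zero (I : Type) (f : I -> M -> M) : good_ops f -> msub f [set 0].
Proof. by move=> fg; split=> [|i _ ->]; [exact: subg_zero|rewrite op0]. Qed.

(* The chart of a compactly generated open subgroup of [Q] is already onto on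
   [S], so that [Q] is the sum of [S] and of the kernel of the chart. *)
Lemma cocompact_split Q S : closed Q -> subg Q -> closed S -> subg S -> S `<=` Q ->
  bdd S Q -> om_full (@no_ops M) S [set 0] ->
  exists C, [/\ closed C /\ subg C, C `<=` bel Q [set 0], bdd [set 0] C,
    ropen (bel Q [set 0]) C & Q `<=` S `+ C].
Proof.
move=> cQ gQ cS gS SQ [C0 cC0 QC0] omS; have [K0 cK0 nK0] := lcM.
(* Enlarged by [C0] so that [K & Q] meets every coset of [S] in [Q]. *)
pose K := K0 `|` C0.
have cK : compact K by exact: compactU.
have nK : nbhs (0 : M) K by apply: filterS nK0 => x; left.
have gU := subg_zero; have UQ := zero_sub gQ; have US := zero_sub gS.
have [V VE] : exists V, V = hull [set 0] (K `&` Q) by eexists.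
have [n [F chF]] := chart_exists R lcM cK nK cQ gQ c0 gU UQ; rewrite -VE in chF.
have gV : subg V by rewrite VE; exact: hull_subg.
have KV x : K x -> Q x -> V x by move=> Kx Qx; rewrite VE; apply: hull_gen.
have VQ : V `<=` Q := hull_le gQ UQ VE.
have cV : closed V := hull_closed nK cQ gQ UQ VE.
have oV : ropen Q V := hull_ropen nK VE.
have ker v : V v -> F v = 0 <-> bel Q [set 0] v := chart_ker gQ gU UQ VE chF (v := v).
have gB : subg (bel Q [set 0]) by exact: bel_subg.
have cB : closed (bel Q [set 0]) by exact: (bel_closed R lcM).
have QKS x : Q x -> exists c s, [/\ K c, Q c, S s & x = c + s].
  move=> Qx; have [c [s [Cc [Ss xE]]]] := QC0 _ Qx; exists c, s; split=> //; first by right.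
  rewrite (_ : c = x - s); last by rewrite xE; zmod.
  by apply: subgB => //; exact: SQ.
exists (V `&` bel Q [set 0]); split.
- by split; [exact: closedI|exact: subgI].
- by move=> x [].
- exact: (bel_bdd gQ gU UQ VE chF).
- by apply: ropenI; [apply: ropenSl oV => x []|exact: ropen_self].
move=> x /QKS[c [s [Kc Qc Ss ->]]]; have Vc := KV _ Kc Qc.
have [|w [Vw Sw Fw]] := chart_onto cK nK cQ gQ gU UQ VE chF cS gS US SQ omS _ (F c).
  move=> y /VQ /QKS[c' [s' [Kc' Qc' Ss' ->]]]; exists c', s'; split=> //.
exists (s + w), (c - w); split; first exact: subgD.
split; last by zmod.
have Vcw : V (c - w) by exact: subgB.
by split=> //; apply/ker => //; rewrite (chartB gU VE chF) // Fw subrr.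
Qed.

Section ProfiniteCover.
Variables (I : Type) (f : I -> M -> M).
Hypothesis f_good : good_ops f.

Lemma pf_limit Q S S1 : pf f Q S -> closed S1 ->
  (forall O, nbhs (0 : M) O -> exists T, [/\ closed T /\ msub f T, S `<=` T, T `<=` Q,
     fin_over T Q & T `<=` S1 `+ O]) -> Q `<=` S1.
Proof.
move=> pfQ cS1 H x Qx; apply: (closedP S1).1 => // O nO.
have [T [[cT mT] ST TQ finT TO]] := H _ (nbhs0_opp nO).
have [s [ o [Ss [ Oo xE]]]] := TO _ (pfQ _ cT mT ST TQ finT _ Qx).
by exists s => //; rewrite xE (_ : s - (s + o) = - o); last zmod.
Qed.

(** Small finite index submodules [C'] of the profinite [C] give finite index submodules [S + C'] of
    [Q]; each is all of [Q], and they shrink to [S]. *)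
Lemma pf_profinite_cover Q S C : closed Q -> msub f Q -> closed S -> msub f S -> S `<=` Q ->
  pf f Q S -> closed C -> msub f C -> C `<=` Q -> bdd [set 0] C -> wzero f Q [set 0] ->
  Q `<=` S `+ C -> Q `<=` S.
Proof.
move=> cQ mQ cS mS SQ pfQ cC mC CQ bC wQ QSC.
have [[gQ sQ] [gS sS] [gCs sC]] := And3 mQ mS mC.
apply: (pf_limit pfQ cS) => O nO.
have [C' [[cC' mC'] _ C'C finC'] C'O] := wzero_profinite f_good cC mC c0
  (msub_zero f_good) (zero_sub gCs) bC (wzeroS CQ wQ) nO.
have gC' := mC'.1.
exists (S `+ C'); split.
- split; last exact: msub_sum.
  apply: (@closed_sum_bdd _ [set 0]) => //; [exact: subg_zero|exact: zero_sub|exact: zero_sub|].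
  exact: bddS bC.
- exact: sumsetl.
- by apply: sumset_sub => //; exact: subset_trans CQ.
- have [s [_ scov]] := finC'; apply: (@fin_overP _ _ _ s); first exact: subg_sumset.
  move=> _ /QSC[a [c [Sa [Cc ->]]]]; have [y ys Cy] := scov _ Cc; exists y => //.
  by exists a, (c - y); split=> //; split=> //; zmod.
- move=> _ [a [c [Sa [/C'O[ o [_ [ Oo [-> ->]]]] ->]]]].
  by exists a, o; rewrite addr0.
Qed.

End ProfiniteCover.

Lemma cocompact_connected Q S : closed Q -> subg Q -> closed S -> subg S -> S `<=` Q ->
  bdd S Q -> om_full (@no_ops M) S [set 0] -> pf (@no_ops M) Q S ->
  wzero (@no_ops M) Q [set 0] -> Q `<=` S.
Proof.
move=> cQ gQ cS gS SQ bQ omS pfQ wQ.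
have [C [[cC gCs] CB bC oC QSC]] := cocompact_split cQ gQ cS gS SQ bQ omS.
apply: (pf_profinite_cover (@no_ops_good M)) wQ QSC => //; try exact: msub_no_ops.
by move=> x /CB[].
Qed.

End Cocompact.

(** * Half-orbits modulo a cocompact submodule *)

Lemma rev_actK (M : Type) (g : int -> M -> M) : rev_act (rev_act g) = g.
Proof. by apply/funext => i; rewrite /rev_act opprK. Qed.

Section Late.
Variables (M : topologicalZmodType) (g : int -> M -> M).
Hypothesis gD : forall i x y, g i (x + y) = g i x + g i y.
Hypothesis g0 : forall x, g 0 x = x.
Hypothesis gA : forall i j x, g (i + j) x = g i (g j x).
Hypothesis gC : forall i, continuous (g i).
Implicit Types (B C : set M).

Definition core C : set M := [set x | forall i : int, C (g i x)].

Lemma core_msub C : subg C -> msub g (core C).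
Proof.
move=> gCs; split; last by move=> j x Cx i; rewrite -gA.
split=> [i|x y Cx Cy i]; first by rewrite (act0 gD); exact: subg0.
by rewrite (actB gD); exact: subgB.
Qed.

Lemma core_closed C : closed C -> closed (core C).
Proof.
move=> cC x clx i.
suff : closure [set x | C (g i x)] x by move=> /(closed_preact gC cC).
by move: x clx; apply: closureS => y /(_ i).
Qed.

Lemma core_sub C : core C `<=` C.
Proof. by move=> x /(_ 0); rewrite g0. Qed.

Lemma late_subg B C n : subg B -> subg C -> subg (late g B C n).
Proof.
move=> gB gCs; split=> [|x y [Bx Cx] [By Cy]].
  by split=> [|i]; [exact: subg0|rewrite (act0 gD); exact: subg0].
by split=> [|i]; [exact: subgB|rewrite (actB gD); exact: subgB].
Qed.

Lemma late_closed B C n : closed B -> closed C -> closed (late g B C n).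
Proof.
move=> cB cC x clx; split=> [|i].
  by apply: cB; move: x clx; apply: closureS => y [].
suff : closure [set x | C (g (n + i)%N%:Z x)] x by move=> /(closed_preact gC cC).
by move: x clx; apply: closureS => y [_ /(_ i)].
Qed.

Lemma late_bdd U B C n : stable g U -> bdd U C -> bdd U (late g B C n).
Proof.
move=> sU bC; apply: bddS (bdd_act gD gC (- n%:Z) sU bC) => x [_ Cx].
exists (g n%:Z x); first by have := Cx 0%N; rewrite addn0.
by rewrite -gA addNr g0.
Qed.

Lemma late_act B C n (m : nat) x : stable g B -> late g B C n x -> late g B C n (g m%:Z x).
Proof.
move=> sB [Bx Cx]; split=> [|i]; first exact: sB.
by rewrite -gA -PoszD -addnA; exact: Cx.
Qed.

Lemma late_mono B C n m x : late g B C n x -> late g B C (n + m) x.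
Proof. by move=> [Bx Cx]; split=> // i; rewrite -addnA; exact: Cx. Qed.

Lemma core_rev C : core C = [set x | forall i : int, C (rev_act g i x)].
Proof.
apply/seteqP; split=> x Cx i; first exact: Cx.
by have := Cx (- i); rewrite /rev_act opprK.
Qed.

End Late.

Section HalfOrbit.
Variables (R : realType) (M : topologicalZmodType) (g : int -> M -> M).
Hypothesis lcM : exists2 K : set M, compact K & nbhs (0 : M) K.
Hypothesis c0 : closed [set 0 : M].
Hypothesis gD : forall i x y, g i (x + y) = g i x + g i y.
Hypothesis g0 : forall x, g 0 x = x.
Hypothesis gA : forall i j x, g (i + j) x = g i (g j x).
Hypothesis gC : forall i, continuous (g i).
Variables (Q S B C : set M).
Hypotheses (cQ : closed Q) (mQ : msub g Q) (cS : closed S) (mS : msub g S) (SQ : S `<=` Q).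
Hypothesis BE : B = bel Q [set 0].
Hypotheses (cC : closed C) (gCs : subg C) (CB : C `<=` B) (bC : bdd [set 0] C)
  (oC : ropen B C).
Hypotheses (wQ : wzero g Q [set 0]) (om1 : om_full (@no_ops M) S [set 0])
  (omg : om_full g S [set 0]).

Let rgD i x y : rev_act g i (x + y) = rev_act g i x + rev_act g i y. Proof. exact: gD. Qed.
Let rgA := rev_actA gA.
Let rg0 := rev_act0 g0.
Let rgC i : continuous (rev_act g i). Proof. exact: gC. Qed.
Let good := int_ops_good gD g0 gA gC.
Let gZ := subg_zero M.
Let mZ : msub g [set 0]. Proof. exact: msub_zero. Qed.
Let gB : subg B. Proof. by rewrite BE; apply: bel_subg => //; exact: mQ.1. Qed.
Let cB : closed B.
Proof. by rewrite BE; apply: (bel_closed R lcM) => //; [exact: mQ.1|exact: zero_sub mQ.1]. Qed.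
Let sB : stable g B.
Proof. by rewrite BE; apply: bel_stable => //; [exact: mQ.2|exact: mZ.2]. Qed.
Let BQ : B `<=` Q. Proof. by rewrite BE => x []. Qed.
Let bB x : B x -> bdd [set 0] [set y | exists k : int, y = x *~ k].
Proof. by rewrite BE => -[]. Qed.

Let Sm := efwd g B C.
Let Sp := efwd (rev_act g) B C.
Let K0 := core g C.
Let mSm : msub g Sm. Proof. exact: efwd_msub. Qed.
Let mSp : msub g Sp.
Proof. by rewrite -msub_rev; apply: efwd_msub => //; rewrite msub_rev. Qed.
Let mK0 : msub g K0. Proof. exact: core_msub. Qed.
Let cK0 : closed K0. Proof. exact: core_closed. Qed.
Let K0C : K0 `<=` C. Proof. exact: core_sub. Qed.
Let K0m : K0 `<=` fwd g C. Proof. by move=> x Kx i. Qed.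
Let fm : fwd g C `<=` Sm. Proof. exact: fwd_efwd. Qed.
Let bp : bwd g C `<=` Sp. Proof. exact: (fwd_efwd rg0 CB). Qed.

(** The closed submodule generated by [x] is compact, hence profinite; a finite index submodule of
    it inside [C] lies in the core [K0]. *)
Lemma homoclinic_per x : Sm x -> Sp x -> per g K0 x.
Proof.
move=> /(efwdP gA)[n1 [Bx n1P]] /(efwdP rgA)[n2 [_ n2P]]; pose n := (n1 + n2)%N.
pose P := closure (hull [set 0] [set y | exists i : int, y = g i x]).
have mP : msub g P by apply: msub_closure => //; exact: orbit_hull_msub.
have PB : P `<=` B.
  have -> : B = closure B by apply/closure_id.
  apply: closureS; apply: hull_min => //; first exact: zero_sub.
  by move=> _ [i ->]; exact: sB.
have bP : bdd [set 0] P.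
  apply: bdd_closure => //; apply: (bdd_trans gZ bC).
  apply: (orbit_hull_bdd (n := n)) => //; first exact: zero_sub.
  - by move=> i; rewrite /n -addnA; exact: n1P.
  - by move=> i; rewrite /n (addnC n1) -addnA; exact: n2P.
  - by move=> i; apply: bddSU (zero_sub gCs) _; apply: bB; exact: sB.
have Px : P x by apply: subset_closure; apply: hull_gen; exists 0; rewrite g0.
have [ O nO OC] := oC.
have PQ : P `<=` Q by exact: subset_trans BQ.
have [T [[cT [gT sT]] _ TP finT] TO] := wzero_profinite good (@closed_closure _ _) mP c0 mZ
  (zero_sub mP.1) bP (wzeroS PQ wQ) nO.
have TK0 : T `<=` K0.
  move=> y Ty i; apply: OC; split; last by apply: PB; apply: TP; exact: sT.
  by have [ o [_ [ Oo [-> ->]]]] := TO _ (sT i _ Ty); rewrite addr0.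
have [m mPg] := fin_over_pigeon gT finT.
have [i|i [j [/andP[ltij _] Tij]]] := mPg (fun i => g i%:Z x); first exact: mP.2.
have [k k0 Tk] := fin_over_exp gT mP.1 finT.
exists (j - i)%N, k; rewrite subn_gt0; split=> //; last by apply: TK0; exact: Tk.
apply: TK0; apply: (@act_inj_in _ _ g0 gA T i%:Z) => //.
by rewrite (actB gD) -gA -PoszD subnKC // ltnW.
Qed.

Lemma homoclinic_fwd x : Sm x -> Sp x -> fwd g C x -> K0 x.
Proof.
move=> Smx Spx fx i; have [N [k [N0 _ KN _]]] := homoclinic_per Smx Spx.
(* Modulo [K0] the iterate at [i] equals one at a nonnegative time of the same class modulo the
   period. *)
have [j jE] : exists j : nat, i + N%:Z * (absz i)%:Z = j%:Z.
  by exists (absz (i + N%:Z * (absz i)%:Z)); nia.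
have -> : g i x = g j%:Z x - g i (g (N%:Z * (absz i)%:Z) x - x).
  by rewrite (actB gD) -gA jE; zmod.
apply: subgB => //; apply: K0C; apply: mK0.2.
exact: (per_mulz gD g0 gA mK0.1 mK0.2 KN).
Qed.

Lemma homoclinic_bwd x : Sm x -> Sp x -> bwd g C x -> K0 x.
Proof.
move=> Smx Spx fx i; have [N [k [N0 _ KN _]]] := homoclinic_per Smx Spx.
have [j jE] : exists j : nat, i + N%:Z * - (absz i)%:Z = - j%:Z.
  by exists (absz (i + N%:Z * - (absz i)%:Z)); nia.
have -> : g i x = g (- j%:Z) x - g i (g (N%:Z * - (absz i)%:Z) x - x).
  by rewrite (actB gD) -gA jE; zmod.
apply: subgB => //; apply: K0C; apply: mK0.2.
exact: (per_mulz gD g0 gA mK0.1 mK0.2 KN).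
Qed.

Let tidy : ropen B (bwd g C `+ fwd g C).
Proof. by apply: (tidy_above gD g0 gA gC gB sB (U := [set 0])) => //; [exact: mZ.2|exact: zero_sub]. Qed.

(** A small element is a backward part in [C] plus a forward part in [C]; if it is homoclinic, so
    are both parts, which then lie in the core. *)
Lemma homoclinic_open : ropen (Sm `&` Sp) K0.
Proof.
have [ O nO OJ] := tidy; exists O => // x [ Ox [Smx Spx]].
have Bx : B x by have [] := Smx.
have [u [v [bu [fv xE]]]] := OJ _ (conj Ox Bx).
have Smu : Sm u.
  rewrite (_ : u = x - v); last by rewrite xE; zmod.
  by apply: (subgB mSm.1) => //; exact: fm.
have Spv : Sp v.
  rewrite (_ : v = x - u); last by rewrite xE; zmod.
  by apply: (subgB mSp.1) => //; exact: bp.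
rewrite xE; apply: (subgD mK0.1).
  by apply: homoclinic_bwd => //; exact: bp.
by apply: homoclinic_fwd => //; exact: fm.
Qed.

Lemma efwd_closed : closed Sm.
Proof.
apply: (@loc_closed _ Sm (fwd g C)) => //; [exact: closed_fwd|exact: mSm.1|].
have [ O nO OJ] := tidy; exists O => // x [ Ox Smx].
have Bx : B x by have [] := Smx.
have [u [v [bu [fv xE]]]] := OJ _ (conj Ox Bx).
have Smu : Sm u.
  rewrite (_ : u = x - v); last by rewrite xE; zmod.
  by apply: (subgB mSm.1) => //; exact: fm.
rewrite xE; apply: (subgD (subg_fwd gD gCs)) => //; apply: K0m.
by apply: homoclinic_bwd => //; exact: bp.
Qed.

Let CS := C `&` S.
Let SB := S `&` B.
Let OS0 := bwd g CS `+ fwd g CS.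
Let OS := (S `&` Sp) `+ (S `&` Sm).

Let gCS : subg CS. Proof. by apply: subgI => //; exact: mS.1. Qed.
Let OS0_subg : subg OS0.
Proof. by apply: subg_sumset; [exact: subg_bwd|exact: subg_fwd]. Qed.
Let OS0_open : ropen SB OS0.
Proof.
apply: (tidy_above gD g0 gA gC (U := [set 0])) => //.
- by apply: subgI => //; exact: mS.1.
- by move=> i x [Sx Bx]; split; [exact: mS.2|exact: sB].
- exact: mZ.2.
- exact: closedI.
- exact: zero_sub.
- by move=> x [Cx Sx]; split=> //; exact: CB.
- by apply: bddS bC => x [].
- apply: ropenI; last by apply: ropenSl (ropen_self S) => x [].
  by apply: ropenSl oC => x [].
Qed.
Let bCSp : bwd g CS `<=` S `&` Sp.
Proof.
move=> x bx; split; first by have [] := bwd_sub g0 bx.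
by apply: bp => i; have [] := bx i.
Qed.
Let fCSm : fwd g CS `<=` S `&` Sm.
Proof.
move=> x bx; split; first by have [] := fwd_sub g0 bx.
by apply: fm => i; have [] := bx i.
Qed.
Let mOS : msub g OS.
Proof. by apply: msub_sum => //; apply: msubI. Qed.

(** Extend [OS] to the least open [W] meeting the bounded part of [S] in [OS]. By [per_trans],
    [S / (S & per W)] has no finite submodule, so the hypothesis on Omega makes all of [S] periodic
    modulo [W]. *)
Lemma locally_finite x : SB x -> per g OS x.
Proof.
have gS := mS.1; have ZS := zero_sub gS.
have belE : bel S [set 0] = SB.
  rewrite /SB BE; apply/seteqP; split=> y; first by move=> [Sy by_]; do 2 split=> //; exact: SQ.
  by move=> [Sy [_ by_]]; split.
have OSB : OS `<=` bel S [set 0].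
  rewrite belE; apply: sumset_sub; first by apply: subgI.
    by move=> y [Sy [By _]].
  by move=> y [Sy [By _]].
have oOS : ropen (bel S [set 0]) OS.
  by rewrite belE; apply: ropenS OS0_open; exact: sumsetS.
have [W [[gW WS] OW oW WB Wmin]] := bel_extend R lcM cS gS c0 gZ ZS om1 mOS.1
  (zero_sub mOS.1) OSB oOS.
have sW : stable g W.
  move=> j y Wy; suff : W `<=` [set z | S z /\ W (g j z)] by move=> /(_ _ Wy)[].
  apply: Wmin.
  - exact: (subgI gS (subg_preact gD j gW)).
  - move=> z Oz; split; first by have [] := OSB _ Oz.
    by apply: OW; exact: mOS.2.
  - by move=> z [].
  - by apply: ropenI; [exact: ropen_self|exact: (ropen_preact gD gC j mS.2 oW)].
have mper : msub g (per g W) by split; [exact: per_subg|exact: per_stable].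
have SP : S `<=` S `&` per g W.
  apply: omg; split.
  - exact: msubI.
  - by apply: zero_sub; exact: (msubI mS mper).1.
  - by move=> y [].
  - by apply: ropenI; [exact: ropen_self|apply: ropenS oW; exact: per_sub].
  move=> F [gF sF] TF FS finF y Fy; split; first exact: FS.
  have gT := (msubI mS mper).1; have sT := (msubI mS mper).2.
  have [m mPg] := fin_over_pigeon gT finF.
  have [i|i [j [/andP[ltij _] Tij]]] := mPg (fun i => g i%:Z y); first exact: sF.
  have [k k0 Tk] := fin_over_exp gT gF finF.
  apply: (@per_trans _ _ gD g0 gA W y (j - i)%N k) => //; first by rewrite subn_gt0.
    have [] // : (S `&` per g W) (g (j - i)%N%:Z y - y).
    apply: (@act_inj_in _ _ g0 gA _ i%:Z) => //.
    by rewrite (actB gD) -gA -PoszD subnKC // ltnW.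
  by have [] := Tk _ Fy.
move=> [Sx Bx]; have [_ [N [k [N0 k0 WN Wk]]]] := SP _ Sx.
have gbel : subg (bel S [set 0]) by exact: bel_subg.
have bx : bel S [set 0] x by rewrite belE.
exists N, k; split=> //; apply: WB; split=> //; last exact: subgMn.
by apply: subgB => //; rewrite belE; split; [exact: mS.2|exact: sB].
Qed.

Let D0 := K0 `+ (S `&` Sm).
Let mD0 : msub g D0. Proof. by apply: msub_sum => //; exact: msubI. Qed.
Let cD0 : closed D0.
Proof.
have cI : closed (S `&` Sm) by apply: closedI => //; exact: efwd_closed.
have gI : subg (S `&` Sm) := (msubI mS mSm).1.
have -> : D0 = (S `&` Sm) `+ K0.
  by apply/seteqP; split=> _ [x [y [? [? ->]]]]; exists y, x; rewrite addrC.
apply: (@closed_sum_bdd _ [set 0]) => //; [exact: mK0.1|exact: zero_sub| |exact: bddS bC].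
exact: zero_sub mK0.1.
Qed.

Let per_mono X Y : X `<=` Y -> per g X `<=` per g Y.
Proof. by move=> XY x [N [k [? ? /XY ? /XY ?]]]; exists N, k. Qed.

Let K0D0 : K0 `<=` D0.
Proof. by apply: sumsetl; exact: (msubI mS mSm).1. Qed.

(** [g N phi - phi] and [phi *+ k] also split inside [S]; two splittings of one element differ by
    homoclinic elements, which are periodic modulo [K0]. *)
Lemma split_per phi p q : SB phi -> Sp p -> Sm q -> phi = p + q -> per g D0 q.
Proof.
move=> Sphi Spp Smq phiE; have [N [k [N0 k0 ON Ok]]] := locally_finite Sphi.
have SmD : S `&` Sm `<=` D0 by apply: sumsetr; exact: mK0.1.
have gper : subg (per g D0) by apply: per_subg => //; [exact: mD0.1|exact: mD0.2].
have aux w z : OS (z + w) -> Sp z -> Sm w -> per g D0 w.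
  move=> [a [b [[Sa Spa] [[Sb Smb] zwE]]]] Spz Smw.
  rewrite (_ : w = (w - b) + b); last by zmod.
  apply: (subgD gper); last by apply: per_sub => //; [exact: mD0.1|exact: mD0.2|exact: SmD].
  apply: (per_mono K0D0); apply: homoclinic_per; first exact: (subgB mSm.1).
  rewrite (_ : w - b = a - z); first exact: (subgB mSp.1).
  by rewrite (_ : w = z + w - z); [rewrite zwE; zmod|zmod].
apply: (@per_trans _ _ gD g0 gA D0 q N k) => //; [exact: mD0.1|exact: mD0.2| |].
  apply: (aux _ (g N%:Z p - p)).
  - by rewrite (_ : _ + _ = g N%:Z phi - phi) // phiE gD; zmod.
  - by apply: (subgB mSp.1) => //; exact: mSp.2.
  - by apply: (subgB mSm.1) => //; exact: mSm.2.
apply: (aux _ (p *+ k)).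
- by rewrite -mulrnDl -phiE.
- exact: (subgMn mSp.1).
- exact: (subgMn mSm.1).
Qed.

Let common_period (s : seq M) : (forall t, t \in s -> per g D0 t) ->
  exists2 N : nat, (0 < N)%N & forall t, t \in s -> D0 (g N%:Z t - t).
Proof.
elim: s => [|t s IHs] ps; first by exists 1%N.
have [N N0 NP] := IHs (fun y ys => ps y (mem_behead (s := t :: s) ys)).
have [N' [_ [N'0 _ DN' _]]] := ps t (mem_head _ _).
exists (N' * N)%N; first by rewrite muln_gt0 N'0.
move=> y; rewrite inE => /predU1P[->|/NP Dy]; rewrite PoszM.
  exact: (per_mulz gD g0 gA mD0.1 mD0.2 DN').
by rewrite mulrC; exact: (per_mulz gD g0 gA mD0.1 mD0.2 Dy).
Qed.

(* Decomposing [g^-1 x] for [x] in [Lm] involves only finitely many cosets; if [N]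
   is a common period of these, then [Lm `<=` g Lm `+ D1] for the closed subgroup
   [D1] of points [N]-periodic modulo [D0].  Iterating gives [Lm `<=` K0 `+ D1], as
   the intersection of the [g^m Lm] lies in [K0]. *)
Lemma late_periodic n :
  (forall q, Q q -> exists s v u,
     [/\ S s, late (rev_act g) B C n v, late g B C n u & q = s + v + u]) ->
  exists2 N : nat, (0 < N)%N & forall x, late g B C n x -> (S `+ K0) (g N%:Z x - x).
Proof.
move=> dec; pose Lm := late g B C n; pose Lp := late (rev_act g) B C n.
have gLm : subg Lm by exact: late_subg.
have gLp : subg Lp by exact: late_subg.
have bLm : bdd [set 0] Lm by apply: late_bdd => //; exact: mZ.2.
have bLp : bdd [set 0] Lp by apply: late_bdd => //; rewrite stable_rev; exact: mZ.2.
have LmB : Lm `<=` B by move=> x [].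
have LpB : Lp `<=` B by move=> x [].
have LmS : Lm `<=` Sm by move=> x Lx; apply/(efwdP gA); exists n.
have LpS : Lp `<=` Sp by move=> x Lx; apply/(efwdP rgA); exists n.
have gS := mS.1; have gSB : subg SB by exact: subgI.
have [Phi [PhiS Phicov]] : fin_over OS0 (SB `&` ((g (-1) @` Lm) `+ [set x | Lp (- x)] `+ [set x | Lm (- x)])).
  apply: (@bdd_fin _ [set 0] SB) => //; [exact: zero_sub|exact: zero_sub|].
  apply: (@bddS _ _ _ ((g (-1) @` Lm) `+ [set x | Lp (- x)] `+ [set x | Lm (- x)])).
    by move=> x [].
  do 2 (apply: bddD => //; last exact: bddN).
  by apply: bdd_act => //; exact: mZ.2.
have /choice[pq pqP] : forall phi, exists r : M * M, (Sp `+ Sm) phi ->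
    [/\ Sp r.1, Sm r.2 & phi = r.1 + r.2].
  move=> phi; have [[p [q [? [? ?]]]]|?] := pselect ((Sp `+ Sm) phi); last by exists (0, 0).
  by exists (p, q).
pose Phip := [seq (pq phi).1 | phi <- Phi]; pose Phim := [seq (pq phi).2 | phi <- [seq phi <- Phi | `[< (Sp `+ Sm) phi >]]].
(* The error left after replacing [phi] by its chosen splitting is homoclinic and bounded, so it too
   takes finitely many values modulo [K0]. *)
have [Psi [PsiB Psicov]] : fin_over K0 ((Sm `&` Sp) `&` ([set x | x \in Phip] `+ C `+ Lp)).
  apply: (@bdd_fin _ [set 0] (Sm `&` Sp)) => //.
  - exact: subgI mSm.1 mSp.1.
  - exact: mK0.1.
  - exact: zero_sub mK0.1.
  - by apply: zero_sub; exact: subgI mSm.1 mSp.1.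
  - apply: (@bddS _ _ _ ([set x | x \in Phip] `+ C `+ Lp)); first by move=> x [].
    by do 2 apply: bddD => //; exact: bdd_seq.
  - exact: homoclinic_open.
have perD : forall t, t \in Phim ++ Psi -> per g D0 t.
  move=> t; rewrite mem_cat => /orP[/mapP[phi + ->]|/PsiB[[Smt Spt] _]]; last first.
    by apply: (per_mono K0D0); exact: homoclinic_per.
  rewrite mem_filter => /andP[/asboolP h /PhiS[SBphi _]].
  by have [h1 h2 h3] := pqP _ h; exact: (split_per SBphi h1 h2 h3).
have [N N0 NP] := common_period perD.
pose D1 := [set x | D0 (g N%:Z x - x)].
have gD1 : subg D1.
  split; first by rewrite /D1 /= (act0 gD) subrr; exact: (subg0 mD0.1).
  move=> x y Dx Dy; rewrite /D1 /= (actB gD).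
  by rewrite (_ : _ - _ = (g N%:Z x - x) - (g N%:Z y - y)); [exact: (subgB mD0.1)|zmod].
have sD1 : stable g D1.
  by move=> i x Dx; rewrite /D1 /= (actC gA) -(actB gD); exact: mD0.2.
have D0D1 : D0 `<=` D1.
  by move=> x Dx; apply: (subgB mD0.1) => //; exact: mD0.2.
have cD1 : closed D1.
  apply: (@closed_comp _ _ (fun x => g N%:Z x - x) D0) => // x _.
  apply: (@continuous_comp _ _ _ (fun y => (g N%:Z y, y)) (fun p : M * M => p.1 - p.2)).
    by apply: cvg_pair => /=; [exact: gC|exact: cvg_id].
  exact: sub_continuous.
have step x : Lm x -> exists2 u, Lm u & D1 (x - g 1 u).
  move=> Lx; have Bx := LmB _ Lx.
  have [s [v [u [Ss Lv Lu xE]]]] := dec _ (BQ (sB (-1) Bx)).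
  have sE : s = g (-1) x + - v + - u by rewrite xE; zmod.
  have SBs : SB s.
    split=> //; rewrite sE; apply: subgB => //; last exact: LmB.
    by apply: subgB => //; [exact: sB|exact: LpB].
  have [|phi phiP [cp [cm [bcp [fcm sphi]]]]] := Phicov s.
    split=> //; exists (g (-1) x + - v), (- u); split; last first.
      by split=> //=; rewrite opprK.
    exists (g (-1) x), (- v); split; first by exists x.
    by split=> //=; rewrite opprK.
  have [Scp Spcp] := bCSp bcp; have [Scm Smcm] := fCSm fcm.
  have phiE : phi = (- v - cp) + (g (-1) x - u - cm).
    rewrite (_ : phi = s - (s - phi)); last by zmod.
    by rewrite sphi sE; zmod.
  have phiO : (Sp `+ Sm) phi.
    exists (- v - cp), (g (-1) x - u - cm); split.
      by apply: (subgB mSp.1) => //; apply: (subgN mSp.1); exact: LpS.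
    split=> //; apply: (subgB mSm.1) => //; apply: (subgB mSm.1); last exact: LmS.
    by apply: mSm.2; exact: LmS.
  have [Spp Smq pqE] := pqP _ phiO; set p := (pq phi).1 in Spp pqE; set q := (pq phi).2 in Smq pqE.
  pose y := g (-1) x - u - cm - q.
  have yE : y = p + cp + v.
    rewrite /y (_ : q = phi - p); last by rewrite pqE; zmod.
    by rewrite phiE; zmod.
  have [|psi psiP Kpsi] := Psicov y.
    split; first split.
    - apply: (subgB mSm.1) => //; apply: (subgB mSm.1) => //.
      by apply: (subgB mSm.1); [apply: mSm.2|]; exact: LmS.
    - rewrite yE; apply: (subgD mSp.1); last exact: LpS.
      exact: (subgD mSp.1).
    - rewrite yE; exists (p + cp), v; split=> //; exists p, cp; split.
        by apply/mapP; exists phi.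
      by split=> //; have [] := bwd_sub g0 bcp.
  exists u => //; rewrite (_ : x - g 1 u = g 1 (cm + q + psi + (y - psi))).
    apply: sD1; apply: (subgD gD1); last exact/D0D1/K0D0.
    apply: (subgD gD1); last by apply: NP; rewrite mem_cat psiP orbT.
    apply: (subgD gD1).
      by apply: D0D1; apply: sumsetr => //; exact: mK0.1.
    apply: NP; rewrite mem_cat; apply/orP; left; apply/mapP; exists phi => //.
    by rewrite mem_filter phiP andbT; apply/asboolP.
  rewrite (_ : cm + q + psi + (y - psi) = g (-1) x - u); last by rewrite /y; zmod.
  by rewrite (actB gD) -gA subrr g0.
have iter (m : nat) x : Lm x -> exists2 u, Lm u & D1 (x - g m%:Z u).
  elim: m => [|m IHm] Lx; first by exists x => //; rewrite g0 subrr; exact: subg0.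
  have [u Lu Du] := IHm Lx; have [w Lw Dw] := step _ Lu; exists w => //.
  rewrite (_ : x - _ = (x - g m%:Z u) + g m%:Z (u - g 1 w)).
    by apply: (subgD gD1) => //; exact: sD1.
  by rewrite (actB gD) -gA -PoszD addn1; zmod.
exists N => // x Lx.
suff Dx : D1 x.
  have [k [t [Kk [[St _] ->]]]] := Dx; exists t, k.
  by split=> //; split=> //; rewrite addrC.
have cLm : closed Lm by exact: late_closed.
(* A point of all the sets [g m Lm] congruent to [x] modulo [D1]; at each time [i] its orbit is seen
   to be in [C] by taking [m] large. *)
have [||||z zP] := @bdd_directed _ [set 0] Lm
    [set [set z | Lm (g (- m%:Z) z) /\ D1 (x - z)] | m in [set: nat]] gZ bLm.
- split; first by exists [set z | Lm (g (- 0%N%:Z) z) /\ D1 (x - z)], 0%N.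
  move=> _ _ [a _ <-] [b _ <-].
  exists [set z | Lm (g (- (a + b)%N%:Z) z) /\ D1 (x - z)]; first by exists (a + b)%N.
  move=> z [Lz Dz]; split; split=> //.
    rewrite (_ : - a%:Z = b%:Z + - (a + b)%N%:Z); last by lia.
    by rewrite gA; exact: late_act.
  rewrite (_ : - b%:Z = a%:Z + - (a + b)%N%:Z); last by lia.
  by rewrite gA; exact: late_act.
- move=> _ [m _ <-]; apply: closedI; first exact: (closed_preact gC cLm).
  apply: (@closed_comp _ _ (fun c => x - c) D1) => // y _.
  apply: (@continuous_comp _ _ _ (fun y => (x, y)) (fun p : M * M => p.1 - p.2)).
    by apply: cvg_pair => /=; [exact: cvg_cst|exact: cvg_id].
  exact: sub_continuous.
- by move=> _ y _ [m _ <-] h ->; rewrite addr0.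
- move=> _ [m _ <-]; have [u Lu Du] := iter m _ Lx; exists (g m%:Z u); first exact: late_act.
  by split=> //=; rewrite -gA addNr g0.
have zm m := zP _ (ex_intro2 _ _ m I erefl).
have Kz : K0 z.
  move=> i; have [[_ Cz] _] := zm (absz i + n)%N.
  have := Cz (absz (i + (absz i)%:Z)); rewrite -gA.
  by rewrite (_ : (n + _)%N%:Z + _ = i) //; lia.
rewrite (_ : x = x - z + z); last by zmod.
by apply: (subgD gD1); [exact: (zm 0%N).2|apply: D0D1; exact: K0D0].
Qed.

End HalfOrbit.

(** * Cocompact parafinite extensions for one automorphism *)

Section CocompactAutomorphism.
Variables (R : realType) (M : topologicalZmodType) (g : int -> M -> M).
Hypothesis lcM : exists2 K : set M, compact K & nbhs (0 : M) K.
Hypothesis c0 : closed [set 0 : M].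
Hypothesis gD : forall i x y, g i (x + y) = g i x + g i y.
Hypothesis g0 : forall x, g 0 x = x.
Hypothesis gA : forall i j x, g (i + j) x = g i (g j x).
Hypothesis gC : forall i, continuous (g i).
Implicit Types (Q S : set M).

Lemma om_full_rev : om_full (rev_act g) = om_full g.
Proof. by rewrite /om_full /om_mem msub_rev pd_rev. Qed.

(** [S] and the half-bounded elements generate a submodule of finite index, hence [Q]. By
    [late_periodic] in both directions of time, some power of [g] is trivial on [Q / (S + K0)]; this
    gives [Q = S + K0], and [K0] is a profinite module. *)
Lemma cocompact_automorphism Q S : closed Q -> msub g Q -> closed S -> msub g S -> S `<=` Q ->
  bdd S Q -> om_full (@no_ops M) S [set 0] -> om_full g S [set 0] ->
  wzero (@no_ops M) Q [set 0] -> wzero g Q [set 0] -> pf g Q S -> Q `<=` S.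
Proof.
move=> cQ mQ cS mS SQ bQ om1 omg w1 wg pfQ.
have [[gQ sQ] [gS sS]] := (mQ, mS).
have good := int_ops_good gD g0 gA gC.
have rgD i x y : rev_act g i (x + y) = rev_act g i x + rev_act g i y by exact: gD.
have rgA := rev_actA gA; have rg0 := rev_act0 g0.
have rgC i : continuous (rev_act g i) by exact: gC.
have gZ := subg_zero M; have mZ := msub_zero good.
have [C [[cC gCs] CB bC oC QSC]] := cocompact_split R lcM c0 cQ gQ cS gS SQ bQ om1.
have [B BE] : exists B, B = bel Q [set 0] by eexists.
rewrite -BE in CB oC.
have gB : subg B by rewrite BE; exact: bel_subg.
have sB : stable g B by rewrite BE; apply: bel_stable => //; exact: mZ.2.
have BQ : B `<=` Q by rewrite BE => x [].
have mB : msub g B by [].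
pose Sm := efwd g B C; pose Sp := efwd (rev_act g) B C.
have mSm : msub g Sm by exact: efwd_msub.
have mSp : msub g Sp.
  by rewrite -msub_rev; apply: efwd_msub => //; rewrite msub_rev.
pose J := bwd g C `+ fwd g C.
have gb := subg_bwd gD gCs; have gf := subg_fwd gD gCs.
have gJ : subg J by exact: subg_sumset.
have oJ : ropen B J.
  by apply: (tidy_above gD g0 gA gC gB sB (U := [set 0])) => //; [exact: mZ.2|exact: zero_sub].
have bJ : bdd [set 0] J.
  apply: bddD => //; apply: bddS bC; [exact: bwd_sub|exact: fwd_sub].
have cJ : closed J.
  apply: (@closed_sum_bdd _ [set 0]) => //.
  - exact: closed_bwd.
  - exact: closed_fwd.
  - exact: zero_sub.
  - exact: zero_sub.
  - by apply: bddS bC; exact: fwd_sub.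
have fm : fwd g C `<=` Sm by exact: fwd_efwd.
have bp : bwd g C `<=` Sp by exact: (fwd_efwd rg0 CB).
have finJ : fin_over (S `+ J) Q.
  have [s [_ scov]] : fin_over J C.
    apply: (@bdd_fin _ [set 0] B) => //; exact: zero_sub.
  apply: (@fin_overP _ _ _ s); first exact: subg_sumset.
  move=> _ /QSC[a [c [Sa [Cc ->]]]]; have [y ys Jy] := scov _ Cc; exists y => //.
  by exists a, (c - y); split=> //; split=> //; zmod.
have cSJ : closed (S `+ J).
  by apply: (@closed_sum_bdd _ [set 0]) => //; exact: zero_sub.
have gSJ : subg (S `+ J) by exact: subg_sumset.
pose G := S `+ (Sp `+ Sm).
have mG : msub g G by do 2 apply: msub_sum => //.
have SJG : S `+ J `<=` G by apply: sumsetS => //; exact: sumsetS.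
have GQ : G `<=` Q.
  by apply: sumset_sub => //; apply: sumset_sub => // x [/BQ].
have QG : Q `<=` G.
  apply: pfQ => //.
  - apply: (fin_over_closed cSJ gSJ mG.1 SJG).
    exact: fin_overS finJ.
  - by apply: sumsetl; apply: subg_sumset; [exact: mSp.1|exact: mSm.1].
  - by apply: fin_overS finJ => //; exact: mG.1.
(* Finitely many coset representatives need only one common time [n], and elements of [J] are
   controlled from time zero. *)
have [n dec] : exists n, forall q, Q q -> exists s v u,
    [/\ S s, late (rev_act g) B C n v, late g B C n u & q = s + v + u].
  have [s [sQ' scov]] := finJ.
  have [n nP] : exists n, forall q, q \in s -> exists a v u,
      [/\ S a, late (rev_act g) B C n v, late g B C n u & q = a + v + u].
    elim: s sQ' {scov} => [|y s IHs] sQ'; first by exists 0%N.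
    have [n nP] := IHs (fun z zs => sQ' z (mem_behead (s := y :: s) zs)).
    have [a [_ [Sa [[v [u [Spv [Smu ->]]]] yE]]]] := QG _ (sQ' _ (mem_head _ _)).
    have [n1 Lv] := (efwdP rgA B C v).1 Spv; have [n2 Lu] := (efwdP gA B C u).1 Smu.
    exists (n + (n1 + n2))%N => q; rewrite inE => /predU1P[->|/nP[a' [v' [u' [Sa' Lv' Lu' ->]]]]].
      exists a, v, u; split=> //; last by rewrite yE; zmod.
      - by rewrite addnC -addnA; exact: late_mono.
      - by rewrite addnCA addnC -addnA addnC -addnA; exact: late_mono.
    by exists a', v', u'; split=> //; exact: late_mono.
  exists n => q /scov[y ys [a' [_ [Sa' [[b [f [bb [ff ->]]]] qE]]]]].
  have [a [v [u [Sa Lv Lu yE]]]] := nP _ ys.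
  exists (a + a'), (v + b), (u + f); split.
  - exact: subgD.
  - apply: (subgD (late_subg rgD n gB gCs)) => //.
    by split=> [|i]; [apply: CB; exact: (bwd_sub g0)|exact: bb].
  - apply: (subgD (late_subg gD n gB gCs)) => //.
    by split=> [|i]; [apply: CB; exact: (fwd_sub g0)|exact: ff].
  - by rewrite (_ : q = y + (q - y)); [rewrite qE yE; zmod|zmod].
pose K0 := core g C.
have mK0 : msub g K0 by exact: core_msub.
have cK0 : closed K0 by exact: core_closed.
have K0C : K0 `<=` C by exact: core_sub.
have bK0 : bdd [set 0] K0 by exact: bddS bC.
pose S1 := S `+ K0.
have mS1 : msub g S1 by exact: msub_sum.
have [gS1 sS1] := mS1.
have cS1 : closed S1.
  by apply: (@closed_sum_bdd _ [set 0]) => //; [exact: mK0.1|exact: zero_sub|exact: zero_sub mK0.1].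
have [N1 N10 N1P] := late_periodic R lcM c0 gD g0 gA gC cQ mQ cS mS SQ BE cC gCs CB bC oC
  wg om1 omg dec.
have [N2 N20 N2P] : exists2 N : nat, (0 < N)%N &
    forall x, late (rev_act g) B C n x -> S1 (g N%:Z x - x).
  have [|||||N2 N20 N2P] := @late_periodic R M (rev_act g) lcM c0 rgD rg0 rgA rgC Q S B C
    cQ _ cS _ SQ BE cC gCs CB bC oC _ om1 _ n _; rewrite ?msub_rev ?wzero_rev ?om_full_rev //.
    rewrite rev_actK => q /dec[a [v [u [Sa Lv Lu ->]]]]; exists a, u, v; split=> //; zmod.
  exists N2 => // x /N2P; rewrite -[core (rev_act g) C]/[set x | forall i : int, C (rev_act g i x)].
  rewrite -core_rev -/K0 -/S1 => h.
  have := per_mulz gD g0 gA gS1 sS1 h (-1).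
  by rewrite mulrN1 opprK.
pose N := (N1 * N2)%N; have N0 : (0 < N)%N by rewrite muln_gt0 N10.
have NP q : Q q -> S1 (g N%:Z q - q).
  move=> /dec[a [v [u [Sa /N2P Sv /N1P Su ->]]]].
  rewrite !gD (_ : _ - _ = (g N%:Z a - a) + (g N%:Z v - v) + (g N%:Z u - u)); last by zmod.
  apply: (subgD gS1); [apply: (subgD gS1)|].
  - by apply: sumsetl; [exact: mK0.1|apply: subgB => //; exact: sS].
  - by rewrite /N mulnC PoszM; exact: (per_mulz gD g0 gA gS1 sS1 Sv).
  - by rewrite /N PoszM; exact: (per_mulz gD g0 gA gS1 sS1 Su).
have CQ : C `<=` Q by exact: subset_trans BQ.
have S1Q : S1 `<=` Q by apply: sumset_sub => //; exact: subset_trans CQ.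
have QS1 : Q `<=` S1.
  apply: (pf_limit pfQ cS1) => O nO.
  have [C' [[cC' [gC' _]] _ C'C finC'] C'O] := wzero_profinite (@no_ops_good M) cC
    (msub_no_ops gCs) c0 (msub_no_ops gZ) (zero_sub gCs) bC (wzeroS CQ w1) nO.
  pose T0 := S1 `+ C'.
  have gT0 : subg T0 by exact: subg_sumset.
  have cT0 : closed T0.
    apply: (@closed_sum_bdd _ [set 0]) => //; [exact: zero_sub|exact: zero_sub|exact: bddS bC].
  have S1T0 : S1 `<=` T0 by exact: sumsetl.
  have ST0 : S `<=` T0 by apply: subset_trans S1T0; apply: sumsetl; exact: mK0.1.
  have finT0 : fin_over T0 Q.
    have [s [_ scov]] := finC'; apply: (@fin_overP _ _ _ s) => //.
    move=> _ /QSC[a [c [Sa [Cc ->]]]]; have [y ys Cy] := scov _ Cc; exists y => //.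
    exists a, (c - y); split; last by split=> //; zmod.
    by apply: sumsetl => //; exact: mK0.1.
  (* As [g N] is the identity modulo [S1], which [T0] contains, [N] conditions already make the
     subgroup stable while keeping its index finite. *)
  pose Tj (j : nat) := [set x | Q x /\ forall i : nat, (i < j)%N -> T0 (g i%:Z x)].
  have gTj j : subg (Tj j).
    split=> [|x y [Qx Tx] [Qy Ty]].
      by split=> [|i _]; [exact: subg0|rewrite (act0 gD); exact: (subg0 gT0)].
    split=> [|i lti]; first exact: subgB.
    by rewrite (actB gD); apply: (subgB gT0); [exact: Tx|exact: Ty].
  have finTj j : fin_over (Tj j) Q.
    elim: j => [|j IHj].
      apply: (@fin_overP _ _ _ [:: 0]) => // x Qx; exists 0; rewrite ?mem_head // subr0.
      by split.
    have finp : fin_over [set x | T0 (g j%:Z x)] Q.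
      have [s [_ scov]] := finT0.
      apply: (@fin_cells _ _ _ _ s (fun y x => T0 (g j%:Z x - y))) => [x Qx|].
        by apply: scov; exact: sQ.
      move=> y x x' Tx Tx' _ _ /=.
      rewrite (actB gD) (_ : _ - _ = (g j%:Z x - y) - (g j%:Z x' - y)); last by zmod.
      exact: (subgB gT0).
    have gp := subg_preact gD j%:Z gT0.
    apply: fin_overS (fin_overI (gTj j) gp IHj finp) => // x [[Qx Tx] Txj]; split=> // i.
    by rewrite ltnS leq_eqVlt => /predU1P[->//|]; exact: Tx.
  exists (Tj N); split=> //.
  - split.
      move=> x clx; split=> [|i lti].
        by apply: cQ; move: x clx; apply: closureS => y [].
      suff : closure [set x | T0 (g i%:Z x)] x by move=> /(closed_preact gC cT0).
      by move: x clx; apply: closureS => y [_ /(_ i lti)].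
    split=> //; apply: (int_stable g0 gA) => x [Qx Tx]; split; try exact: sQ.
      move=> i lti; rewrite -gA -PoszD addn1; move: lti; rewrite leq_eqVlt => /predU1P[->|].
        rewrite (_ : g N%:Z x = (g N%:Z x - x) + x); last by zmod.
        apply: (subgD gT0); first by apply: S1T0; exact: NP.
        by have := Tx 0%N N0; rewrite g0.
      exact: Tx.
    move=> [|i] lti; rewrite -gA.
      rewrite add0r (_ : g (-1) x = g N.-1%:Z x - g (-1) (g N%:Z x - x)).
        apply: (subgB gT0); first by apply: Tx; rewrite prednK.
        by apply: S1T0; apply: sS1; exact: NP.
      rewrite (actB gD) -gA (_ : -1 + N%:Z = N.-1%:Z); [zmod|by move: N0; lia].
    by rewrite (_ : i.+1%:Z + -1 = i%:Z); [apply: Tx; exact: ltnW|lia].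
  - by move=> x Sx; split=> [|i _]; [exact: SQ|apply: ST0; exact: sS].
  - by move=> x [].
  - move=> x [_ /(_ 0%N N0)]; rewrite g0 => -[a [c [Sa [/C'O[ o [_ [ Oo [-> ->]]]] ->]]]].
    by exists a, o; rewrite addr0.
apply: (pf_profinite_cover c0 good cQ mQ cS mS SQ pfQ cK0 mK0) => //.
exact: subset_trans CQ.
Qed.

End CocompactAutomorphism.

(** * Reduction to cyclic acting groups *)

Section CompactlyGeneratedAction.
Variables (R : realType) (A M : topologicalZmodType) (act : A -> M -> M).
Hypothesis lcM : exists2 K : set M, compact K & nbhs (0 : M) K.
Hypothesis c0 : closed [set 0 : M].
Hypothesis act_cont : continuous (fun p : A * M => act p.1 p.2).
Hypothesis actD : forall a x y, act a (x + y) = act a x + act a y.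
Hypothesis act1 : forall x, act 0 x = x.
Hypothesis actA : forall a b x, act (a + b) x = act a (act b x).
Hypothesis cgA : compactly_generated A.
Implicit Types (C E L O P Q S T U : set M) (a b : A).

Let aZ a : act a 0 = 0.
Proof. by apply: (addrI (act a 0)); rewrite -actD !addr0. Qed.
Let aN a x : act a (- x) = - act a x.
Proof. by apply: (addrI (act a x)); rewrite -actD !subrr aZ. Qed.
Let aB a x y : act a (x - y) = act a x - act a y.
Proof. by rewrite actD aN. Qed.

Lemma act_continuous a : continuous (act a).
Proof.
move=> x; apply: (@continuous_comp _ _ _ (fun y => (a, y)) (fun p : A * M => act p.1 p.2)).
  by apply: cvg_pair => /=; [exact: cvg_cst|exact: cvg_id].
exact: act_cont.
Qed.

Lemma act_continuousl x : continuous (act^~ x).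
Proof.
move=> a; apply: (@continuous_comp _ _ _ (fun b => (b, x)) (fun p : A * M => act p.1 p.2)).
  by apply: cvg_pair => /=; [exact: cvg_id|exact: cvg_cst].
exact: act_cont.
Qed.

(** The action is jointly continuous, so a compact set of generators is equicontinuous at zero. *)
Lemma act_good : good_ops act.
Proof.
split=> //; have [C [cC gen]] := cgA; pose J := C `|` [set a | C (- a)].
have cJ : compact J by apply: compactU => //; exact: compactN.
exists J; split=> [S gS SJ a x Sx|O nO].
  have [s [sC ->]] := gen a.
  elim: s sC => [|c s IHs] sC; first by rewrite big_nil act1.
  rewrite big_cons actA; apply: SJ; first exact: sC (mem_head _ _).
  by apply: IHs => d ds; apply: sC; rewrite inE ds orbT.
have nP : nbhs (0 : M) [set x | J `<=` [set a | O (act a x)]].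
  move/compact_near_coveringP: cJ => cJ.
  apply: (cJ _ (nbhs (0 : M)) (fun x a => O (act a x))) => a Ja.
  have /= := @act_cont (a, 0 : M) O; rewrite aZ => /(_ nO)[[P Q] /= [nP nQ] PQ].
  by exists (P, Q) => //= -[b y] [Pb Qy]; apply: (PQ (b, y)).
by exists [set x | J `<=` [set a | O (act a x)]] => // a x Ja; exact.
Qed.

Lemma act_inv a : exists b, forall x, act b (act a x) = x /\ act a (act b x) = x.
Proof. by exists (- a) => x; rewrite -!actA addNr addrN act1. Qed.

Definition cyc a : int -> M -> M := fun i => act (a *~ i).

Let cD a i x y : cyc a i (x + y) = cyc a i x + cyc a i y. Proof. exact: actD. Qed.
Let c1 a x : cyc a 0 x = x. Proof. by rewrite /cyc mulr0z. Qed.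
Let cA a i j x : cyc a (i + j) x = cyc a i (cyc a j x).
Proof. by rewrite /cyc mulrzDr actA. Qed.
Let cC a i : continuous (cyc a i). Proof. exact: act_continuous. Qed.
Let cgood a : good_ops (cyc a). Proof. exact: int_ops_good. Qed.
Let cyc_stable a S : stable act S -> stable (cyc a) S.
Proof. by move=> sS i x; exact: sS. Qed.
Let cyc_msub a S : msub act S -> msub (cyc a) S.
Proof. by move=> [gS sS]; split=> //; exact: cyc_stable. Qed.

Section Transfers.
Variables L U : set M.
Hypotheses (cL : closed L) (mL : msub act L) (mU : msub act U) (UL : U `<=` L).

Lemma om_full_cyc a : om_full act L U -> om_full (cyc a) L U.
Proof.
apply: (om_full_transfer act_good act_continuous act_inv (cgood a)) => //.
  by move=> S _; exact: cyc_stable.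
by move=> b i x; rewrite /cyc -!actA addrC.
Qed.

Lemma om_full_triv : om_full act L U -> om_full (@no_ops M) L U.
Proof. by apply: (om_full_transfer act_good act_continuous act_inv (@no_ops_good M)) => // S _ _ []. Qed.

Hypothesis cU : closed U.

Lemma wzero_cyc a : wzero act L U -> wzero (cyc a) L U.
Proof.
apply: (wzero_transfer act_good act_continuous act_inv (cgood a)) => //.
  by move=> S _; exact: cyc_stable.
by move=> b i x; rewrite /cyc -!actA addrC.
Qed.

Lemma wzero_triv : wzero act L U -> wzero (@no_ops M) L U.
Proof. by apply: (wzero_transfer act_good act_continuous act_inv (@no_ops_good M)) => // S _ _ []. Qed.

End Transfers.

(* [E / U] is torsion and each of its elements is periodic under each [a], hence,
   [A] being compactly generated, has a finite orbit. *)
Theorem discrete_trivial U E : msub act U -> closed E -> msub act E -> U `<=` E ->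
  ropen E U -> pd act E U -> om_full act setT U -> wzero act setT E -> E `<=` U.
Proof.
move=> mU cE mE UE oU pdE omU wE.
have [[gU sU] [gE sE]] := (mU, mE).
have cU : closed U by exact: ropen_closed cE gE gU UE oU.
have cT : closed [set: M] by exact: closedT.
have mT : msub act [set: M] by [].
have om1 : om_full (@no_ops M) setT U by exact: om_full_triv.
have w1 : wzero (@no_ops M) setT E by exact: wzero_triv.
have tE : tors E U.
  (* [E / E1] is torsion free and discrete, so the torsion-free case makes it zero. *)
  pose E1 := [set x | E x /\ exists2 k, (0 < k)%N & U (x *+ k)].
  have UE1 : U `<=` E1 by move=> u Uu; split; [exact: UE|exists 1%N].
  have gE1 : subg E1.
    split; first by apply: UE1; exact: subg0.
    move=> x y [Ex [k k0 Uk]] [Ey [l l0 Ul]]; split; first exact: subgB.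
    exists (k * l)%N; first by rewrite muln_gt0 k0.
    rewrite mulrnBl; apply: subgB => //; first by rewrite mulrnA; exact: subgMn.
    by rewrite mulnC mulrnA; exact: subgMn.
  have E1E : E1 `<=` E by move=> x [].
  have oE1 : ropen E E1 by exact: ropenS oU.
  have cE1 : closed E1 by exact: ropen_closed cE gE gE1 E1E oE1.
  suff EE1 : E `<=` E1 by move=> x /EE1[].
  apply: (discrete_torsionfree_trivial R lcM cE1 gE1 cE gE E1E oE1) => //.
    move=> x k Ex k0 [_ [l l0 Ul]]; split=> //; exists (k * l)%N; first by rewrite muln_gt0 k0.
    by rewrite mulrnA.
  exact: om_fullS om1.
have perE a : E `<=` per (cyc a) U.
  have mUa := cyc_msub a mU; have mEa := cyc_msub a mE.
  have mper : msub (cyc a) (per (cyc a) U).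
    by split; [apply: per_subg => //; exact: mUa.2|apply: per_stable => //; exact: mUa.2].
  (* [E / U] may have finite submodules under [a] alone; they all lie in [Ea], and by [per_trans] no
     new ones appear in [E / Ea]. *)
  pose Ea := E `&` per (cyc a) U.
  have mEa' : msub (cyc a) Ea by exact: msubI.
  have UEa : U `<=` Ea.
    by move=> u Uu; split; [exact: UE|apply: per_sub => //; exact: mUa.2].
  have EaE : Ea `<=` E by move=> x [].
  have oEa : ropen E Ea by exact: ropenS oU.
  have cEa : closed Ea by exact: ropen_closed cE gE mEa'.1 EaE oEa.
  suff : E `<=` Ea by move=> h x /h[].
  refine (discrete_torsion_trivial R lcM (cD a) (c1 a) (cA a) (@cC a) cEa mEa' cE mEa EaE oEa _ _ _ _ _ _).
  - by move=> x /tE[k k0 Uk]; exists k => //; exact: UEa.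
  - move=> F [gF sF] EaF FE finF x Fx; split; first exact: FE.
    have [m mPg] := fin_over_pigeon mEa'.1 finF.
    have [i|i [j [/andP[ltij _] Tij]]] := mPg (fun i => cyc a i%:Z x); first exact: sF.
    have [k k0 Uk] := tE _ (FE _ Fx).
    apply: (@per_trans _ _ (cD a) (c1 a) (cA a) U x (j - i)%N k) => //.
    + exact: mUa.2.
    + by rewrite subn_gt0.
    + have [] // : Ea (cyc a (j - i)%N%:Z x - x).
      apply: (@act_inj_in _ _ (c1 a) (cA a) Ea i%:Z) => //; first exact: mEa'.2.
      by rewrite (actB (cD a)) -cA -PoszD subnKC // ltnW.
    + by apply: per_sub => //; exact: mUa.2.
  - exact: om_fullS om1.
  - exact: (om_fullS UEa (om_full_cyc cT mT mU (fun _ _ => I) (a := a) omU)).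
  - exact: w1.
  - exact: wzero_cyc.
move=> x Ex.
pose St := [set a | U (act a x - x)].
have gSt : subg St.
  split; first by rewrite /St /= act1 subrr; exact: subg0.
  move=> a b Ua Ub; rewrite /St /=.
  have -> : act (a - b) x - x = act (- b) ((act a x - x) - (act b x - x)).
    rewrite (_ : act a x - x - _ = act a x - act b x); last by zmod.
    by rewrite aB -!actA addNr act1 [- b + a]addrC.
  by apply: sU; exact: subgB.
have [C [cC' gen]] := cgA.
have nSt : nbhs (0 : A) St.
  have [ O nO OU] := oU.
  have nx : nbhs (act 0 x) [set y | O (y - x)] by rewrite act1; exact: nbhs0_shift.
  have nA : nbhs (0 : A) [set a | O (act a x - x)] by exact: (act_continuousl nx).
  apply: filterS nA => a /= Oa; apply: OU; split=> //.
  by apply: subgB => //; exact: sE.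
(* The stabiliser [St] of [x] modulo [U] is open, so [A] is generated by it and finitely many
   elements, each with a positive multiple in [St]: the index is finite. *)
have [s _ scov] := compact_cover0 cC' nSt.
have [r [_ rcov]] : fin_over St [set: A].
  apply: (@fin_overS _ St _ (gspan St s)) => //.
    have gG := gspan_subg s gSt.
    move=> a _; have [t [tC ->]] := gen a.
    have CG c : C c -> gspan St s c.
      move=> /scov[y ys Sty]; rewrite (_ : c = c - y + y); last by zmod.
      by apply: subgD => //; [exact: gspan_sub|exact: gspan_mem].
    elim: t tC => [|c t IHt] tC; first by rewrite big_nil; exact: subg0.
    rewrite big_cons; apply: subgD => //; last first.
      by apply: IHt => d dt; apply: tC; rewrite inE dt orbT.
    have [/CG//|/CG] := tC c (mem_head _ _); rewrite -{2}[c]opprK; exact: subgN.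
  apply: fin_gspan => // a _; have [N [_ [N0 _ UN _]]] := perE a _ Ex.
  by exists N.
pose z := [seq act b x | b <- r].
have orb a : gspan U z (act a x).
  have [b br Stb] := rcov a I.
  rewrite (_ : act a x = act b (act (a - b) x - x) + act b x); last first.
    by rewrite aB -actA addrC [b + _]addrC subrK subrKC.
  apply: (subgD (gspan_subg z gU)); first by apply: gspan_sub; exact: sU.
  by apply: gspan_mem => //; apply/mapP; exists b.
suff : gspan U z `<=` U by apply; rewrite -[x]act1.
apply: pdE.
- split; first exact: gspan_subg.
  move=> a; apply: (@gspan_min _ U z [set y | gspan U z (act a y)]).
  + split=> [|y y' Gy Gy'] /=; first by rewrite aZ; exact: (subg0 (gspan_subg z gU)).
    by rewrite aB; exact: (subgB (gspan_subg z gU)).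
  + by move=> u Uu; apply: gspan_sub; exact: sU.
  + by move=> _ /mapP[b _ ->] /=; rewrite -actA.
- exact: gspan_sub.
- by apply: gspan_min => // _ /mapP[b _ ->]; exact: sE.
- by apply: fin_gspan => // _ /mapP[b _ ->]; apply: tE; exact: sE.
Qed.

(** Modulo the submodule [S], an element of [T] is represented in a compact set, whose points all
    move by little when [a] is near zero. *)
Lemma nbhs_stable Q S T : msub act Q -> msub act S -> subg T -> S `<=` T -> T `<=` Q ->
  bdd S Q -> ropen Q T -> nbhs (0 : A) [set a | forall x, T x -> T (act a x)].
Proof.
move=> [gQ sQ] [gS sS] gT ST TQ [C cC' QC] [ O nO OT].
have [ O' [nO' O'D _]] := nbhs0_split nO.
have nA : nbhs (0 : A) [set a | C `<=` [set c | O (act a c - c)]].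
  move/compact_near_coveringP: cC' => cC'.
  apply: (cC' _ (nbhs (0 : A)) (fun a c => O (act a c - c))) => c Cc.
  have /= := @act_cont (0, c) [set y | O' (y - c)].
  rewrite act1 => /(_ (nbhs0_shift c nO'))[[P P'] /= [nP nP'] PP'].
  exists (P' `&` [set c' | O' (c - c')], P) => /=.
    by split=> //; apply: filterI => //; exact: nbhs0_shiftN.
  move=> [c' a] /= [[P'c' Oc'] Pa].
  rewrite (_ : act a c' - c' = (act a c' - c) + (c - c')); last by zmod.
  by apply: O'D => //; exact: (PP' (a, c')).
apply: filterS nA => a aC x Tx.
have [c [s [Cc [Ss xE]]]] := QC _ (TQ _ Tx).
have Tc : T c by rewrite (_ : c = x - s); [apply: subgB => //; exact: ST|rewrite xE; zmod].
have -> : act a x = (act a c - c) + c + act a s by rewrite xE actD; zmod.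
apply: (subgD gT); last by apply: ST; exact: sS.
apply: (subgD gT) => //; apply: OT; split; first exact: aC.
by apply: (subgB gQ); [apply: sQ|]; exact: TQ.
Qed.

(* [Q / S] is profinite, even as a module over each cyclic subgroup of [A]; a
   neighbourhood of [0] in [A] stabilises a given open subgroup, and finitely many
   cyclic subgroups take care of the rest of a compact set of generators. *)
Theorem cocompact_trivial Q S : closed Q -> msub act Q -> closed S -> msub act S ->
  S `<=` Q -> bdd S Q -> pf act Q S -> om_full act S [set 0] -> wzero act Q [set 0] ->
  Q `<=` S.
Proof.
move=> cQ mQ cS mS SQ bQ pfQ omS wQ.
have [[gQ sQ] [gS sS]] := (mQ, mS).
have m0 : msub act [set 0] := msub_zero act_good.
have om1 : om_full (@no_ops M) S [set 0] by apply: om_full_triv => //; exact: zero_sub.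
have wz1 : wzero (@no_ops M) Q [set 0] by apply: wzero_triv => //; exact: zero_sub.
(* A compact parafinite [P / S] is itself an instance of the known case of the theorem, so it is
   zero. *)
have w1 : wzero (@no_ops M) Q S.
  move=> P [[cP [gP _]] SP PQ bP pfP].
  exact: (cocompact_connected R lcM c0 cP gP cS gS SP bP om1 pfP (wzeroS PQ wz1)).
have wc a : wzero (cyc a) Q S.
  have oma : om_full (cyc a) S [set 0] by apply: om_full_cyc => //; exact: zero_sub.
  have wza : wzero (cyc a) Q [set 0] by apply: wzero_cyc => //; exact: zero_sub.
  move=> P [[cP mP] SP PQ bP pfP].
  exact: (cocompact_automorphism R lcM c0 (cD a) (c1 a) (cA a) (@cC a) cP mP cS
    (cyc_msub a mS) SP bP om1 oma (wzeroS PQ wz1) (wzeroS PQ wza) pfP).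
move=> x Qx; apply: contrapT => nSx.
have [ O nO OS] := closed_nmem cS nSx.
have [S1 [[cS1 [gS1 _]] SS1 S1Q finS1] S1O] := wzero_profinite (@no_ops_good M) cQ
  (msub_no_ops gQ) cS (msub_no_ops gS) SQ bQ w1 (nbhs0_opp nO).
have nS1x : ~ S1 x.
  move=> /S1O[ o [s [/= Oo [Ss xE]]]]; apply: (OS _ Oo).
  by rewrite (_ : x - o = s) // xE; zmod.
pose N := [set a | forall y, S1 y -> S1 (act a y)].
have nN : nbhs (0 : A) (N `&` [set a | N (- a)]).
  have nN : nbhs (0 : A) N by apply: (nbhs_stable (S := S) mQ) => //; exact: fin_ropen.
  by apply: filterI => //; exact: nbhs0_opp.
have [C [cC' gen]] := cgA.
have [s _ scov] := compact_cover0 cC' nN.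
(* The elements [b] are treated one by one: intersecting all translates of [T] under [b] keeps
   finite index because [Q / S] is profinite over [b], and keeps earlier stability because [A] is
   commutative. *)
have [T [[cT gT] ST TS1 finT [Ts TN]]] : exists T, [/\ closed T /\ subg T, S `<=` T, T `<=` S1,
    fin_over T Q & (forall b, b \in s -> stable (cyc b) T) /\
      forall a y, N a -> T y -> T (act a y)].
  elim: s {scov} => [|b s [T [[cT gT] ST TS1 finT [Ts TN]]]].
    by exists S1; split=> //; split=> // a y; exact.
  have TQ : T `<=` Q by exact: subset_trans S1Q.
  have [ O2 nO2 O2T] : ropen Q T by exact: fin_ropen.
  have [T1 [[cT1 [gT1 sT1]] ST1 T1Q finT1] T1O] := wzero_profinite (cgood b) cQ
    (cyc_msub b mQ) cS (cyc_msub b mS) SQ bQ (wc b) nO2.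
  have T1T : T1 `<=` T.
    move=> y T1y; have [ o [u [ Oo [Su yE]]]] := T1O _ T1y.
    rewrite yE; apply: (subgD gT); last exact: ST.
    apply: O2T; split=> //; rewrite (_ : o = y - u); last by rewrite yE; zmod.
    by apply: (subgB gQ); [exact: T1Q|exact: SQ].
  pose T2 := [set y | forall i, T (cyc b i y)].
  have T2T : T2 `<=` T by move=> y /(_ 0); rewrite c1.
  have gT2 : subg T2.
    split=> [i|y z Ty Tz i] /=; first by rewrite /cyc aZ; exact: subg0.
    by rewrite /cyc aB; apply: (subgB gT); [exact: Ty|exact: Tz].
  have T12 : T1 `<=` T2 by move=> y T1y i; apply: T1T; exact: sT1.
  have T2Q : T2 `<=` Q by exact: subset_trans TQ.
  exists T2; split.
  - by split=> //; apply: (@fin_over_closed _ T1) => //; exact: fin_overS finT1.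
  - exact: subset_trans T12.
  - exact: subset_trans TS1.
  - exact: fin_overS finT1.
  - split=> [d|a y Na Ty i]; last by rewrite /cyc -actA addrC actA; apply: TN => //; exact: Ty.
    rewrite inE => /predU1P[->|ds] j y Ty i; first by rewrite -cA.
    by rewrite /cyc -actA addrC actA; apply: (Ts d ds j); exact: Ty.
suff mT : msub act T.
  by apply: nS1x; apply: (TS1); exact: (pfQ T cT mT ST (subset_trans TS1 S1Q) finT).
split=> // a y Ty; have [t [tC ->]] := gen a.
elim: t tC => [|c t IHt] tC; first by rewrite big_nil act1.
rewrite big_cons actA.
have {IHt} : T (act (\sum_(d <- t) d) y).
  by apply: IHt => d dt; apply: tC; rewrite inE dt orbT.
move: (act _ y) => {}y {}Ty.
have [/scov[b bs [Nb _]]|/scov[b bs [_ Nb]]] := tC c (mem_head _ _).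
  have -> : act c y = cyc b 1 (act (c - b) y) by rewrite /cyc mulr1z -actA addrC subrK.
  by apply: (Ts b bs); exact: TN.
have -> : act c y = cyc b (- 1) (act (- (- c - b)) y).
  by rewrite /cyc mulrNz mulr1z -actA; congr act; zmod.
by apply: (Ts b bs); exact: TN.
Qed.

End CompactlyGeneratedAction.

(** * Sheer submodules *)

Section OmegaAndW.
Variables (M : topologicalZmodType) (I : Type) (f : I -> M -> M).
Hypothesis f_good : good_ops f.
Implicit Types (G K L P S T U : set M).

(** [L' / (L' & T)] embeds into [L / T]: a finite submodule [F] of the former is carried to
    [F + T]. *)
Lemma om_mem_restrict L L' U T : msub f L -> msub f L' -> U `<=` L' -> L' `<=` L ->
  om_mem f L U T -> om_mem f L' U (L' `&` T).
Proof.
move=> mL mL' UL' L'L [mT UT TL oT pdT]; split=> //.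
- exact: msubI.
- by move=> u Uu; split; [exact: UL'|exact: UT].
- by apply: ropenI; [exact: ropen_self|exact: ropenSl oT].
- move=> F mF TF FL' finF x Fx; split; first exact: FL'.
  have /(_ x) : F `+ T `<=` T.
    apply: pdT; first exact: msub_sum.
    - by apply: sumsetr; exact: mF.1.
    - by apply: sumset_sub => //; [exact: mL.1|exact: subset_trans L'L].
    - by apply: fin_over_sum finF; [exact: (msubI mL' mT).1|exact: mT.1|move=> y []].
  by apply; apply: sumsetl Fx; exact: mT.1.
Qed.

Lemma om_mem_trans L U S T : msub f L -> om_mem f L U S -> om_mem f S U T -> om_mem f L U T.
Proof.
move=> mL [mS US SL oS pdS] [mT UT TS oT pdT]; split=> //.
- exact: subset_trans SL.
- exact: ropen_trans oT.
- move=> F mF TF FL finF.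
  suff FS : F `<=` S by exact: pdT.
  have FSS : F `+ S `<=` S.
    apply: pdS; first exact: msub_sum.
    - by apply: sumsetr; exact: mF.1.
    - by apply: sumset_sub => //; exact: mL.1.
    - by apply: fin_over_sum finF; [exact: mT.1|exact: mS.1|].
  by apply: subset_trans FSS; apply: sumsetl; exact: mS.1.
Qed.

Lemma w_mem_trans L K P Q : msub f K -> w_mem f L K P -> w_mem f L P Q -> w_mem f L K Q.
Proof.
move=> mK [[cP mP] KP PL bP pfP] [[cQ mQ] PQ QL bQ pfQ]; split=> //.
- exact: subset_trans PQ.
- by apply: bdd_trans bQ => //; exact: mK.1.
- move=> S cS mS KS SQ finS.
  have PS : P `<=` S.
    by apply: (pf_sub mP mK.1 pfP cP cS mS KS KP); apply: fin_overS finS => //; exact: mS.1.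
  exact: pfQ.
Qed.

End OmegaAndW.

Section Subquotients.
Variables (A M : topologicalZmodType) (act : A -> M -> M).
Hypothesis lcM : exists2 K : set M, compact K & nbhs (0 : M) K.
Hypothesis act_good : good_ops act.
Implicit Types (G K L P S T U : set M).

Lemma submodP S : submod act S <-> msub act S.
Proof. by split=> [[S0 [SB Sa]]|[[S0 SB] Sa]]. Qed.

Lemma closed_submodP S : closed_submod act S <-> closed S /\ msub act S.
Proof. by split=> -[cS /submodP]. Qed.

Lemma quot_finiteP L S : quot_finite L S <-> fin_over S L.
Proof.
split=> [[F [/finite_seqP[s ->] [sL Ls]]]|[s [sL Ls]]].
  exists s; split=> // x /Ls[y [z [ys [Sz ->]]]]; exists y => //.
  by rewrite (_ : y + z - y = z) //; zmod.
exists [set` s]; split; first exact: finite_seq.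
split=> // x /Ls[y ys Sy]; exists y, (x - y); do 2!split=> //; zmod.
Qed.

Lemma rel_openP L S : subg L -> subg S -> S `<=` L -> rel_open L S <-> ropen L S.
Proof.
move=> gL gS SL; split=> [[V [ oV VL]]|[ O nO OS]].
  exists V; last by rewrite VL.
  by apply: open_nbhs_nbhs; split=> //; have := subg0 gS; rewrite -VL => -[].
exists (interior O `+ S); split; first by apply: open_sumset; exact: open_interior.
apply/seteqP; split=> [_ [[ o [s [ Oo [Ss ->]]]] Los]|x Sx].
  apply: (subgD gS) => //; apply: OS; split; first exact: interior_subset.
  by rewrite (_ : o = o + s - s); [apply: (subgB gL) => //; exact: SL|zmod].
split; last exact: SL.
by exists 0, x; rewrite add0r; split=> //; exact: nbhs_interior.
Qed.

Lemma quot_compactP L K : closed L -> subg L -> subg K -> K `<=` L ->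
  quot_compact L K <-> bdd K L.
Proof.
move=> cL gL gK KL; split=> [qL|[C cC LC] J U oU LU].
  have [C cC nC] := lcM.
  have [||F [finF LF]] := qL M (fun i => interior [set y | C (y - i)]).
  - by move=> i; exact: open_interior.
  - move=> x Lx; exists x => //; exists x, 0; rewrite addr0; split; last by split=> //; exact: subg0.
    exact: nbhs0_shift.
  exists (F `+ C); first by apply: compactD => //; exact: finite_compact.
  move=> _ /LF[i Fi [y [k [/interior_subset /= Cy [Kk ->]]]]].
  by exists y, k; split=> //; exists i, (y - i); do 2!split=> //; zmod.
have [i0 _ _] := LU _ (subg0 gL).
have /choice[h hP] : forall x, exists i, L x -> (U i `+ K) x.
  move=> x; have [/LU[i _ Ui]|nLx] := pselect (L x); first by exists i.
  by exists i0.
have cCL : compact (C `&` L) by exact: compact_closedI.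
have [|s sC scov] := compact_cover_seq (N := fun x => U (h x) `+ K) cCL.
  by move=> x [_ Lx]; apply: open_nbhs_nbhs; split; [exact: open_sumset|exact: hP].
exists (h @` [set` s]); split; first by apply: finite_image; exact: finite_seq.
move=> x Lx; have [c [k [Cc [Kk xE]]]] := LC _ Lx.
have Lc : L c by rewrite (_ : c = x - k); [apply: (subgB gL) => //; exact: KL|rewrite xE; zmod].
have [y ys [u [k' [Uu [Kk' cE]]]]] := scov _ (conj Cc Lc).
exists (h y); first by exists y.
exists u, (k' + k); split=> //; split; first exact: subgD.
by rewrite xE cE; zmod.
Qed.

Lemma purely_discreteP L S : msub act L -> msub act S -> S `<=` L ->
  purely_discrete act L S <-> ropen L S /\ pd act L S.
Proof.
move=> mL mS SL; rewrite /purely_discrete /quot_discrete (rel_openP mL.1 mS.1 SL).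
split=> -[ oS pdS]; split=> // F.
  by move=> mF SF FL finF; rewrite (pdS F) //; [exact/submodP|exact/quot_finiteP].
move=> /submodP mF [SF FL] /quot_finiteP finF; apply/seteqP; split=> //.
exact: pdS.
Qed.

Lemma compact_parafiniteP P K : closed P -> msub act P -> msub act K -> K `<=` P ->
  compact_parafinite act P K <-> bdd K P /\ pf act P K.
Proof.
move=> cP mP mK KP; rewrite /compact_parafinite (quot_compactP cP mP.1 mK.1 KP).
split=> -[bP pfP]; split=> // S.
  by move=> cS mS KS SP finS; rewrite (pfP S) //; [exact/closed_submodP|exact/quot_finiteP].
move=> /closed_submodP[cS mS] [KS SP] /quot_finiteP finS; apply/seteqP; split=> //.
exact: pfP.
Qed.

Lemma Omega_preE L K : closed L -> msub act L -> K `<=` L ->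
  Omega_pre act L K = [set x | forall S, om_mem act L K S -> S x].
Proof.
move=> cL mL KL; have [_ _ OmL _ _] := omega_open act_good lcM cL mL KL.
apply/seteqP; split=> [x [Lx xP] S [mS KS SL oS pdS]|x xP].
  apply: xP => //; first exact/submodP.
    by apply/rel_openP => //; [exact: mL.1|exact: mS.1].
  exact/purely_discreteP.
split; first exact: OmL.
move=> S /submodP mS [KS SL] _ /(purely_discreteP mL mS SL)[ oS pdS].
by apply: xP; split.
Qed.

Lemma Wflat_preE L K G : msub act L -> msub act K -> w_mem act L K G ->
  (forall P, w_mem act L K P -> P `<=` G) -> Wflat_pre act L K = G.
Proof.
move=> mL mK memG GP; have [[cG mG] KG GL bG pfG] := memG.
apply/seteqP; split=> [_ [n [S [memS [k [z [Kk [sz ->]]]]]]]|x Gx].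
  apply: (subgD mG.1); first exact: KG.
  elim: n memS z sz => [|n IHn] memS z; first by move=> ->; exact: subg0 mG.1.
  move=> [y [w [sy [Sw ->]]]]; apply: (subgD mG.1).
    by apply: IHn sy => i ltin; apply: memS; exact: ltnW.
  have [/closed_submodP[cS mS] [[KS SL] /(compact_parafiniteP cS mS mK KS)[bS pfS]]] :=
    memS n (ltnSn n).
  by apply: GP Sw; split.
exists 1%N, (fun=> G); split=> [i _|]; last first.
  exists 0, x; split; first exact: subg0 mK.1.
  by split; [exists 0, x; rewrite add0r|rewrite add0r].
by split; [exact/closed_submodP|split=> //; exact/compact_parafiniteP].
Qed.

Hypothesis c0 : closed [set 0 : M].

Lemma sheerP L : closed L -> msub act L ->
  sheer act L [set 0] <-> wzero act L [set 0] /\ om_full act L [set 0].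
Proof.
move=> cL mL; have m0 := msub_zero act_good; have zL := zero_sub mL.1.
have [G memG GP] := w_greatest act_good lcM cL mL c0 m0 zL.
rewrite /sheer (Wflat_preE mL m0 memG GP) (Omega_preE cL mL zL).
split=> -[wL omL]; split.
- by move=> P /GP; rewrite wL.
- by move=> S memS x; rewrite -omL; exact.
- by apply/seteqP; split; [exact: wL|have [] := memG].
- apply/seteqP; split; first by have [] := omega_open act_good lcM cL mL zL.
  by move=> x Lx S memS; exact: omL Lx.
Qed.

End Subquotients.

(** * Sheer submodules below and above a closed submodule *)

Theorem mainTheorem8 (A M : topologicalZmodType) (act : A -> M -> M) :
  LC_module act -> compactly_generated A ->
  sheer act [set: M] [set 0] ->
  (forall N : set M, closed_submod act N ->
     [/\ Nminus act N `<=` N /\ N `<=` Nplus act N,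
         purely_discrete act N (Nminus act N),
         compact_parafinite act (Nplus act N) N,
         (closed_submod act (Nminus act N) /\ sheer act (Nminus act N) [set 0] /\
          forall S : set M, closed_submod act S -> sheer act S [set 0] ->
            Nminus act N `<=` S -> S `<=` N -> S = Nminus act N) &
         (closed_submod act (Nplus act N) /\ sheer act (Nplus act N) [set 0] /\
          forall S : set M, closed_submod act S -> sheer act S [set 0] ->
            N `<=` S -> S `<=` Nplus act N -> S = Nplus act N)]) /\
  (forall N1 N2 : set M, closed_submod act N1 -> closed_submod act N2 ->
     N1 `<=` N2 ->
     Nminus act N1 `<=` Nminus act N2 /\ Nplus act N1 `<=` Nplus act N2).

Proof.
move=> [_ [[hM lM] [act_cont [actD [act1 actA]]]]] cgA shM.
have c0 : closed [set 0 : M] by apply: accessible_closed_set1; exact: hausdorff_accessible.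
have lcM : exists2 K : set M, compact K & nbhs (0 : M) K.
  by have [K nK [cK _]] := lM 0 I; exists K => //; rewrite -[nbhs _]withinET.
have good : good_ops act by exact: act_good.
have m0 := msub_zero good.
have cT : closed [set: M] by exact: closedT.
have mT : msub act [set: M] by [].
have [wM omM] := (sheerP lcM good c0 cT mT).1 shM.
have minusP N : closed N -> msub act N -> om_mem act N [set 0] (Nminus act N) /\
    forall S, om_mem act N [set 0] S -> Nminus act N `<=` S.
  move=> cN mN; have zN := zero_sub mN.1.
  rewrite /Nminus (Omega_preE lcM good cN mN zN); split; first exact: omega_open.
  by move=> S memS x; exact.
have plusP N : closed N -> msub act N -> w_mem act setT N (Nplus act N) /\
    forall P, w_mem act setT N P -> P `<=` Nplus act N.
  move=> cN mN; have [//|G memG GP] := w_greatest good lcM cT mT cN mN.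
  by rewrite /Nplus (Wflat_preE lcM mT mN memG GP).
split=> [N /closed_submodP[cN mN]|N1 N2 /closed_submodP[cN1 mN1] /closed_submodP[cN2 mN2] N12].
  have zN := zero_sub mN.1.
  have [memU Umin] := minusP N cN mN; have [mU zU UN oU pdU] := memU.
  have [memE Emax] := plusP N cN mN; have [[cE mE] NE _ bE pfE] := memE.
  set U := Nminus act N in memU Umin mU zU UN oU pdU *.
  set E := Nplus act N in memE Emax cE mE NE bE pfE *.
  have cU : closed U by exact: ropen_closed cN mN.1 mU.1 UN oU.
  (* An extension of compact parafinite modules is again one, so [E] absorbs whatever is compact
     parafinite modulo [E]. *)
  have wE : wzero act setT E by move=> P /(w_mem_trans mN memE) /Emax.
  split=> //.
  - exact/purely_discreteP.
  - exact/compact_parafiniteP.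
  - split; first exact/closed_submodP.
    split.
      apply/sheerP => //; split; first exact: wzeroS wM.
      by move=> S /(om_mem_trans good mN memU) /Umin.
    move=> S /closed_submodP[cS mS] /(sheerP lcM good c0 cS mS)[_ omS] US SN.
    apply/seteqP; split=> // x Sx.
    (* [S & U] is open in [S] with purely discrete quotient; since Omega (S) = S, it is all of
       [S]. *)
    have memSU := om_mem_restrict good mN mS (zero_sub mS.1) SN memU.
    by have [] := omS _ memSU _ Sx.
  - split; first exact/closed_submodP.
    split.
      apply/sheerP => //; split; first exact: wzeroS wM.
      (* An open [S] with [E / S] purely discrete falls under the first vanishing statement, as W (M
         / E) = 0 and Omega (M / S) = M / S. *)
      move=> S [mS zS SE oS pdS].
      apply: (discrete_trivial Rdefinitions.R lcM act_cont actD act1 actA cgA mS cE) => //.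
      exact: om_fullS omM.
    move=> S /closed_submodP[cS mS] /(sheerP lcM good c0 cS mS)[_ omS] NS SE.
    apply/seteqP; split=> //.
    apply: (cocompact_trivial Rdefinitions.R lcM c0 act_cont actD act1 actA cgA cE mE cS) => //.
    + exact: bddSU bE.
    + by move=> T cT' mT' ST; apply: pfE => //; exact: subset_trans ST.
    + exact: wzeroS wM.
have [memU1 U1min] := minusP N1 cN1 mN1; have [memU2 _] := minusP N2 cN2 mN2.
have [memE1 _] := plusP N1 cN1 mN1; have [_ E2max] := plusP N2 cN2 mN2.
split.
  have /U1min : om_mem act N1 [set 0] (N1 `&` Nminus act N2).
    exact: (om_mem_restrict good mN2 mN1 (zero_sub mN1.1) N12 memU2).
  by move=> U12 x /U12[].
have /E2max E12 : w_mem act setT N2 (Nplus act N1 `+ N2).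
  exact: w_mem_sum memE1.
by apply: subset_trans E12; apply: sumsetl; exact: mN2.1.
Qed.
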